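(* Let $N$ be a compact Calabi--Yau $3$-manifold (real dimension $6$) with Kähler form $\omega$ and nowhere-vanishing holomorphic $(3,0)$-form $\Upsilon$, let $M^7=N\times S^1$, and let $A\in\mathbb{R}$. Suppose $(\omega_t,\Upsilon_t)$ is a smooth family of compatible $\mathrm{SU}(3)$-structures on $N$ with $\omega_0=\omega$, $\Upsilon_0=\Upsilon$, satisfying $$\frac{\partial}{\partial t}\omega_t=-\mathcal{L}_{\nabla_t(\log|\Upsilon_t|_{\omega_t})}\omega_t+\beta_t,\qquad \frac{\partial}{\partial t}\Upsilon_t=\mathcal{L}_{\nabla_t(\log|\Upsilon_t|_{\omega_t})}\Upsilon_t+\gamma_t,$$ where $\beta_t\in\Omega^2(N)$ and $\gamma_t\in\Omega^3(N)$ (complex-valued in the case of $\gamma_t$). Let $\{\varphi_t\}$ be the family of $\mathrm{G}_2$-structures on $M$ given by $$\varphi_t=\mathrm{Re}\left(\frac{1}{|\Upsilon_t|_{\omega_t}}\Upsilon_t\right)+|\Upsilon_t|_{\omega_t}\,dr\wedge\omega_t .$$ Then $\{\varphi_t\}$ is a solution of the modified Laplacian coflow with constant $A$ if, and only if, for all $t$, $$\beta_t\wedge\omega_t=-A\,\frac{1}{|\Upsilon_t|_{\omega_t}}\,d(\log|\Upsilon_t|_{\omega_t})\wedge\mathrm{Re}(\Upsilon_t),\qquad \mathrm{Im}(\gamma_t)=A\,|\Upsilon_t|_{\omega_t}\,d(\log|\Upsilon_t|_{\omega_t})\wedge\omega_t .$$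
   Context: Calabi--Yau $3$-manifold here means a complex $3$-fold with a Kähler form $\omega$ and a nowhere-vanishing holomorphic $(3,0)$-form $\Upsilon$ (so $d\omega=0$, $d\Upsilon=0$); $\omega$ is not assumed Ricci-flat. The function $|\Upsilon|_\omega>0$ is defined by $\frac{\omega^3}{3!}=\frac{i}{8}\frac{1}{|\Upsilon|_\omega^2}\Upsilon\wedge\overline{\Upsilon}$. A family of compatible $\mathrm{SU}(3)$-structures $(\omega_t,\Upsilon_t)$ means: for each $t$ there is a complex structure $J_t$ on $N$ for which $\omega_t$ is a Kähler form and $\Upsilon_t$ is a nowhere-vanishing holomorphic $(3,0)$-form. $\nabla_t f$ denotes the gradient of $f$ with respect to the Kähler metric of $\omega_t$ and $\mathcal{L}$ is the Lie derivative. $r$ is the angle coordinate on $S^1$, $dr$ the standard $1$-form; forms on $N$ and $S^1$ are pulled back to $M$. A $\mathrm{G}_2$-structure $\varphi\in\Omega^3(M^7)$ determines a metric $g_\varphi$ and volume form $\mathrm{vol}_\varphi$ by $(X\lrcorner\varphi)\wedge(Y\lrcorner\varphi)\wedge\varphi=6g_\varphi(X,Y)\mathrm{vol}_\varphi$, a Hodge star $\ast_\varphi$, the dual $4$-form $\psi=\ast_\varphi\varphi$, and the scalar torsion $\tau_0=\frac17\ast_\varphi(\varphi\wedge d\varphi)$. A family $\varphi_t$ solves the modified Laplacian coflow with constant $A\in\mathbb{R}$ if $\psi_t=\ast_t\varphi_t$ satisfies $$\frac{\partial}{\partial t}\psi_t=\Delta_t\psi_t+d\Big(\big(A-\tfrac72(\tau_0)_t\big)\varphi_t\Big),$$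 where $\Delta_t=dd^{\ast_t}+d^{\ast_t}d$ is the Hodge Laplacian of $g_{\varphi_t}$. *)

(* Defs.v *)
From HB Require Import structures.
From mathcomp Require Import all_boot all_order all_algebra all_fingroup.
From mathcomp Require Import all_classical all_reals all_analysis.
From mathcomp Require Export complex.

Set Implicit Arguments.
Unset Strict Implicit.
Unset Printing Implicit Defensive.

Import Order.TTheory GRing.Theory Num.Theory.
Import numFieldNormedType.Exports.

Local Open Scope classical_set_scope.
Local Open Scope ring_scope.
Local Open Scope complex_scope.

(** * Calculus on subsets of R^m *)

(* The limit is taken over the increments that stay in [D]; for open [D] this
   is the usual partial derivative, for a product of an interval with an open
   set it is one-sided at the end points of the interval. *)
Definition has_partial (R : realType) m (D : set 'rV[R]_m) (f : 'rV[R]_m -> R)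
    (j : 'I_m) (x : 'rV[R]_m) (l : R) : Prop :=
  h^-1 * (f (x + h *: delta_mx 0 j) - f x)
    @[h --> within [set h : R | D (x + h *: delta_mx 0 j)] 0^'] --> l.

Fixpoint Ck (R : realType) m (k : nat) (D : set 'rV[R]_m) (f : 'rV[R]_m -> R)
    {struct k} : Prop :=
  {within D, continuous f} /\
  (if k is k'.+1 then
     exists g : 'I_m -> 'rV[R]_m -> R, forall j,
       (forall x, D x -> has_partial D f j x (g j x)) /\ Ck k' D (g j)
   else True).

Definition smooth_on (R : realType) m (D : set 'rV[R]_m) (f : 'rV[R]_m -> R) :=
  forall k, Ck k D f.

Definition smooth_map_on (R : realType) m n (D : set 'rV[R]_m)
    (F : 'rV[R]_m -> 'rV[R]_n) :=
  forall j, smooth_on D (fun x => F x 0 j).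

(* Derivative at [t] of a function of time defined on the interval [T]. *)
Definition has_tderiv (R : realType) (T : set R) (f : R -> R) (t l : R) : Prop :=
  h^-1 * (f (t + h) - f t) @[h --> within [set h : R | T (t + h)] 0^'] --> l.

(** * Manifolds *)

Record charts (R : realType) (n : nat) (M : Type) := Charts {
  cidx : Type;
  cdom : cidx -> set M;
  ccoord : cidx -> M -> 'rV[R]_n;
  cinv : cidx -> 'rV[R]_n -> M }.

Definition cimg (R : realType) n (M : Type) (X : charts R n M) (i : cidx X) :
  set 'rV[R]_n := ccoord i @` cdom i.

Definition trans (R : realType) n (M : Type) (X : charts R n M)
  (i j : cidx X) : 'rV[R]_n -> 'rV[R]_n := ccoord j \o cinv i.

Definition smooth_atlas (R : realType) n (M : topologicalType)
    (X : charts R n M) : Prop :=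
  [/\ forall p : M, exists i : cidx X, cdom i p,
      forall i : cidx X,
        [/\ open (cdom i), open (cimg i),
            {within cdom i, continuous (ccoord i)},
            {within cimg i, continuous (cinv i)}
          & forall p, cdom i p -> cinv i (ccoord i p) = p]
    & forall i j : cidx X,
        smooth_map_on (ccoord i @` (cdom i `&` cdom j)) (trans i j)].

Definition prod_charts (R : realType) n1 n2 (M1 M2 : Type)
    (X1 : charts R n1 M1) (X2 : charts R n2 M2) : charts R (n1 + n2) (M1 * M2) :=
  {| cidx := (cidx X1 * cidx X2)%type;
     cdom := fun i => cdom i.1 `*` cdom i.2;
     ccoord := fun i p => row_mx (ccoord i.1 p.1) (ccoord i.2 p.2);
     cinv := fun i x => (cinv i.1 (lsubmx x), cinv i.2 (rsubmx x)) |}.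

Definition circle (R : realType) : set (R * R) :=
  [set z | z.1 ^+ 2 + z.2 ^+ 2 = 1].
Arguments circle : clear implicits.

Lemma circle_cos_sin (R : realType) (r : R) : circle R (cos r, sin r).
Proof. exact: cos2Dsin2. Qed.

Definition angle_pt (R : realType) (r : R) : circle R :=
  exist _ (cos r, sin r) (mem_set (circle_cos_sin r)).

(* The chart with index [a] is the angle coordinate with values in
   ]a, a + 2 pi[ on the circle minus the point of angle [a]. *)
Definition circle_charts (R : realType) : charts R 1 (circle R) :=
  {| cidx := R;
     cdom := fun a => [set z | z <> angle_pt a];
     ccoord := fun a z =>
       const_mx (xget 0 [set r | a < r < a + 2 * pi /\ angle_pt r = z]);
     cinv := fun a x => angle_pt (x 0 0) |}.

(** * Exterior algebra of R^n *)

(* A k-covector is an alternating multilinear function of k vectors, which are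
   the rows of a k x n matrix. *)
Definition covector (R : realType) (K : Type) (k n : nat) := 'M[R]_(k, n) -> K.

Definition alternating (R : realType) k n (a : covector R R k n) : Prop :=
  (forall (r : 'I_k) (b c : R) (u v w : 'M[R]_(k, n)),
     row r u = b *: row r v + c *: row r w ->
     row' r v = row' r u -> row' r w = row' r u -> a u = b * a v + c * a w) /\
  (forall (r s : 'I_k) (v : 'M[R]_(k, n)),
     r != s -> row r v = row s v -> a v = 0).

Definition cwedge (R : realType) (K : fieldType) k l n
    (a : covector R K k n) (b : covector R K l n) : covector R K (k + l) n :=
  fun v => ((k`! * l`!)%:R)^-1 * \sum_(s : 'S_(k + l))
    (-1) ^+ s * (a (usubmx (row_perm s v)) * b (dsubmx (row_perm s v))).

Definition contract (R : realType) (K : Type) k n (X : 'rV[R]_n)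
    (a : covector R K k.+1 n) : covector R K k n :=
  fun v => a (col_mx X v).

(* A metric [g] is given by its Gram matrix; together with an orientation of
   R^n, reversed when [e] is true, it determines the volume form. *)
Definition vol_form (R : realType) n (g : 'M[R]_n) (e : bool) :
    covector R R n n :=
  fun v => (-1) ^+ e * Num.sqrt (\det g) * \det v.

(* In indices, with respect to the standard basis:
   ( *a)_J = (1/k!) a^I vol_(I J), the indices I being raised with g. *)
Definition star (R : realType) k l (g : 'M[R]_(k + l)) (e : bool)
    (a : covector R R k (k + l)) : covector R R l (k + l) :=
  fun v => (k`!)%:R^-1 * \sum_(I : {ffun 'I_k -> 'I_(k + l)})
    a (rowsub I (invmx g)) * vol_form g e (col_mx (rowsub I 1%:M) v).

Definition pos_def (R : realType) n (g : 'M[R]_n) : Prop :=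
  g^T = g /\ forall u : 'rV[R]_n, u != 0 -> 0 < (u *m g *m u^T) 0 0.

(** * Differential forms *)

(* A tensor field is given by its coordinate expressions in the charts; only
   the values on the images of the charts matter. *)
Definition kform (R : realType) (K : Type) n (M : Type) (X : charts R n M)
  (k : nat) := cidx X -> 'rV[R]_n -> covector R K k n.

Definition func (R : realType) n (M : Type) (X : charts R n M) :=
  cidx X -> 'rV[R]_n -> R.

Definition vfield (R : realType) n (M : Type) (X : charts R n M) :=
  cidx X -> 'rV[R]_n -> 'rV[R]_n.

(* (1,1)-tensor: the vector [v] at the point of coordinates [x] is mapped to
   [v *m J i x]. *)
Definition endo (R : realType) n (M : Type) (X : charts R n M) :=
  cidx X -> 'rV[R]_n -> 'M[R]_n.

Section Forms.
Context {R : realType} {n : nat} {M : Type} {X : charts R n M}.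

Definition form_eq K k (a b : kform K X k) : Prop :=
  forall i x v, cimg i x -> a i x v = b i x v.

Definition is_form k (a : kform R X k) : Prop :=
  [/\ forall i x, cimg i x -> alternating (a i x),
      forall i v, smooth_on (cimg i) (fun x => a i x v)
    & forall (i j : cidx X) p v, cdom i p -> cdom j p ->
        a i (ccoord i p) v =
        a j (ccoord j p) (v *m jacobian (trans i j) (ccoord i p))].

Definition is_endo (J : endo X) : Prop :=
  (forall (i : cidx X) r s, smooth_on (cimg i) (fun x => J i x r s)) /\
  (forall (i j : cidx X) p, cdom i p -> cdom j p ->
     J i (ccoord i p) *m jacobian (trans i j) (ccoord i p) =
     jacobian (trans i j) (ccoord i p) *m J j (ccoord j p)).

Definition smooth_family k (T : set R) (a : R -> kform R X k) : Prop :=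
  (forall t, T t -> is_form (a t)) /\
  (forall i v, smooth_on [set y : 'rV[R]_(1 + n) |
                            T (lsubmx y 0 0) /\ cimg i (rsubmx y)]
                 (fun y => a (lsubmx y 0 0) i (rsubmx y) v)).

Definition re_form k (a : kform R[i] X k) : kform R X k :=
  fun i x v => complex.Re (a i x v).
Definition im_form k (a : kform R[i] X k) : kform R X k :=
  fun i x v => complex.Im (a i x v).

Definition is_cform k (a : kform R[i] X k) : Prop :=
  is_form (re_form a) /\ is_form (im_form a).

Definition smooth_cfamily k (T : set R) (a : R -> kform R[i] X k) : Prop :=
  smooth_family T (fun t => re_form (a t)) /\
  smooth_family T (fun t => im_form (a t)).

(* [b] is the derivative at time [t] of the family [a] defined on [T]. *)
Definition form_tderiv k (T : set R) (a : R -> kform R X k) (t : R)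
    (b : kform R X k) : Prop :=
  forall i x v, cimg i x -> has_tderiv T (fun s => a s i x v) t (b i x v).

Definition cform_tderiv k (T : set R) (a : R -> kform R[i] X k) (t : R)
    (b : kform R[i] X k) : Prop :=
  form_tderiv T (fun s => re_form (a s)) t (re_form b) /\
  form_tderiv T (fun s => im_form (a s)) t (im_form b).

Definition fscale k (f : func X) (a : kform R X k) : kform R X k :=
  fun i x v => f i x * a i x v.

Definition fwedge k l (a : kform R X k) (b : kform R X l) : kform R X (k + l) :=
  fun i x => cwedge (a i x) (b i x).

Definition dfun (f : func X) : kform R X 1 := fun i x v => 'D_v (f i) x.

Definition ext_d k (a : kform R X k) : kform R X k.+1 := fun i x v =>
  \sum_(r < k.+1) (-1) ^+ r * 'D_(row r v) (fun y => a i y (row' r v)) x.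

(* In coordinates, for constant v_1, ..., v_k:
   (L_Y a)(v_1, .., v_k) = D_Y (a (v_1, .., v_k))
                           + sum_r a (v_1, .., D_(v_r) Y, .., v_k). *)
Definition lie k (Y : vfield X) (a : kform R X k) : kform R X k := fun i x v =>
  'D_(Y i x) (fun y => a i y v) x +
  \sum_(r < k) a i x
    (\matrix_(s < k) if s == r then 'D_(row r v) (Y i) x else row s v).

Definition clie k (Y : vfield X) (a : kform R[i] X k) : kform R[i] X k :=
  fun i x v => lie Y (re_form a) i x v +i* lie Y (im_form a) i x v.

Definition grad (g : cidx X -> 'rV[R]_n -> 'M[R]_n) (f : func X) : vfield X :=
  fun i x => (\row_s 'D_(delta_mx 0 s) (f i) x) *m invmx (g i x).

End Forms.

(** * Complex structures and Calabi-Yau structures in real dimension 6 *)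

Section CalabiYau.
Context {R : realType} {N : Type} {X : charts R 6 N}.

(* Complex-valued differential of a complex-valued function. *)
Definition cdiff (f : 'rV[R]_6 -> R[i]) (x : 'rV[R]_6) : covector R R[i] 1 6 :=
  fun v => 'D_v (fun y => complex.Re (f y)) x
           +i* 'D_v (fun y => complex.Im (f y)) x.

Definition holomorphic_on (J : endo X) (i : cidx X) (V : set 'rV[R]_6)
    (f : 'rV[R]_6 -> R[i]) : Prop :=
  [/\ smooth_on V (fun y => complex.Re (f y)),
      smooth_on V (fun y => complex.Im (f y))
    & forall x v, V x -> cdiff f x (v *m J i x) = 'i * cdiff f x v].

Definition real_coords (z : 'I_3 -> 'rV[R]_6 -> R[i]) (x : 'rV[R]_6) :
    'rV[R]_6 :=
  row_mx (\row_j complex.Re (z j x)) (\row_j complex.Im (z j x)).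

(* Complex coordinates (z_1, z_2, z_3) on the open subset of N that corresponds
   to [V] in the chart [i]. *)
Definition holomorphic_chart (J : endo X) (i : cidx X) (V : set 'rV[R]_6)
    (z : 'I_3 -> 'rV[R]_6 -> R[i]) : Prop :=
  [/\ open V, V `<=` cimg i, forall j, holomorphic_on J i V (z j),
      open (real_coords z @` V)
    & exists2 G : 'rV[R]_6 -> 'rV[R]_6,
        smooth_map_on (real_coords z @` V) G
        & forall x, V x -> G (real_coords z x) = x].

Definition complex_structure (J : endo X) : Prop :=
  [/\ is_endo J, forall i x, cimg i x -> J i x *m J i x = - 1%:M
    & forall i x, cimg i x ->
        exists V z, V x /\ holomorphic_chart J i V z].

Definition holomorphic_30_form (J : endo X) (U : kform R[i] X 3) : Prop :=
  is_cform U /\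
  forall i V z, holomorphic_chart J i V z ->
    exists2 f : 'rV[R]_6 -> R[i], holomorphic_on J i V f
      & forall x (v : 'M[R]_(3, 6)), V x ->
          U i x v = f x *
            cwedge (cwedge (cdiff (z 0) x) (cdiff (z 1) x)) (cdiff (z 2) x) v.

(* Gram matrix of g(u, v) = omega(u, J v). *)
Definition kaehler_metric (J : endo X) (omega : kform R X 2)
    (i : cidx X) (x : 'rV[R]_6) : 'M[R]_6 :=
  \matrix_(r, s)
    omega i x (col_mx (delta_mx 0 r : 'rV[R]_6) (delta_mx 0 s *m J i x)).

Definition kaehler (J : endo X) (omega : kform R X 2) : Prop :=
  [/\ is_form omega,
      forall i x v, cimg i x -> omega i x (v *m J i x) = omega i x v,
      forall i x, cimg i x -> pos_def (kaehler_metric J omega i x)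
    & form_eq (ext_d omega) (fun _ _ _ => 0)].

Definition calabi_yau (J : endo X) (omega : kform R X 2) (U : kform R[i] X 3) :
    Prop :=
  [/\ complex_structure J, kaehler J omega, holomorphic_30_form J U
    & forall i x, cimg i x -> exists v, U i x v != 0].

(* |U|_omega *)
Definition norm_U (omega : kform R X 2) (U : kform R[i] X 3) : func X :=
  fun i x => xget 0 [set f : R | 0 < f /\ forall v : 'M[R]_(6, 6),
    ((3`!)%:R^-1 * cwedge (cwedge (omega i x) (omega i x)) (omega i x) v)%:C =
    'i / 8%:R * ((f ^+ 2)^-1)%:C *
      cwedge (U i x) (fun w => conjc (U i x w)) v].

Definition log_norm_U (omega : kform R X 2) (U : kform R[i] X 3) : func X :=
  fun i x => ln (norm_U omega U i x).

Definition grad_log_norm_U (J : endo X) (omega : kform R X 2)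
    (U : kform R[i] X 3) : vfield X :=
  grad (kaehler_metric J omega) (log_norm_U omega U).

End CalabiYau.

(** * G2-structures and the modified Laplacian coflow *)

Section G2.
Context {R : realType}.

(* (X _| phi) /\ (Y _| phi) /\ phi = 6 g(X, Y) vol, with [g] positive definite
   and [vol] its volume form for one of the two orientations. At most one pair
   (metric, orientation) satisfies this, and there is one exactly when [phi] is
   in the GL(7, R)-orbit of the standard G2 3-form. *)
Definition G2_metrics (phi : covector R R 3 7) : set ('M[R]_7 * bool) :=
  [set ge | pos_def ge.1 /\
    forall (X Y : 'rV[R]_7) (v : 'M[R]_(7, 7)),
      cwedge (cwedge (contract X phi) (contract Y phi)) phi v =
      6 * (X *m ge.1 *m Y^T) 0 0 * vol_form ge.1 ge.2 v].

Definition G2_metric (phi : covector R R 3 7) : 'M[R]_7 * bool :=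
  xget (1%:M, false) (G2_metrics phi).

Context {M : Type} {X : charts R 7 M}.

(* Pointwise condition on a differential 3-form; that [phi] is a smooth form is
   not part of it (see [is_form]). *)
Definition G2_structure (phi : kform R X 3) : Prop :=
  forall i x, cimg i x -> G2_metrics (phi i x) !=set0.

(* Hodge star of g_phi from k-forms to l-forms, for k + l = 7. *)
Definition star37 (phi a : kform R X 3) : kform R X 4 :=
  fun i x => let ge := G2_metric (phi i x) in
    @star R 3 4 ge.1 ge.2 (a i x).
Definition star47 (phi : kform R X 3) (a : kform R X 4) : kform R X 3 :=
  fun i x => let ge := G2_metric (phi i x) in
    @star R 4 3 ge.1 ge.2 (a i x).
Definition star57 (phi : kform R X 3) (a : kform R X 5) : kform R X 2 :=
  fun i x => let ge := G2_metric (phi i x) in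
    @star R 5 2 ge.1 ge.2 (a i x).
Definition star77 (phi : kform R X 3) (a : kform R X 7) : kform R X 0 :=
  fun i x => let ge := G2_metric (phi i x) in
    @star R 7 0 ge.1 ge.2 (a i x).

Definition psi (phi : kform R X 3) : kform R X 4 := star37 phi phi.

Definition tau0 (phi : kform R X 3) : func X :=
  fun i x => 7%:R^-1 * star77 phi (fwedge phi (ext_d phi)) i x 0.

(* d^* = (-1)^(n (k + 1) + 1) * d * on k-forms in dimension n = 7. *)
Definition codiff4 (phi : kform R X 3) (a : kform R X 4) : kform R X 3 :=
  fun i x v =>
    (-1) ^+ (7 * (4 + 1) + 1)%N * star47 phi (ext_d (star47 phi a)) i x v.
Definition codiff5 (phi : kform R X 3) (a : kform R X 5) : kform R X 4 :=
  fun i x v =>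
    (-1) ^+ (7 * (5 + 1) + 1)%N * star37 phi (ext_d (star57 phi a)) i x v.

Definition laplacian4 (phi : kform R X 3) (a : kform R X 4) : kform R X 4 :=
  fun i x v => ext_d (codiff4 phi a) i x v + codiff5 phi (ext_d a) i x v.

Definition modified_laplacian_coflow (A : R) (T : set R)
    (phi : R -> kform R X 3) : Prop :=
  (forall t, T t -> G2_structure (phi t)) /\
  (forall t, T t ->
     form_tderiv T (fun s => psi (phi s)) t
       (fun i x v =>
          laplacian4 (phi t) (psi (phi t)) i x v +
          ext_d (fscale (fun j y => A - 7%:R / 2%:R * tau0 (phi t) j y)
                        (phi t)) i x v)).

End G2.

(** * The product with a circle *)

Section Product.
Context {R : realType} {N : Type} {X : charts R 6 N}.

Notation XS := (prod_charts X (circle_charts R)).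

Definition pull1 k (a : kform R X k) : kform R XS k :=
  fun i x v => a i.1 (lsubmx x) (lsubmx v).

Definition pull1_func (f : func X) : func XS :=
  fun i x => f i.1 (lsubmx x).

Definition pull2 k (a : kform R (circle_charts R) k) : kform R XS k :=
  fun i x v => a i.2 (rsubmx x) (rsubmx v).

Definition dr : kform R (circle_charts R) 1 := fun _ _ v => v 0 0.

(* Re (U / |U|) + |U| dr /\ omega *)
Definition G2_form (omega : kform R X 2) (U : kform R[i] X 3) :
    kform R (XS : charts R 7 (N * circle R)) 3 :=
  fun i x v =>
    pull1 (fscale (fun j y => (norm_U omega U j y)^-1) (re_form U)) i x v +
    fscale (pull1_func (norm_U omega U))
      (fwedge (pull2 dr) (pull1 omega)) i x v.

End Product.

(* Main.v *)
(* In holomorphic coordinates [U = h dz_1 /\ dz_2 /\ dz_3] with [h] holomorphic,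
   so [d U = 0]; and at each point [omega] and [U] are, in a suitable frame,
   multiples of the standard forms. With [f = |U|] and [L = log f], this gives
   [psi = omega^2 / 2 - dr /\ Im U], hence [d psi = 0], and
   [d phi = - (f^-1 dL /\ Re U + f dr /\ dL /\ omega)], hence
   [phi /\ d phi = 0], i.e. [tau0 = 0], and, with [Y = grad L],
   [star d phi = dr /\ (Y _| Im U) - (Y _| omega) /\ omega].
   By Cartan's formula [d star d phi] is
   [- dr /\ L_Y (Im U) - (L_Y omega) /\ omega], which are exactly the Lie
   derivative terms of [d psi / dt]. What remains of the coflow equation is
   [beta /\ omega - dr /\ Im gamma = A d phi], whose components without and
   with [dr] are the two conditions. *)

(* All pointwise identities are reduced to one flat model. At each point a unitary frame, whose
   first vector is rotated by a phase so that the coefficient of [U] becomes positive, brings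
   [omega] to [om0] and [U] to a multiple of [re0 + i im0]; adding f^-1 times the circle direction
   turns [phi] into the constant form [phi0]. There the metric, the star and the contractions
   involve integer coefficients only, and what is left is decided by computing with lists of
   indices. Such a frame is chosen at each point separately, without any regularity, so nothing is
   differentiated in it. It only serves to prove closed formulas for [psi], [star d phi] and |U| in
   terms of [omega], [U], dL and its gradient; these formulas hold on a whole chart and are then
   differentiated. The norm |U| and the metric of [phi] are picked by a choice operator, so
   uniqueness has to be known before either can be computed. *)
From Pilot Require Import Defs.
From HB Require Import structures.
From mathcomp Require Import all_boot all_order all_algebra all_fingroup.
From mathcomp Require Import all_classical all_reals all_analysis.
From mathcomp Require Import ring lra zify.
(* [alternating] is also defined in the trigo file of MathComp-Analysis. *)
Import Pilot.Defs.

Set Implicit Arguments.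
Unset Strict Implicit.
Unset Printing Implicit Defensive.

Import Order.TTheory GRing.Theory Num.Theory.
Import numFieldNormedType.Exports.

Local Open Scope ring_scope.

(** * Alternating multilinear forms *)

Section Alternating.
Context {R : realType}.

Lemma row'_eqP m n (r : 'I_m) (u v : 'M[R]_(m, n)) :
  (forall s, s != r -> row s u = row s v) -> row' r u = row' r v.
Proof.
move=> H; apply/matrixP => i j; rewrite !mxE.
have /H/rowP/(_ j) : lift r i != r by rewrite eq_sym neq_lift.
by rewrite !mxE.
Qed.

Lemma row'_eqE m n (r s : 'I_m) (u v : 'M[R]_(m, n)) :
  row' r u = row' r v -> s != r -> row s u = row s v.
Proof.
move=> /matrixP H; rewrite eq_sym => /unlift_some[i -> _].
by apply/rowP => j; have := H i j; rewrite !mxE.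
Qed.

Lemma alt_rows k n (a : covector R R k n) : alternating a ->
  forall (r : 'I_k) (b c : R) (u v w : 'M[R]_(k, n)),
    row r u = b *: row r v + c *: row r w ->
    (forall s, s != r -> row s v = row s u) ->
    (forall s, s != r -> row s w = row s u) -> a u = b * a v + c * a w.
Proof. by move=> [H _] r b c u v w *; apply: (H r) => //; apply: row'_eqP. Qed.

Lemma lin_expand n (f : 'rV[R]_n -> R) :
  (forall b c u v, f (b *: u + c *: v) = b * f u + c * f v) ->
  forall u, f u = \sum_j u 0 j * f (delta_mx 0 j).
Proof.
move=> lf u.
have f0 : f 0 = 0 by have := lf 0 0 0 0; rewrite !scale0r addr0 !mul0r addr0.
rewrite {1}(row_sum_delta u).
elim/big_rec2: _ => // j y1 y2 _ <-.
by rewrite -[y2 in LHS]scale1r lf mul1r.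
Qed.

Lemma row_col_mx0 k n (u : 'rV[R]_n) (v : 'M[R]_(k, n)) :
  row ord0 (col_mx u v : 'M[R]_(1 + k, n)) = u.
Proof.
apply/rowP => j; rewrite mxE -(col_mxEu u v 0 j).
by congr (col_mx u v _ j); apply/val_inj.
Qed.

Lemma row_col_mxS k n (u : 'rV[R]_n) (v : 'M[R]_(k, n)) (r : 'I_k) :
  row (lift ord0 r) (col_mx u v : 'M[R]_(1 + k, n)) = row r v.
Proof.
apply/rowP => j; rewrite [LHS]mxE [RHS]mxE -(col_mxEd u v r j).
by congr (col_mx u v _ j); apply/val_inj.
Qed.

Lemma alt_row0_lin k n (a : covector R R k.+1 n) : alternating a ->
  forall v b c (u w : 'rV[R]_n),
    a (col_mx (b *: u + c *: w) v) = b * a (col_mx u v) + c * a (col_mx w v).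
Proof.
move=> ha v b c u w.
apply: (alt_rows ha (r := ord0)); first by rewrite !row_col_mx0.
  by move=> s; rewrite eq_sym => /unlift_some[i -> _]; rewrite !row_col_mxS.
by move=> s; rewrite eq_sym => /unlift_some[i -> _]; rewrite !row_col_mxS.
Qed.

Lemma alt_contract k n (a : covector R R k.+1 n) X : alternating a ->
  alternating (contract X a).
Proof.
move=> ha; split=> [r b c u v w h1 h2 h3|r s v rs h].
  apply: (alt_rows ha (r := lift ord0 r)); first by rewrite !row_col_mxS.
    move=> s; case: (unliftP ord0 s) => [s' ->|->]; last by rewrite !row_col_mx0.
    by rewrite !row_col_mxS (inj_eq lift_inj) => sr; exact: row'_eqE h2 sr.
  move=> s; case: (unliftP ord0 s) => [s' ->|->]; last by rewrite !row_col_mx0.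
  by rewrite !row_col_mxS (inj_eq lift_inj) => sr; exact: row'_eqE h3 sr.
by apply: (ha.2 (lift ord0 r) (lift ord0 s)); rewrite ?(inj_eq lift_inj) ?row_col_mxS.
Qed.

Lemma alt_sum k n (J : finType) (c : J -> R) (a : J -> covector R R k n) :
  (forall j, alternating (a j)) -> alternating (fun v => \sum_j c j * a j v).
Proof.
move=> ha; split=> [r b c' u v w h1 h2 h3|r s v rs h].
  rewrite !mulr_sumr -big_split; apply: eq_bigr => j _ /=.
  by rewrite ((ha j).1 _ _ _ _ _ _ h1 h2 h3); ring.
by rewrite big1 // => j _; rewrite ((ha j).2 _ _ _ rs h) mulr0.
Qed.

Lemma alt_lin k n (a b : covector R R k n) x y :
  alternating a -> alternating b -> alternating (fun v => x * a v + y * b v).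
Proof.
move=> ha hb; split=> [r b' c' u v w h1 h2 h3|r s v rs h].
  by rewrite (ha.1 _ _ _ _ _ _ h1 h2 h3) (hb.1 _ _ _ _ _ _ h1 h2 h3); ring.
by rewrite (ha.2 _ _ _ rs h) (hb.2 _ _ _ rs h) !mulr0 addr0.
Qed.

Lemma alt_ext k n (a b : covector R R k n) : (forall v, a v = b v) ->
  alternating a -> alternating b.
Proof. by move=> ab; have -> : a = b by apply: funext. Qed.

(** This is the monomial e^(K 0) /\ .. /\ e^(K (k-1)). The map [K] may be unordered or have
    repetitions, so signs and vanishing are left to the determinant. *)
Definition eps k n (K : 'I_k -> 'I_n) : covector R R k n := fun v =>
  \det (colsub K v).

Lemma eps_alt k n (K : 'I_k -> 'I_n) : alternating (eps K).
Proof.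
split=> [r b c u v w h1 h2 h3|r s v rs h].
  apply: (determinant_multilinear (i0 := r)).
  - by apply/rowP => j; have /rowP/(_ (K j)) := h1; rewrite !mxE.
  - by apply/matrixP => i j; have /matrixP/(_ i (K j)) := h2; rewrite !mxE.
  - by apply/matrixP => i j; have /matrixP/(_ i (K j)) := h3; rewrite !mxE.
apply: (determinant_alternate rs) => j.
by have /rowP/(_ (K j)) := h; rewrite !mxE.
Qed.

(** Induction on the degree: the first row is expanded in the standard basis, and the contraction
    with a basis vector is a form of degree one less. *)
Lemma multilin_expand k n (a : covector R R k n) : alternating a -> forall v,
  a v = \sum_(K : {ffun 'I_k -> 'I_n})
          (\prod_r v r (K r)) * a (rowsub K 1%:M).
Proof.
elim: k a => [|k IH] a ha v.
  rewrite (eq_bigr (fun=> a v)); last first.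
    by move=> K _; rewrite big_ord0 mul1r; congr a; apply/matrixP => -[].
  by rewrite sumr_const card_ffun !card_ord expn0.
have -> : a v = a (col_mx (row ord0 v) (row' ord0 v)).
  congr a; apply/row_matrixP => r; case: (unliftP ord0 r) => [r' ->|->].
    by rewrite row_col_mxS; apply/rowP => j; rewrite !mxE.
  by rewrite row_col_mx0.
rewrite (lin_expand (f := fun u => a (col_mx u (row' ord0 v)))); last first.
  by move=> *; apply: alt_row0_lin.
transitivity (\sum_j \sum_(K : {ffun 'I_k -> 'I_n})
  (v ord0 j * ((\prod_r v (lift ord0 r) (K r)) *
    a (col_mx (delta_mx 0 j : 'rV[R]_n) (rowsub K 1%:M))))).
  apply: eq_bigr => j _; rewrite -mulr_sumr mxE; congr (_ * _).
  rewrite -[LHS]/(contract (delta_mx 0 j) a (row' ord0 v)).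
  rewrite (IH _ (alt_contract (delta_mx 0 j) ha)).
  by apply: eq_bigr => K _; congr (_ * _); apply: eq_bigr => r _; rewrite mxE.
rewrite pair_bigA /=.
(* A map on k + 1 rows amounts to its value on row 0 and its restriction to the other rows. *)
rewrite [RHS](reindex (fun p : 'I_n * {ffun 'I_k -> 'I_n} =>
  [ffun r => if unlift ord0 r is Some r' then p.2 r' else p.1])) /=; last first.
  exists (fun K : {ffun _ -> _} => (K ord0, [ffun r => K (lift ord0 r)])) => /=.
    move=> [j K] _ /=; rewrite ffunE unlift_none; congr pair.
    by apply/ffunP => r; rewrite !ffunE liftK.
  move=> K _; apply/ffunP => r; rewrite ffunE.
  by case: unliftP => [r' ->|->] //=; rewrite ffunE.
apply: eq_bigr => -[j K] _ /=.
rewrite big_ord_recl ffunE unlift_none -!mulrA; congr (_ * (_ * _)).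
  by apply: eq_bigr => r _; rewrite ffunE liftK.
congr a; apply/row_matrixP => r; case: (unliftP ord0 r) => [r' ->|->].
  by rewrite row_col_mxS; apply/rowP => j'; rewrite !mxE ffunE liftK.
by rewrite row_col_mx0; apply/rowP => j'; rewrite !mxE ffunE unlift_none eq_sym.
Qed.

(** Polarisation: [a] vanishes on [SS], which has the sum of rows [r] and [s] in both places. Of the
    four terms of its expansion the two with a repeated row vanish, and the other two are [a v] and
    its transposed value. *)
Lemma alt_tperm k n (a : covector R R k n) : alternating a ->
  forall (r s : 'I_k) v, r != s -> a (row_perm (tperm r s) v) = - a v.
Proof.
move=> ha r s v rs.
pose M x y : 'M[R]_(k, n) :=
  \matrix_t if t == r then row x v else if t == s then row y v else row t v.
have Mrow x y t : row t (M x y) =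
    if t == r then row x v else if t == s then row y v else row t v.
  by rewrite rowK.
pose S y : 'M[R]_(k, n) :=
  \matrix_t if t == r then row r v + row s v else if t == s then row y v else row t v.
pose SS : 'M[R]_(k, n) :=
  \matrix_t if (t == r) || (t == s) then row r v + row s v else row t v.
have sr : (s == r) = false by rewrite eq_sym (negbTE rs).
have e1 : a SS = 1 * a (S r) + 1 * a (S s).
  apply: (alt_rows ha (r := s)).
  - by rewrite !rowK eqxx sr orbT !scale1r.
  - by move=> t ts; rewrite !rowK (negbTE ts) orbF.
  - by move=> t ts; rewrite !rowK (negbTE ts) orbF.
have e2 y : a (S y) = 1 * a (M r y) + 1 * a (M s y).
  apply: (alt_rows ha (r := r)).
  - by rewrite !rowK eqxx !scale1r.
  - by move=> t ts; rewrite !rowK (negbTE ts).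
  - by move=> t ts; rewrite !rowK (negbTE ts).
have e0 : a SS = 0.
  by apply: (ha.2 r s) => //; rewrite !rowK !eqxx orbT.
have e3 y : a (M y y) = 0.
  by apply: (ha.2 r s) => //; rewrite !rowK !eqxx sr.
have -> : v = M r s.
  apply/row_matrixP => t; rewrite rowK.
  by case: eqP => [->|_] //; case: eqP => [->|].
have -> : row_perm (tperm r s) (M r s) = M s r.
  apply/row_matrixP => t; rewrite rowK.
  have -> : row t (row_perm (tperm r s) (M r s)) = row (tperm r s t) (M r s).
    by apply/rowP => j; rewrite !mxE.
  rewrite rowK; case: tpermP => [->|->|/eqP/negbTE -> /eqP/negbTE ->].
  - by rewrite eqxx sr eqxx.
  - by rewrite sr !eqxx.
  - by [].
by move: e1; rewrite e0 !e2 !e3; lra.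
Qed.

Lemma alt_perm k n (a : covector R R k n) : alternating a ->
  forall (s : 'S_k) v, a (row_perm s v) = (-1) ^+ s * a v.
Proof.
move=> ha s; have [ts -> /=] := prod_tpermP s.
elim: ts => [_ v|[x y] ts IH /= /andP[xy dts] v].
  by rewrite big_nil row_perm1 odd_perm1 mul1r.
rewrite big_cons row_permM alt_tperm // IH // odd_permM odd_tperm xy.
by rewrite signr_addb expr1 mulN1r mulNr.
Qed.

(** The multilinear expansion is averaged over all permutations of the rows, which turns its
    products into determinants. The sum runs over all maps [K], not only the increasing ones, whence
    the factor 1/k!. *)
Lemma alt_expand k n (a : covector R R k n) : alternating a -> forall v,
  a v = \sum_(K : {ffun 'I_k -> 'I_n}) ((k`!)%:R^-1 * a (rowsub K 1%:M)) * eps K v.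
Proof.
move=> ha v.
have fk : ((k`!)%:R : R) != 0 by rewrite pnatr_eq0 -lt0n fact_gt0.
have E (s : 'S_k) : a v = \sum_(K : {ffun 'I_k -> 'I_n})
    a (rowsub K 1%:M) * ((-1) ^+ s * \prod_r v r (K (s r))).
  rewrite (multilin_expand ha).
  rewrite (reindex (fun K : {ffun 'I_k -> 'I_n} => [ffun r => K (s r)])) /=.
    apply: eq_bigr => K _.
    have -> : rowsub [ffun r => K (s r)] 1%:M = row_perm s (rowsub K (1%:M : 'M[R]_n)).
      by apply/matrixP => i j; rewrite !mxE ffunE.
    rewrite (alt_perm ha).
    rewrite (eq_bigr (fun r => v r (K (s r)))); last by move=> r _; rewrite ffunE.
    by rewrite mulrCA [RHS]mulrCA; congr (_ * _); rewrite mulrC.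
  exists (fun K : {ffun 'I_k -> 'I_n} => [ffun r => K (s^-1%g r)]) => K _.
    by apply/ffunP => r; rewrite !ffunE permKV.
  by apply/ffunP => r; rewrite !ffunE permK.
apply: (mulfI fk); rewrite mulr_sumr.
transitivity (\sum_(s : 'S_k) a v).
  by rewrite sumr_const card_Sn mulr_natl.
rewrite (eq_bigr _ (fun s _ => E s)) exchange_big; apply: eq_bigr => K _ /=.
rewrite !mulrA divff // mul1r -mulr_sumr; congr (_ * _).
by apply: eq_bigr => s _; congr (_ * _); apply: eq_bigr => r _; rewrite mxE.
Qed.

End Alternating.

(** * Wedge products and the Hodge star *)

Section Wedge.
Context {R : realType}.

Lemma eps_perm k n (K : 'I_k -> 'I_n) (s : 'S_k) (v : 'M[R]_(k, n)) :
  eps (K \o s) v = (-1) ^+ s * eps K v.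
Proof.
rewrite /eps; have -> : colsub (K \o s) v = col_perm s (colsub K v).
  by apply/matrixP => i j; rewrite !mxE.
by rewrite col_permE det_mulmx det_perm odd_permV mulrC.
Qed.

Lemma eps_ext k n (K L : 'I_k -> 'I_n) : K =1 L -> eps (R := R) K =1 eps L.
Proof. by move=> KL v; rewrite /eps; congr (\det _); apply/matrixP => i j; rewrite !mxE KL. Qed.

Definition catf k l n (K : 'I_k -> 'I_n) (L : 'I_l -> 'I_n) (s : 'I_(k + l)) :=
  match fintype.split s with inl a => K a | inr b => L b end.

Lemma catf_l k l n (K : 'I_k -> 'I_n) (L : 'I_l -> 'I_n) a :
  catf K L (lshift l a) = K a.
Proof. by rewrite /catf -[lshift l a]/(unsplit (inl a)) unsplitK. Qed.

Lemma catf_r k l n (K : 'I_k -> 'I_n) (L : 'I_l -> 'I_n) b :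
  catf K L (rshift k b) = L b.
Proof. by rewrite /catf -[rshift k b]/(unsplit (inr b)) unsplitK. Qed.

Section BlockPerm.
Context {k l : nat} (s : 'S_k) (t : 'S_l).

Definition block_perm_fun (i : 'I_(k + l)) : 'I_(k + l) :=
  match fintype.split i with inl a => lshift l (s a) | inr b => rshift k (t b) end.

Lemma block_perm_inj : injective block_perm_fun.
Proof.
move=> x y; rewrite -[x]splitK -[y]splitK /block_perm_fun !unsplitK.
case: (fintype.split x) => a; case: (fintype.split y) => b //=.
- by move/(@lshift_inj _ _)/perm_inj ->.
- by move/eqP; rewrite eq_lrshift.
- by move/eqP; rewrite eq_rlshift.
- by move/(@rshift_inj _ _)/perm_inj ->.
Qed.

Definition block_perm := perm block_perm_inj.

Lemma block_perm_l a : block_perm (lshift l a) = lshift l (s a).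
Proof. by rewrite permE /block_perm_fun -[lshift l a]/(unsplit (inl a)) unsplitK. Qed.

Lemma block_perm_r b : block_perm (rshift k b) = rshift k (t b).
Proof. by rewrite permE /block_perm_fun -[rshift k b]/(unsplit (inr b)) unsplitK. Qed.

Lemma sign_block_perm (K : comNzRingType) :
  (-1) ^+ block_perm = (-1) ^+ s * (-1) ^+ t :> K.
Proof.
rewrite -!det_perm -(det_ublock _ 0); congr (\det _).
apply/matrixP => x y; rewrite -[x]splitK -[y]splitK.
case: (fintype.split x) => a; case: (fintype.split y) => b /=.
- by rewrite block_mxEul !mxE block_perm_l (inj_eq (@lshift_inj _ _)).
- by rewrite block_mxEur !mxE block_perm_l eq_lrshift.
- by rewrite block_mxEdl !mxE block_perm_r eq_rlshift.
- by rewrite block_mxEdr !mxE block_perm_r (inj_eq (@rshift_inj _ _)).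
Qed.

End BlockPerm.

(** Laplace expansion along blocks, summed over all permutations instead of shuffles. Once the two
    minors are expanded over [t] and [u], the block permutation of [(t, u)] is absorbed into [s],
    and each of the k! l! pairs contributes one copy of the full determinant. *)
Lemma laplace_sum (K : comNzRingType) k l (A : 'M[K]_(k + l)) :
  \sum_(s : 'S_(k + l)) (-1) ^+ s *
    (\det (ulsubmx (row_perm s A)) * \det (drsubmx (row_perm s A))) =
  (k`! * l`!)%:R * \det A.
Proof.
have detV m (B : 'M[K]_m) : \det B = \sum_(s : 'S_m) (-1) ^+ s * \prod_i B (s i) i.
  rewrite -det_tr; apply: eq_bigr => s _; congr (_ * _).
  by apply: eq_bigr => i _; rewrite mxE.
transitivity (\sum_(p : 'S_k * 'S_l) \det A); last first.
  by rewrite sumr_const card_prod !card_Sn mulr_natl.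
transitivity (\sum_(s : 'S_(k + l)) \sum_(p : 'S_k * 'S_l)
   (-1) ^+ (block_perm p.1 p.2 * s)%g * \prod_i A ((block_perm p.1 p.2 * s)%g i) i).
  apply: eq_bigr => s _.
  rewrite !detV big_distrlr /= pair_bigA mulr_sumr /=.
  apply: eq_bigr => -[t u] _ /=.
  rewrite odd_permM signr_addb sign_block_perm big_split_ord /=.
  under [X in _ = _ * (X * _)]eq_bigr do rewrite permM block_perm_l.
  under [X in _ = _ * (_ * X)]eq_bigr do rewrite permM block_perm_r.
  under [X in _ * (_ * X * _) = _]eq_bigr do rewrite !mxE.
  under [X in _ * (_ * _ * (_ * X)) = _]eq_bigr do rewrite !mxE.
  rewrite [in RHS]mulrC -!mulrA [(-1) ^+ s in RHS]lock.
  set x := (-1) ^+ s; set y := \prod_i _; set z := \prod_i _.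
  set a := (-1) ^+ t; set b := (-1) ^+ u.
  by rewrite -lock; clearbody x y z a b; ring.
rewrite exchange_big; apply: eq_bigr => -[t u] _ /=.
rewrite detV [RHS](reindex_inj (mulgI (block_perm t u))).
by [].
Qed.

(** Products of covectors are determinants, so this is [laplace_sum]. The scalars are general
    because it serves both real coordinates and complex differentials. *)
Lemma cwedge_det (K : numFieldType) k l n (al : 'I_k -> 'rV[R]_n -> K)
    (be : 'I_l -> 'rV[R]_n -> K) (v : 'M[R]_(k + l, n)) :
  cwedge (fun u => \det (\matrix_(i, j) al j (row i u)))
    (fun u => \det (\matrix_(i, j) be j (row i u))) v =
  \det (\matrix_(i, j) (match fintype.split j with inl a => al a | inr b => be b end)
     (row i v)).
Proof.
have kl : ((k`! * l`!)%:R : K) != 0 by rewrite pnatr_eq0 -lt0n muln_gt0 !fact_gt0.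
rewrite /cwedge; apply: (mulfI kl); rewrite mulrA divff // mul1r -laplace_sum.
apply: eq_bigr => s _; congr (_ * (_ * _)); congr (\det _);
  apply/matrixP => x y; rewrite !mxE.
  rewrite -[lshift l y]/(unsplit (inl y)) unsplitK; congr al.
  by apply/rowP => j; rewrite !mxE.
rewrite -[rshift k y]/(unsplit (inr y)) unsplitK; congr be.
by apply/rowP => j; rewrite !mxE.
Qed.

Lemma epsE k n (K : 'I_k -> 'I_n) :
  eps (R := R) K = fun u => \det (\matrix_(i, j) (row i u) 0 (K j)).
Proof.
by apply: funext => u; congr (\det _); apply/matrixP => x y; rewrite !mxE.
Qed.

Lemma cwedge_eps k l n (K : 'I_k -> 'I_n) (L : 'I_l -> 'I_n) (v : 'M[R]_(k + l, n)) :
  cwedge (eps K) (eps L) v = eps (catf K L) v.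
Proof.
rewrite 2!epsE (cwedge_det (fun j w => w 0 (K j)) (fun j w => w 0 (L j))) epsE.
congr (\det _); apply/matrixP => x y; rewrite !mxE /catf.
by case: (fintype.split y) => a; rewrite mxE.
Qed.

Lemma cwedge_suml (I : finType) k l n (c : I -> R) (a : I -> covector R R k n)
    (b : covector R R l n) v :
  cwedge (fun u => \sum_i c i * a i u) b v = \sum_i c i * cwedge (a i) b v.
Proof.
rewrite /cwedge; under [RHS]eq_bigr do rewrite mulrCA mulr_sumr.
rewrite -mulr_sumr exchange_big /=; congr (_ * _); apply: eq_bigr => s _.
by rewrite mulr_suml mulr_sumr; apply: eq_bigr => i _; rewrite -mulrA mulrCA.
Qed.

Lemma cwedge_sumr (I : finType) k l n (c : I -> R) (a : covector R R k n)
    (b : I -> covector R R l n) v :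
  cwedge a (fun u => \sum_i c i * b i u) v = \sum_i c i * cwedge a (b i) v.
Proof.
rewrite /cwedge; under [RHS]eq_bigr do rewrite mulrCA mulr_sumr.
rewrite -mulr_sumr exchange_big /=; congr (_ * _); apply: eq_bigr => s _.
rewrite !mulr_sumr; apply: eq_bigr => i _.
by rewrite [a _ * _]mulrCA [_ * (c i * _)]mulrCA.
Qed.

Lemma cwedge_linl k l n (x y : R) (a a' : covector R R k n) (b : covector R R l n) v :
  cwedge (fun u => x * a u + y * a' u) b v = x * cwedge a b v + y * cwedge a' b v.
Proof.
rewrite /cwedge mulrCA [y * _]mulrCA -mulrDr; congr (_ * _).
rewrite !mulr_sumr -big_split; apply: eq_bigr => s _ /=.
by rewrite mulrDl !mulrDr -!mulrA [_ * (x * _)]mulrCA [_ * (y * _)]mulrCA.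
Qed.

Lemma cwedge_linr k l n (x y : R) (a : covector R R k n) (b b' : covector R R l n) v :
  cwedge a (fun u => x * b u + y * b' u) v = x * cwedge a b v + y * cwedge a b' v.
Proof.
rewrite /cwedge mulrCA [y * _]mulrCA -mulrDr; congr (_ * _).
rewrite !mulr_sumr -big_split; apply: eq_bigr => s _ /=.
by rewrite mulrDr mulrDr ![a _ * (_ * _)]mulrCA ![_ * (x * _)]mulrCA ![_ * (y * _)]mulrCA.
Qed.

Lemma alt_expandF k n (a : covector R R k n) : alternating a ->
  a = fun v => \sum_(K : {ffun 'I_k -> 'I_n})
    ((k`!)%:R^-1 * a (rowsub K 1%:M)) * eps K v.
Proof. by move=> ha; apply: funext => v; exact: alt_expand. Qed.

Lemma cwedge_expand k l n (a : covector R R k n) (b : covector R R l n) :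
  alternating a -> alternating b -> forall v,
  cwedge a b v = \sum_(K : {ffun 'I_k -> 'I_n}) (k`!)%:R^-1 * a (rowsub K 1%:M) *
    \sum_(L : {ffun 'I_l -> 'I_n}) (l`!)%:R^-1 * b (rowsub L 1%:M) *
      eps (catf K L) v.
Proof.
move=> ha hb v.
rewrite [in LHS](alt_expandF ha) cwedge_suml; apply: eq_bigr => K _; congr (_ * _).
rewrite [in LHS](alt_expandF hb) cwedge_sumr; apply: eq_bigr => L _; congr (_ * _).
by rewrite cwedge_eps.
Qed.

Lemma cwedge_alt k l n (a : covector R R k n) (b : covector R R l n) :
  alternating a -> alternating b -> alternating (cwedge a b).
Proof.
move=> ha hb; apply: alt_ext (fun v => esym (cwedge_expand ha hb v)) _.
by apply: alt_sum => K; apply: alt_sum => L; exact: eps_alt.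
Qed.

Lemma eps_cons l n (K : 'I_1 -> 'I_n) (L : 'I_l -> 'I_n) (v : 'M[R]_(1 + l, n)) :
  eps (catf K L) v =
  \sum_(r < l.+1) (-1) ^+ r * eps K (row r v) * eps L (row' r v).
Proof.
rewrite {1}/eps (expand_det_col _ ord0); apply: eq_bigr => r _.
rewrite /cofactor addn0 [RHS]mulrAC mulrC; congr (_ * _ * _).
  congr (\det _); apply/matrixP => i j; rewrite !mxE.
  by rewrite -(catf_r K L j); congr (v _ (catf K L _)); apply/val_inj.
rewrite /eps det_mx11 !mxE -(catf_l K L 0).
by congr (v _ (catf K L _)); apply/val_inj.
Qed.

Lemma cwedge1 l n (a : covector R R 1 n) (b : covector R R l n) :
  alternating a -> alternating b -> forall v,
  cwedge a b v = \sum_(r < l.+1) (-1) ^+ r * (a (row r v) * b (row' r v)).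
Proof.
move=> ha hb v; rewrite cwedge_expand //.
transitivity (\sum_(K : {ffun 'I_1 -> 'I_n}) \sum_(L : {ffun 'I_l -> 'I_n})
  \sum_(r < l.+1) (-1) ^+ r * ((1`!%:R^-1 * a (rowsub K 1%:M)) * eps K (row r v) *
    ((l`!)%:R^-1 * b (rowsub L 1%:M) * eps L (row' r v)))).
  apply: eq_bigr => K _; rewrite mulr_sumr; apply: eq_bigr => L _.
  rewrite eps_cons !mulr_sumr; apply: eq_bigr => r _.
  set x := (-1) ^+ r; set y := eps L _; set z := eps K _.
  by clearbody x y z; ring.
under eq_bigr do rewrite exchange_big /=.
rewrite exchange_big /=; apply: eq_bigr => r _.
rewrite [in RHS](alt_expand ha) [in RHS](alt_expand hb) big_distrlr /= mulr_sumr.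
by apply: eq_bigr => K _; rewrite [RHS]mulr_sumr.
Qed.

Definition fun_linear k n (F : covector R R k n -> R) :=
  forall (I : finType) (c : I -> R) (a : I -> covector R R k n),
    F (fun v => \sum_i c i * a i v) = \sum_i c i * F (a i).

(** Applied to one argument at a time, this reduces the identities for wedge products to monomials,
    where they become identities between index maps. *)
Lemma eps_ind k n (F G : covector R R k n -> R) :
  fun_linear F -> fun_linear G -> (forall K, F (eps K) = G (eps K)) ->
  forall a, alternating a -> F a = G a.
Proof.
move=> lF lG FG a ha; rewrite [in LHS](alt_expandF ha) [in RHS](alt_expandF ha).
by rewrite lF lG; apply: eq_bigr => K _; rewrite FG.
Qed.

Lemma fun_linear_wl k l n (b : covector R R l n) v :
  fun_linear (fun a : covector R R k n => cwedge a b v).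
Proof. by move=> I c a; exact: cwedge_suml. Qed.

Lemma fun_linear_wr k l n (a : covector R R k n) v :
  fun_linear (fun b : covector R R l n => cwedge a b v).
Proof. by move=> I c b; exact: cwedge_sumr. Qed.

Lemma cwedge_sumlF (I : finType) k l n (c : I -> R) (a : I -> covector R R k n)
    (b : covector R R l n) :
  cwedge (fun u => \sum_i c i * a i u) b = fun v => \sum_i c i * cwedge (a i) b v.
Proof. by apply: funext => v; exact: cwedge_suml. Qed.

Lemma cwedge_sumrF (I : finType) k l n (c : I -> R) (a : covector R R k n)
    (b : I -> covector R R l n) :
  cwedge a (fun u => \sum_i c i * b i u) = fun v => \sum_i c i * cwedge a (b i) v.
Proof. by apply: funext => v; exact: cwedge_sumr. Qed.

Lemma cwedge_epsF k l n (K : 'I_k -> 'I_n) (L : 'I_l -> 'I_n) :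
  cwedge (eps (R := R) K) (eps L) = eps (catf K L).
Proof. by apply: funext => v; exact: cwedge_eps. Qed.

Lemma catf1_0 l n (K : 'I_1 -> 'I_n) (L : 'I_l -> 'I_n) : catf K L ord0 = K ord0.
Proof. by rewrite -(catf_l K L ord0); congr catf; apply/val_inj. Qed.

Lemma catf1_S l n (K : 'I_1 -> 'I_n) (L : 'I_l -> 'I_n) r :
  catf K L (lift ord0 r) = L r.
Proof. by rewrite -(catf_r K L r); congr catf; apply/val_inj. Qed.

Lemma catf1A l m n (K : 'I_1 -> 'I_n) (L : 'I_l -> 'I_n) (M : 'I_m -> 'I_n) s :
  catf K (catf L M) s = catf (catf K L) M s.
Proof.
case: (unliftP ord0 s) => [t ->|->].
  rewrite catf1_S -[t]splitK; case: (fintype.split t) => a /=.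
    rewrite catf_l -(catf1_S K L a) -(catf_l _ M); congr catf; exact/val_inj.
  rewrite catf_r -(catf_r (catf K L) M a); congr catf; exact/val_inj.
rewrite catf1_0 -(catf1_0 K L) -(catf_l (catf K L) M); congr catf; exact/val_inj.
Qed.

Lemma cwedge1A l m n (a : covector R R 1 n) (b : covector R R l n)
    (c : covector R R m n) : alternating a -> alternating b -> alternating c ->
  forall v, cwedge a (cwedge b c) v = cwedge (cwedge a b) c v.
Proof.
move=> ha hb hc v.
apply: (eps_ind (F := fun a => cwedge a (cwedge b c) v)
  (G := fun a => cwedge (cwedge a b) c v)) ha => [||K].
- exact: fun_linear_wl.
- by move=> I x a'; rewrite cwedge_sumlF cwedge_suml.
apply: (eps_ind (F := fun b => cwedge (eps K) (cwedge b c) v)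
  (G := fun b => cwedge (cwedge (eps K) b) c v)) hb => [||L].
- by move=> I x a'; rewrite cwedge_sumlF cwedge_sumr.
- by move=> I x a'; rewrite cwedge_sumrF cwedge_suml.
apply: (eps_ind (F := fun c => cwedge (eps K) (cwedge (eps L) c) v)
  (G := fun c => cwedge (cwedge (eps K) (eps L)) c v)) hc => [||M].
- by move=> I x a'; rewrite cwedge_sumrF cwedge_sumr.
- exact: fun_linear_wr.
by rewrite !cwedge_epsF; apply: eps_ext => s; exact: catf1A.
Qed.

Lemma cwedge11C l n (a b : covector R R 1 n) (c : covector R R l n) :
  alternating a -> alternating b -> alternating c ->
  forall v, cwedge a (cwedge b c) v = - cwedge b (cwedge a c) v.
Proof.
move=> ha hb hc v.
apply: (eps_ind (F := fun a => cwedge a (cwedge b c) v)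
  (G := fun a => - cwedge b (cwedge a c) v)) ha => [||K].
- exact: fun_linear_wl.
- move=> I x a'; rewrite cwedge_sumlF cwedge_sumr -sumrN.
  by apply: eq_bigr => t _; rewrite mulrN.
apply: (eps_ind (F := fun b => cwedge (eps K) (cwedge b c) v)
  (G := fun b => - cwedge b (cwedge (eps K) c) v)) hb => [||L].
- by move=> I x a'; rewrite cwedge_sumlF cwedge_sumr.
- move=> I x a'; rewrite cwedge_suml -sumrN.
  by apply: eq_bigr => t _; rewrite mulrN.
apply: (eps_ind (F := fun c => cwedge (eps K) (cwedge (eps L) c) v)
  (G := fun c => - cwedge (eps L) (cwedge (eps K) c) v)) hc => [||M].
- by move=> I x a'; rewrite cwedge_sumrF cwedge_sumr.
- move=> I x a'; rewrite cwedge_sumrF cwedge_sumr -sumrN.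
  by apply: eq_bigr => t _; rewrite mulrN.
rewrite !cwedge_epsF.
(* On monomials both sides have the same indices, with the first two exchanged. *)
pose s : 'S_(1 + (1 + l)) := tperm ord0 (lift ord0 ord0).
have -> : - eps (catf L (catf K M)) v = (-1) ^+ s * eps (catf L (catf K M)) v.
  by rewrite odd_tperm neq_lift expr1 mulN1r.
rewrite -eps_perm.
apply: eps_ext => t /=; case: tpermP => [->|->|].
- by rewrite catf1_0 catf1_S catf1_0.
- by rewrite catf1_0 catf1_S catf1_0.
case: (unliftP ord0 t) => [u ->|-> //] _.
case: (unliftP ord0 u) => [w ->|-> //] _.
by rewrite !catf1_S.
Qed.

(** The sum over permutations is reindexed by the exchange of the two blocks of rows, which is even:
    it is the product of the transpositions (0 2) and (1 3). *)
Lemma cwedge22C n (a b : covector R R 2 n) v : cwedge a b v = cwedge b a v.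
Proof.
rewrite /cwedge; congr (_ * _).
pose f (i : 'I_(2 + 2)) : 'I_(2 + 2) := match fintype.split i with
  inl x => rshift 2 x | inr x => lshift 2 x end.
have fl x : f (lshift 2 x) = rshift 2 x.
  by rewrite /f -[lshift 2 x]/(unsplit (inl x)) unsplitK.
have fr x : f (rshift 2 x) = lshift 2 x.
  by rewrite /f -[rshift 2 x]/(unsplit (inr x)) unsplitK.
have ff : involutive f.
  by move=> x; rewrite -[x]splitK; case: (fintype.split x) => y /=; rewrite !(fl, fr).
pose t := perm (inv_inj ff).
have st : odd_perm t = false.
  have -> : t = (tperm ord0 (inord 2) * tperm (inord 1) (inord 3))%g.
    apply/permP => -[[|[|[|[|//]]]] i]; rewrite permM [LHS]permE /f; case: splitP => -[[|[|//]] j] //= e;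
    rewrite !permE /= -!val_eqE /= ?inordK //=; apply/val_inj; rewrite /= ?inordK //.
  rewrite odd_permM !odd_tperm -!val_eqE /= !inordK //.
rewrite (reindex_inj (mulgI t)); apply: eq_bigr => s _.
rewrite odd_permM st addFb [a _ * _]mulrC; congr (_ * (_ * _)).
  by congr b; apply/matrixP => i j; rewrite !mxE permM permE fr.
by congr a; apply/matrixP => i j; rewrite !mxE permM permE fl.
Qed.

Lemma cwedge_mulmx (K : fieldType) k l m n (a : covector R K k n) (b : covector R K l n)
    (P : 'M[R]_(m, n)) v :
  cwedge a b (v *m P) = cwedge (fun u => a (u *m P)) (fun u => b (u *m P)) v.
Proof.
rewrite /cwedge; congr (_ * _); apply: eq_bigr => s _.
have -> : row_perm s (v *m P) = row_perm s v *m P.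
  by rewrite !row_permE mulmxA.
by rewrite -{1 2}[row_perm s v]vsubmxK mul_col_mx col_mxKu col_mxKd.
Qed.

Lemma alt_mulmx k m n (a : covector R R k n) (P : 'M[R]_(m, n)) :
  alternating a -> alternating (fun u => a (u *m P)).
Proof.
move=> ha; split=> [r b c u v w h1 h2 h3|r s v rs h].
  apply: (alt_rows ha (r := r)).
  - by rewrite !row_mul h1 mulmxDl !scalemxAl.
  - by move=> s sr; rewrite !row_mul (row'_eqE h2 sr).
  - by move=> s sr; rewrite !row_mul (row'_eqE h3 sr).
by apply: (ha.2 r s) => //; rewrite !row_mul h.
Qed.

Lemma contract_mulmx k m n (a : covector R R k.+1 n) (P : 'M[R]_(m, n)) (X : 'rV[R]_m) v :
  contract (X *m P) a (v *m P) = contract X (fun u => a (u *m P)) v.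
Proof. by rewrite /contract -mul_col_mx. Qed.

Lemma det_alt k : alternating (fun v : 'M[R]_k => \det v).
Proof.
split=> [r b c u v w|r s v rs h]; first exact: determinant_multilinear.
by apply: (determinant_alternate rs) => j; have /rowP/(_ j) := h; rewrite !mxE.
Qed.

Lemma alt_col_mxl k l n (a : covector R R (k + l) n) (v : 'M[R]_(l, n)) :
  alternating a -> alternating (fun u => a (col_mx u v)).
Proof.
move=> ha; split=> [r b c u w z h1 h2 h3|r s u rs h].
  apply: (alt_rows ha (r := lshift l r)); first by rewrite !rowKu.
    move=> s; rewrite -[s]splitK; case: (fintype.split s) => x /=.
      by rewrite (inj_eq (@lshift_inj _ _)) !rowKu => /(row'_eqE h2).
    by rewrite !rowKd.
  move=> s; rewrite -[s]splitK; case: (fintype.split s) => x /=.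
    by rewrite (inj_eq (@lshift_inj _ _)) !rowKu => /(row'_eqE h3).
  by rewrite !rowKd.
by apply: (ha.2 (lshift l r) (lshift l s)); rewrite ?(inj_eq (@lshift_inj _ _)) ?rowKu.
Qed.

Lemma eps_rowsub k m n (K : 'I_k -> 'I_n) (I : 'I_k -> 'I_m) (P : 'M[R]_(m, n)) :
  eps K (rowsub I P) = eps I (rowsub K P^T).
Proof. by rewrite /eps -det_tr; congr (\det _); apply/matrixP => i j; rewrite !mxE. Qed.

Lemma star_std k l (e : bool) (a : covector R R k (k + l)) v :
  alternating a ->
  star 1%:M e a v = (-1) ^+ e * \sum_(K : {ffun 'I_k -> 'I_(k + l)})
    (k`!)%:R^-1 * a (rowsub K 1%:M) * \det (col_mx (rowsub K 1%:M) v).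
Proof.
move=> ha; rewrite /star !mulr_sumr; apply: eq_bigr => K _.
rewrite invmx1 /vol_form det1 sqrtr1 mulr1.
by set x := (-1) ^+ e; clearbody x; ring.
Qed.

Lemma star_eps k l (e : bool) (K : 'I_k -> 'I_(k + l)) v :
  star 1%:M e (eps K) v = (-1) ^+ e * \det (col_mx (rowsub K 1%:M : 'M[R]_(k, k + l)) v).
Proof.
rewrite star_std; last exact: eps_alt.
(* Read backwards, the sum is the expansion of the determinant as an alternating function of its
   first k rows. *)
congr (_ * _); rewrite (alt_expand (alt_col_mxl v (@det_alt (k + l)))).
apply: eq_bigr => I _; rewrite eps_rowsub trmx1.
by rewrite -!mulrA; congr (_ * _); rewrite mulrC.
Qed.

(** The rows of [P] are orthonormal for [g], so the inverse metric is P^T P. One factor P^T goes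
    into the argument of [a] read in the frame; after expanding this form, the sum over [I] becomes
    the expansion of the volume form evaluated on rows of [P]. The sign [e'] compares the
    orientation with that of the frame. *)
Lemma star_mulmx k l (g P : 'M[R]_(k + l)) (e e' : bool) (a : covector R R k (k + l)) :
  alternating a -> P *m g *m P^T = 1%:M ->
  (-1) ^+ e * Num.sqrt (\det g) * \det P = (-1) ^+ e' ->
  forall w, star g e a (w *m P) = star 1%:M e' (fun u => a (u *m P)) w.
Proof.
move=> ha Pg he w.
have [Pu _] : P \in unitmx /\ g \in unitmx.
  have : \det (P *m g *m P^T) != 0 by rewrite Pg det1 oner_neq0.
  rewrite !det_mulmx det_tr !mulf_eq0 !negb_or => /andP[/andP[p q] _].
  by rewrite !unitmxE !unitfE.
have gi : invmx g = P^T *m P.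
  have gP : g *m (P^T *m P) = 1%:M.
    by rewrite mulmxA; apply: mulmx1C; rewrite mulmxA.
  have [gu _] := mulmx1_unit gP.
  by rewrite -[RHS](mulKmx gu) gP mulmx1.
set b := fun u => a (u *m P).
have hb : alternating b by exact: alt_mulmx.
rewrite star_std // /star gi.
set h := fun u => vol_form g e (col_mx u (w *m P)).
have hh : alternating h.
  apply: (alt_col_mxl (a := vol_form g e)).
  apply: alt_ext (alt_lin ((-1) ^+ e * Num.sqrt (\det g)) 0 (@det_alt (k + l)) (@det_alt (k + l))).
  by move=> v; rewrite mul0r addr0.
transitivity (\sum_(I : {ffun 'I_k -> 'I_(k + l)})
    (k`!)%:R^-1 * h (rowsub I 1%:M) * \sum_(K : {ffun 'I_k -> 'I_(k + l)})
      (k`!)%:R^-1 * b (rowsub K 1%:M) * eps I (rowsub K P)).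
  rewrite mulr_sumr; apply: eq_bigr => I _.
  have -> : rowsub I (P^T *m P) = rowsub I P^T *m P.
    by apply/matrixP => i j; rewrite !mxE; apply: eq_bigr => t _; rewrite !mxE.
  rewrite -[a _]/(b (rowsub I P^T)) (alt_expand hb).
  rewrite -[vol_form _ _ _]/(h (rowsub I 1%:M)).
  rewrite [X in _ * X = _]mulrC mulrA; congr (_ * _).
  by apply: eq_bigr => K _; rewrite eps_rowsub trmxK.
under eq_bigr do rewrite mulr_sumr.
rewrite exchange_big mulr_sumr; apply: eq_bigr => K _ /=.
transitivity ((k`!)%:R^-1 * b (rowsub K 1%:M) * h (rowsub K P)).
  rewrite [in RHS](alt_expand hh) mulr_sumr; apply: eq_bigr => I _.
  by rewrite mulrCA.
rewrite [RHS]mulrCA; congr (_ * _); rewrite /h /vol_form.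
have -> : col_mx (rowsub K P) (w *m P) = col_mx (rowsub K 1%:M) w *m P.
  rewrite mul_col_mx; congr col_mx; rewrite mul_rowsub_mx mul1mx //.
by rewrite det_mulmx mulrCA mulrC -he; ring.
Qed.

Lemma star_linear k l (g : 'M[R]_(k + l)) e v :
  fun_linear (fun a : covector R R k (k + l) => star g e a v).
Proof.
move=> I c a; rewrite /star; under [RHS]eq_bigr do rewrite mulrCA mulr_sumr.
rewrite -mulr_sumr exchange_big /=; congr (_ * _); apply: eq_bigr => s _.
by rewrite mulr_suml; apply: eq_bigr => i _; rewrite -mulrA.
Qed.

End Wedge.

(** * Forms with constant integer coefficients *)

Section Monomials.
Context {R : realType} {n : nat} (ix : nat -> 'I_n).

(** Indices are natural numbers, converted by [ix], so that lists of indices are closed data on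
    which the sorting below can be run by computation. *)
Definition mono k (I : seq nat) : covector R R k n :=
  eps (fun s : 'I_k => ix (nth 0%N I s)).
Arguments mono k I v : clear implicits.

Lemma mono_alt k I : alternating (mono k I).
Proof. exact: eps_alt. Qed.

Lemma mono_swap k A i j J v : (size A + (size J).+2)%N = k ->
  mono k (A ++ i :: j :: J) v = - mono k (A ++ j :: i :: J) v.
Proof.
move=> sk.
have h0 : (size A < k)%N by lia.
have h1 : ((size A).+1 < k)%N by lia.
pose s : 'S_k := tperm (Ordinal h0) (Ordinal h1).
have -> : - mono k (A ++ j :: i :: J) v = (-1) ^+ s * mono k (A ++ j :: i :: J) v.
  by rewrite odd_tperm -val_eqE /= neq_ltn ltnSn expr1 mulN1r.
rewrite /mono -eps_perm; apply: eps_ext => t /=; congr ix.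
rewrite !nth_cat; case: tpermP => [->|->|/eqP t0 /eqP t1] /=.
- by rewrite ltnn subnn ltnNge leqnSn /= subSnn.
- by rewrite ltnn subnn ltnNge leqnSn /= subSnn.
case: ltnP => // At; have := t0; have := t1; rewrite -!val_eqE /=.
case: (t - size A)%N (subnK At) => [|[|m]] //= <-; rewrite ?add0n ?eqxx //.
Qed.

Lemma mono_dup k A i J v : (size A + (size J).+2)%N = k ->
  mono k (A ++ i :: i :: J) v = 0.
Proof. by move=> sk; have := mono_swap i i v sk; lra. Qed.

(** Insertion that records the parity of the adjacent swaps made; [None] signals a repeated index,
    for which the monomial is zero. *)
Fixpoint ins (i : nat) (J : seq nat) : option (bool * seq nat) :=
  if J is j :: J' then
    if (i < j)%N then Some (false, i :: J) else if i == j then None else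
    if ins i J' is Some (b, K) then Some (~~ b, j :: K) else None
  else Some (false, [:: i]).

Fixpoint srt (I : seq nat) : option (bool * seq nat) :=
  if I is i :: I' then
    if srt I' is Some (b, J) then
      if ins i J is Some (b', K) then Some (b (+) b', K) else None
    else None
  else Some (false, [::]).

Definition omono k A (o : option (bool * seq nat)) v : R :=
  if o is Some (b, K) then (-1) ^+ b * mono k (A ++ K) v else 0.
Arguments omono k A o v : clear implicits.

Lemma ins_size i J b K : ins i J = Some (b, K) -> size K = (size J).+1.
Proof.
elim: J b K => [|j J IH] b K /=; first by case=> _ <-.
case: ifP => _; first by case=> _ <-.
case: ifP => _ //; case: (ins i J) IH => [[b' K']|//] IH [_ <-] /=.
by rewrite (IH b' K').
Qed.

Lemma srt_size I b K : srt I = Some (b, K) -> size K = size I.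
Proof.
elim: I b K => [|i I IH] b K /=; first by case=> _ <-.
case: (srt I) IH => [[b' K']|//] IH.
case E: (ins i K') => [[b'' K'']|//] [_ <-].
by rewrite (ins_size E) (IH b' K').
Qed.

Lemma ins_mono k A i J v : (size A + (size J).+1)%N = k ->
  mono k (A ++ i :: J) v = omono k A (ins i J) v.
Proof.
elim: J A => [|j J IH] A sk /=; first by rewrite mul1r.
case: ifP => _; first by rewrite /= mul1r.
case: eqP => [->|_]; first by rewrite mono_dup.
rewrite mono_swap // -cat_rcons IH ?size_rcons //; last by rewrite -sk /=; lia.
case: (ins i J) => [[b K]|] /=; last by rewrite oppr0.
by rewrite cat_rcons; case: b; rewrite /= ?expr1 ?expr0 ?mulN1r ?mul1r ?opprK.
Qed.

(** The prefix [A] holds the indices already passed: the degree [k] of the monomial stays fixed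
    while the induction runs on the tail. *)
Lemma srt_monoA k A I v : (size A + size I)%N = k ->
  mono k (A ++ I) v = omono k A (srt I) v.
Proof.
elim: I A => [|i I IH] A sk /=; first by rewrite mul1r.
rewrite -cat_rcons IH ?size_rcons; last by rewrite -sk /= addSnnS.
case E: (srt I) => [[b J]|] //=.
rewrite cat_rcons ins_mono; last by rewrite (srt_size E) -sk.
case: (ins i J) => [[b' K]|] /=; last by rewrite mulr0.
by rewrite signr_addb mulrA.
Qed.

Lemma srt_mono k I v : size I = k -> mono k I v = omono k [::] (srt I) v.
Proof. by move=> sk; rewrite -(srt_monoA (A := [::])). Qed.

(* The pair [(c, [:: i_1; ..; i_k])] stands for the constant form
   [c e^(i_1) /\ .. /\ e^(i_k)]. Identities between such forms are decided by
   sorting indices and collecting terms, see [is_null]. *)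
Definition formal := seq (int * seq nat).

Definition interp k (P : formal) : covector R R k n := fun v =>
  \sum_(t <- P) t.1%:~R * mono k t.2 v.
Arguments interp k P v : clear implicits.

Fixpoint addm (t : int * seq nat) (P : formal) : formal :=
  if P is u :: P' then
    if u.2 == t.2 then (t.1 + u.1, u.2) :: P' else u :: addm t P'
  else [:: t].

Definition norm_step (t : int * seq nat) (P : formal) : formal :=
  if srt t.2 is Some (b, J) then addm (if b then - t.1 else t.1, J) P else P.

(** The lengths are tested because [mono k] pads a short list with index 0 and ignores the end of a
    long one, so sorting would then be unsound. *)
Definition is_null k (P : formal) : bool :=
  all (fun t => size t.2 == k) P &&
  all (fun t => t.1 == 0) (foldr norm_step [::] P).

Lemma interp_addm k t P v :
  interp k (addm t P) v = t.1%:~R * mono k t.2 v + interp k P v.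
Proof.
rewrite /interp; elim: P => [|u P IH] /=; first by rewrite big_seq1 big_nil addr0.
case: eqP => [ut|_]; last by rewrite !big_cons IH; ring.
by rewrite !big_cons /= ut intrD; ring.
Qed.

Lemma is_nullP k P v : is_null k P -> interp k P v = 0.
Proof.
move=> /andP[sP nP].
have -> : interp k P v = interp k (foldr norm_step [::] P) v.
  elim: P sP {nP} => //= t P IH /andP[/eqP st /IH {}IH].
  rewrite /interp big_cons -/(interp k P v) IH srt_mono // /norm_step.
  case: (srt t.2) => [[b J]|] /=; last by rewrite mulr0 add0r.
  rewrite -/(interp k (addm _ _) v) interp_addm /=; congr (_ + _).
  by case: b; rewrite ?rmorphN /= ?expr1 ?mulN1r ?mulrN ?mulNr ?mul1r.
rewrite /interp big_seq big1 // => t /(allP nP)/eqP ->.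
by rewrite mul0r.
Qed.

Definition popp (P : formal) : formal := [seq (- t.1, t.2) | t <- P].
Definition pscale (c : int) (P : formal) : formal := [seq (c * t.1, t.2) | t <- P].

Lemma interp_cat k P Q v : interp k (P ++ Q) v = interp k P v + interp k Q v.
Proof. by rewrite /interp big_cat. Qed.

Lemma interp_opp k P v : interp k (popp P) v = - interp k P v.
Proof.
rewrite /interp big_map -sumrN; apply: eq_bigr => t _ /=.
by rewrite rmorphN mulNr.
Qed.

Lemma interp_scale k c P v : interp k (pscale c P) v = c%:~R * interp k P v.
Proof.
rewrite /interp big_map mulr_sumr; apply: eq_bigr => t _ /=.
by rewrite rmorphM /= mulrA.
Qed.

Lemma interp_eq k P Q v : is_null k (P ++ popp Q) -> interp k P v = interp k Q v.
Proof.
by move/(is_nullP v)/eqP; rewrite interp_cat interp_opp subr_eq0 => /eqP.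
Qed.

Lemma interp_sum k P : interp k P =
  fun v => \sum_(j < size P) (nth (0, [::]) P j).1%:~R * mono k (nth (0, [::]) P j).2 v.
Proof. by apply: funext => v; rewrite /interp (big_nth (0, [::])) big_mkord. Qed.

Lemma interp_alt k P : alternating (interp k P).
Proof. by rewrite interp_sum; apply: alt_sum => j; exact: mono_alt. Qed.

Definition pwedge (P Q : formal) : formal :=
  flatten [seq [seq (t.1 * u.1, t.2 ++ u.2) | u <- Q] | t <- P].

Lemma mono_cat k l I J v : size I = k -> cwedge (mono k I) (mono l J) v = mono (k + l) (I ++ J) v.
Proof.
move=> sI; rewrite cwedge_eps; apply: eps_ext => s; rewrite -[s]splitK.
case: (fintype.split s) => a /=; rewrite nth_cat sI.
  by rewrite catf_l ltn_ord.
by rewrite catf_r ltnNge leq_addr /= addKn.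
Qed.

Lemma interp_wedge k l P Q v : all (fun t => size t.2 == k) P ->
  cwedge (interp k P) (interp l Q) v = interp (k + l) (pwedge P Q) v.
Proof.
move=> sP; rewrite {1}(interp_sum k) {1}(interp_sum l) cwedge_suml.
rewrite /interp /pwedge big_flatten big_map (big_nth (0, [::])) big_mkord.
apply: eq_bigr => i _; rewrite cwedge_sumr big_map (big_nth (0, [::])) big_mkord mulr_sumr.
apply: eq_bigr => j _ /=; rewrite mono_cat ?rmorphM ?mulrA //.
by apply/eqP/(allP sP)/mem_nth.
Qed.

Definition mcontr (i : nat) (I : seq nat) : formal :=
  [seq ((-1) ^+ s, take s I ++ drop s.+1 I) | s <- iota 0%N (size I) & nth 0%N I s == i].
Definition pcontr (i : nat) (P : formal) : formal :=
  flatten [seq pscale t.1 (mcontr i t.2) | t <- P].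

Hypothesis ixK : forall i, (i < n)%N -> ix i = i :> nat.

Lemma mono_contr k (i : 'I_n) I v : size I = k.+1 -> all (fun j => (j < n)%N) I ->
  contract (delta_mx 0 i) (mono k.+1 I) v = interp k (mcontr i I) v.
Proof.
move=> sI In; rewrite /contract {1}/mono {1}/eps (expand_det_row _ ord0).
rewrite /interp /mcontr big_map big_filter sI.
have -> : iota 0%N k.+1 = index_iota 0%N k.+1 by rewrite /index_iota subn0.
rewrite [RHS]big_mkord [RHS]big_mkcond /=; apply: eq_bigr => s _.
have Is : (nth 0%N I s < n)%N by apply: (allP In); rewrite mem_nth // sI.
rewrite [X in X * _]mxE.
have -> : (col_mx (delta_mx 0 i : 'rV[R]_n) v : 'M[R]_(1 + k, n)) ord0 (ix (nth 0%N I s)) = (nth 0%N I s == i)%:R.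
  have /rowP/(_ (ix (nth 0%N I s))) := row_col_mx0 (delta_mx 0 i) v.
  by rewrite !mxE /= -val_eqE /= ixK.
case: eqP => _; last by rewrite mul0r.
rewrite mul1r /cofactor add0n rmorphXn rmorphN1; congr (_ * _).
rewrite /mono /eps; congr (\det _); apply/matrixP => a b; rewrite [LHS]mxE [LHS]mxE [LHS]mxE [RHS]mxE.
have -> : (col_mx (delta_mx 0 i : 'rV[R]_n) v : 'M[R]_(1 + k, n)) (lift ord0 a) (ix (nth 0%N I (lift s b))) =
   v a (ix (nth 0%N I (lift s b))).
  have /rowP/(_ (ix (nth 0%N I (lift s b)))) := row_col_mxS (delta_mx 0 i) v a.
  by rewrite !mxE.
congr (v a (ix _)); rewrite nth_cat size_take sI ltn_ord /= /bump.
case: (leqP s b) => sb; first by rewrite nth_drop addSn subnKC // add1n.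
by rewrite nth_take.
Qed.

Lemma interp_contr k (i : 'I_n) P v :
  all (fun t => (size t.2 == k.+1) && all (fun j => (j < n)%N) t.2) P ->
  contract (delta_mx 0 i) (interp k.+1 P) v = interp k (pcontr i P) v.
Proof.
rewrite /contract /pcontr; elim: P => [|t P IH] /=; first by rewrite /interp !big_nil.
move=> /andP[/andP[/eqP st tn] /IH {}IH].
rewrite interp_cat interp_scale -mono_contr // -IH.
by rewrite /interp big_cons.
Qed.

Definition compl (I : seq nat) := [seq j <- iota 0%N n | j \notin I].
Definition star_ok k (t : int * seq nat) := let I := t.2 in
  [&& size I == k, uniq I, all (fun j => (j < n)%N) I,
   size (compl I) == (n - k)%N &
   if srt (I ++ compl I) is Some (_, K) then K == iota 0%N n else false].
(** In the flat metric the star of e^I is e^J up to sign, where [J] is the increasing complement of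
    [I] and the sign is that of the permutation sorting [I ++ J]. *)
Definition pstar (P : formal) : formal :=
  [seq (if srt (t.2 ++ compl t.2) is Some (b, _) then if b then - t.1 else t.1 else 0,
        compl t.2) | t <- P].

Lemma mono_iota (v : 'M[R]_n) : mono n (iota 0%N n) v = \det v.
Proof.
rewrite /mono /eps; congr (\det _); apply/matrixP => i j; rewrite !mxE.
by congr (v i _); apply/val_inj; rewrite nth_iota ?ltn_ord // add0n; exact: ixK (ltn_ord j).
Qed.

End Monomials.
Arguments mono {R n} ix k I v.
Arguments interp {R n} ix k P v.

(** * The flat Hodge star on monomials *)

Section Star.
Context {R : realType} {k l : nat} (ix : nat -> 'I_(k + l)).
Hypothesis ixK : forall i, (i < k + l)%N -> ix i = i :> nat.

(** The matrix [w] has the basis vectors of [I] as its first rows and [v] below. Its columns taken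
    in the order [I ++ J] form a block triangular matrix with identity corner, whose determinant is
    the minor [J] of [v]; restoring the natural order of the columns costs the sorting sign. *)
Lemma mono_star e t v : star_ok (n := k + l) k t ->
  star 1%:M e (mono (R := R) ix k t.2) v =
  (-1) ^+ e * interp ix l (pstar (n := k + l) [:: (1, t.2)]) v.
Proof.
case: t => c I /= /and5P[/eqP sI uI In /eqP sJ].
rewrite /interp /= big_seq1 /= star_eps => eI; congr (_ * _).
set J := compl I in sJ eI *; rewrite addKn in sJ.
set K := fun _ => _; set w := col_mx _ _.
have Id x : (x < k)%N -> (nth 0%N I x < k + l)%N by move=> xk; apply: (allP In); rewrite mem_nth // sI.
have Jd x : (x < l)%N -> nth 0%N J x \in J by move=> xk; rewrite mem_nth // sJ.
have e1 : mono ix (k + l) (I ++ J) w = mono ix l J v.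
  have wu a j : w (lshift l a) j = (K a == j)%:R by rewrite /w col_mxEu !mxE.
  have wd a j : w (rshift k a) j = v a j by rewrite /w col_mxEd.
  clearbody w; rewrite /mono /eps.
  have -> : colsub (fun s : 'I_(k + l) => ix (nth 0%N (I ++ J) s)) w =
    block_mx 1%:M 0 (colsub K v) (colsub (fun s : 'I_l => ix (nth 0%N J s)) v).
    rewrite -[LHS]submxK; congr block_mx; apply/matrixP => a b;
      rewrite !mxE ?wu ?wd !nth_cat /= ?sI ?ltn_ord ?[(k + _ < k)%N]ltnNge ?leq_addr ?addKn //=.
    - rewrite -val_eqE /= /K !ixK ?Id ?ltn_ord //.
      by rewrite nth_uniq ?sI ?ltn_ord.
    - rewrite -val_eqE /= /K !ixK ?Id ?ltn_ord //; last first.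
        by have := Jd _ (ltn_ord b); rewrite mem_filter mem_iota => /andP[_ /andP[]].
      have := Jd _ (ltn_ord b); rewrite mem_filter => /andP[/negP h _].
      by case: eqP => // E; case: h; rewrite -E mem_nth // sI.
  by rewrite det_lblock det1 mul1r.
have := @srt_mono R _ ix (k + l) (I ++ J) w.
rewrite size_cat sI sJ => /(_ erefl); rewrite e1.
case: (srt (I ++ J)) eI => [[b M]|//] /eqP -> /=; rewrite mono_iota // => ->.
by case: b; rewrite ?expr1 ?expr0 ?mul1r ?mulN1r ?mulrNz ?mulr1z ?mulN1r ?opprK.
Qed.

Lemma interp_star e P v : all (star_ok (n := k + l) k) P ->
  star 1%:M e (interp (R := R) ix k P) v = (-1) ^+ e * interp ix l (pstar (n := k + l) P) v.
Proof.
move=> sP; rewrite [in LHS]interp_sum star_linear /interp big_map mulr_sumr.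
rewrite [RHS](big_nth (0, [::])) big_mkord; apply: eq_bigr => j _.
rewrite (mono_star _ _ (t := nth (0, [::]) P j)); last by apply: (allP sP); rewrite mem_nth.
rewrite /interp big_seq1 /= mulrCA; congr (_ * _); rewrite mulrA; congr (_ * _).
case: (srt _) => [[[] M]|]; rewrite ?mulr0 // ?mulr1 // ?rmorphN ?mulrN ?mulr1 //.
Qed.

End Star.

(** * Linear algebra of the G2-structure on the product *)

(* The complex coordinates of the model are [z_j = x_(2j) + i x_(2j+1)], j = 0, 1, 2,
   and [dr] is the covector of index 6; [re0 + i im0] is [dz_0 /\ dz_1 /\ dz_2]. *)
Definition om0 : formal := [:: (1, [:: 0; 1]%N); (1, [:: 2; 3]%N); (1, [:: 4; 5]%N)].
Definition re0 : formal :=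
  [:: (1, [:: 0; 2; 4]%N); (-1, [:: 0; 3; 5]%N); (-1, [:: 1; 2; 5]%N); (-1, [:: 1; 3; 4]%N)].
Definition im0 : formal :=
  [:: (1, [:: 1; 2; 4]%N); (1, [:: 0; 3; 4]%N); (1, [:: 0; 2; 5]%N); (-1, [:: 1; 3; 5]%N)].
Definition cov0 (i : nat) : formal := [:: (1, [:: i])].
Definition phi0 : formal := re0 ++ pwedge (cov0 6) om0.
Definition psi0 : formal :=
  [:: (1, [:: 0; 1; 2; 3]%N); (1, [:: 0; 1; 4; 5]%N); (1, [:: 2; 3; 4; 5]%N)] ++
  popp (pwedge (cov0 6) im0).
(** [dphi0 i] and [stardphi0 i] are [d phi] and its star in the model when dL is the basis covector
    e^i, and contraction with the basis vector [i] is then contraction with the gradient of L.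
    Everything is linear in dL, so the six values of [i] suffice. *)
Definition dphi0 i : formal :=
  popp (pwedge (cov0 i) re0 ++ pwedge (cov0 6) (pwedge (cov0 i) om0)).
Definition stardphi0 i : formal :=
  pwedge (cov0 6) (pcontr i im0) ++ popp (pwedge (pcontr i om0) om0).

(** * Identities of the flat model, decided by computation *)

Lemma flat_G2 : all (fun i => all (fun j =>
  is_null 7 (pwedge (pwedge (pcontr i phi0) (pcontr j phi0)) phi0 ++
    popp [:: (if i == j then 6%:Z else 0, iota 0%N 7)])) (iota 0%N 7)) (iota 0%N 7).
Proof. by vm_compute. Qed.

Lemma flat_star_phi : all (star_ok (n := 3 + 4) 3) phi0 &&
  is_null 4 (pstar (n := 3 + 4) phi0 ++ popp psi0).
Proof. by vm_compute. Qed.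

Lemma flat_star_psi : all (star_ok (n := 4 + 3) 4) psi0 &&
  is_null 3 (pstar (n := 4 + 3) psi0 ++ popp phi0).
Proof. by vm_compute. Qed.

(* [pstar] only accepts monomials without repeated indices. *)
Definition dphi1 i : formal := [seq t <- dphi0 i | uniq t.2].

Lemma flat_star_dphi : all (fun i => [&& is_null 4 (dphi0 i ++ popp (dphi1 i)),
  all (star_ok (n := 4 + 3) 4) (dphi1 i) &
  is_null 3 (pstar (n := 4 + 3) (dphi1 i) ++ popp (stardphi0 i))]) (iota 0%N 6).
Proof. by vm_compute. Qed.

Lemma flat_phi_dphi : all (fun i => is_null 7 (pwedge phi0 (dphi0 i))) (iota 0%N 6).
Proof. by vm_compute. Qed.

Lemma flat_omega2 : is_null 4 (pwedge om0 om0 ++ popp (pscale 2%:Z (take 3 psi0))).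
Proof. by vm_compute. Qed.

Lemma flat_omega3 : is_null 6 (pwedge (pwedge om0 om0) om0 ++ popp [:: (6%:Z, iota 0%N 6)]).
Proof. by vm_compute. Qed.

Lemma flat_reim : [&& is_null 6 (pwedge re0 re0), is_null 6 (pwedge im0 im0),
  is_null 6 (pwedge re0 im0 ++ popp [:: (4%:Z, iota 0%N 6)]) &
  is_null 6 (pwedge im0 re0 ++ popp [:: (- 4%:Z, iota 0%N 6)])].
Proof. by vm_compute. Qed.

Section Product7.
Context {R : realType}.

Definition p1 (K : Type) k (a : covector R K k 6) : covector R K k (6 + 1) :=
  fun v => a (lsubmx v).
Definition drc : covector R R 1 (6 + 1) := fun v => rsubmx v 0 0.

Lemma cwedge_p1 (K : fieldType) k l (a : covector R K k 6) (b : covector R K l 6) :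
  cwedge (p1 a) (p1 b) = p1 (cwedge a b).
Proof.
apply: funext => v; rewrite /cwedge /p1; congr (_ * _); apply: eq_bigr => s _.
congr (_ * (a _ * b _)); apply/matrixP => i j; rewrite !mxE;
  congr (v _ _); exact/val_inj.
Qed.

Lemma row_lsubmx k (v : 'M[R]_(k, 6 + 1)) r : row r (lsubmx v) = lsubmx (row r v).
Proof. by apply/rowP => j; rewrite !mxE. Qed.

Lemma p1_alt k (a : covector R R k 6) : alternating a -> alternating (p1 a).
Proof.
move=> ha; split=> [r b c u v w h1 h2 h3|r s v rs h].
  apply: (alt_rows ha (r := r)).
  - by rewrite !row_lsubmx h1 linearD /= !linearZ.
  - by move=> s sr; rewrite !row_lsubmx (row'_eqE h2 sr).
  - by move=> s sr; rewrite !row_lsubmx (row'_eqE h3 sr).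
by apply: (ha.2 r s) => //; rewrite !row_lsubmx h.
Qed.

Lemma drc_alt : alternating drc.
Proof.
split=> [r b c u v w h1 h2 h3|r s v rs h]; last by case/eqP: rs; rewrite !ord1.
by have /rowP/(_ (rshift 6 0)) := h1; rewrite !mxE !ord1 /drc !mxE.
Qed.

Lemma cwedge_Zl k l n x (a : covector R R k n) (b : covector R R l n) :
  cwedge (fun u => x * a u) b = fun v => x * cwedge a b v.
Proof.
apply: funext => v; have := cwedge_linl x 0 a a b v.
rewrite mul0r addr0 => <-; congr (cwedge _ b v); apply: funext => u.
by rewrite mul0r addr0.
Qed.

Lemma cwedge_Zr k l n x (a : covector R R k n) (b : covector R R l n) :
  cwedge a (fun u => x * b u) = fun v => x * cwedge a b v.
Proof.
apply: funext => v; have := cwedge_linr x 0 a b b v.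
rewrite mul0r addr0 => <-; congr (cwedge a _ v); apply: funext => u.
by rewrite mul0r addr0.
Qed.

Lemma cwedge_mulmxF (K : fieldType) k l m n (a : covector R K k n) (b : covector R K l n)
    (P : 'M[R]_(m, n)) :
  (fun v => cwedge a b (v *m P)) = cwedge (fun u => a (u *m P)) (fun u => b (u *m P)).
Proof. by apply: funext => v; exact: cwedge_mulmx. Qed.

Definition i6 : nat -> 'I_6 := inord.
Definition i7 : nat -> 'I_(6 + 1) := inord.
Definition F6 k (P : formal) : covector R R k 6 := interp i6 k P.
Arguments F6 k P v : clear implicits.
Definition F7 k (P : formal) : covector R R k (6 + 1) := interp i7 k P.
Arguments F7 k P v : clear implicits.

Lemma i7K i : (i < 6 + 1)%N -> i7 i = i :> nat.
Proof. exact: inordK. Qed.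
Lemma i6K i : (i < 6)%N -> i6 i = i :> nat.
Proof. exact: inordK. Qed.

Definition small k (P : formal) :=
  all (fun t => (size t.2 == k) && all (fun j => (j < 6)%N) t.2) P.

Lemma F7_p1 k P : small k P -> p1 (F6 k P) = F7 k P.
Proof.
move=> sP; apply: funext => v; rewrite /p1 /F6 /F7 /interp !big_seq.
apply: eq_bigr => -[c I] /(allP sP)/andP[/eqP /= sI In]; congr (_ * _).
rewrite /mono /eps; congr (\det _); apply/matrixP => r s; rewrite !mxE.
congr (v r _); apply/val_inj => /=.
have Is : (nth 0%N I s < 6)%N by apply: (allP In); rewrite mem_nth // sI.
by rewrite i6K // i7K // ltnS ltnW.
Qed.

Lemma lin_row (X : 'rV[R]_6) k (a : covector R R k.+1 6) : alternating a ->
  contract X a = fun v => \sum_i X 0 i * contract (delta_mx 0 i) a v.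
Proof.
move=> ha; apply: funext => v; rewrite /contract.
rewrite (lin_expand (f := fun u => a (col_mx u v))) // => *.
exact: alt_row0_lin.
Qed.

Lemma sign_pos_inj (e e' : bool) (x y : R) : 0 < x -> 0 < y ->
  (-1) ^+ e * x = (-1) ^+ e' * y -> e = e'.
Proof. by move=> x0 y0; case: e; case: e' => //; rewrite ?expr1 ?expr0; lra. Qed.

(** * The G2-structure at a point, in a frame adapted to the SU(3)-structure *)

Section AtPoint.
Context (om : covector R R 2 6) (re im : covector R R 3 6) (f : R) (P : 'M[R]_6).
Hypotheses (f0 : 0 < f) (Pu : P \in unitmx).
Hypotheses (omP : (fun u => om (u *m P)) = F6 2 om0)
  (reP : (fun u => re (u *m P)) = fun u => f * F6 3 re0 u)
  (imP : (fun u => im (u *m P)) = fun u => f * F6 3 im0 u).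

(** The last frame vector is f^-1 times the circle direction, since in [phi7] it is f dr that plays
    the role of e^6. The metric [g7] makes the rows of [P7] orthonormal, and [e7] makes this frame
    positively oriented. *)
Definition P7 : 'M[R]_(6 + 1) := block_mx P 0 0 (f^-1)%:M.
Definition g7 : 'M[R]_(6 + 1) := invmx P7 *m (invmx P7)^T.
Definition e7 : bool := \det P7 < 0.

Lemma P7_unit : P7 \in unitmx.
Proof.
rewrite unitmxE det_ublock det_scalar1 unitrM -unitmxE Pu unitfE.
by rewrite invr_eq0 gt_eqF.
Qed.

Lemma lsubmx_P7 k (w : 'M[R]_(k, 6 + 1)) : lsubmx (w *m P7) = lsubmx w *m P.
Proof.
by rewrite -{1}[w]hsubmxK mul_row_block !mulmx0 addr0 row_mxKl.
Qed.

Lemma rsubmx_P7 k (w : 'M[R]_(k, 6 + 1)) : rsubmx (w *m P7) = f^-1 *: rsubmx w.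
Proof.
by rewrite -{1}[w]hsubmxK mul_row_block !mulmx0 add0r row_mxKr mul_mx_scalar.
Qed.

Lemma p1_P7 (K : Type) k (a : covector R K k 6) :
  (fun w => p1 a (w *m P7)) = p1 (fun u => a (u *m P)).
Proof. by apply: funext => w; rewrite /p1 lsubmx_P7. Qed.

Lemma drc_P7 : (fun w => drc (w *m P7)) = fun w => f^-1 * F7 1 (cov0 6) w.
Proof.
apply: funext => w; rewrite /drc rsubmx_P7 mxE; congr (_ * _).
rewrite /F7 /interp big_seq1 mul1r /mono /eps det_mx11 !mxE.
by congr (w _ _); apply/val_inj; rewrite /= i7K.
Qed.

Definition phi7 : covector R R 3 (6 + 1) := fun v =>
  f^-1 * p1 re v + f * cwedge drc (p1 om) v.
Definition psi7 : covector R R 4 (6 + 1) := fun v =>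
  2^-1 * cwedge (p1 om) (p1 om) v - cwedge drc (p1 im) v.

Lemma phi7_P7 : (fun w => phi7 (w *m P7)) = F7 3 phi0.
Proof.
rewrite /phi7; apply: funext => w; rewrite cwedge_mulmx drc_P7 !p1_P7 omP.
rewrite -[p1 re _]/((fun w => p1 re (w *m P7)) w) p1_P7 reP.
rewrite F7_p1 // cwedge_Zl /F7 /phi0 interp_cat; congr (_ + _).
  rewrite /p1 mulKf ?gt_eqF // -/(p1 (F6 3 re0) w) F7_p1 //.
by rewrite mulVKf ?gt_eqF // interp_wedge.
Qed.

Lemma psi7_P7 : (fun w => psi7 (w *m P7)) = F7 4 psi0.
Proof.
rewrite /psi7; apply: funext => w; rewrite !cwedge_mulmx drc_P7 !p1_P7 omP imP.
rewrite F7_p1 //.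
have -> : p1 (fun u => f * F6 3 im0 u) = fun u => f * F7 3 im0 u.
  by rewrite -F7_p1.
rewrite cwedge_Zl cwedge_Zr mulKf ?gt_eqF // /F7 !interp_wedge //.
rewrite (interp_eq i7 w flat_omega2) interp_scale mulKf ?pnatr_eq0 //.
by rewrite -interp_opp -interp_cat.
Qed.

Lemma phi7_alt : alternating phi7.
Proof.
have -> : phi7 = fun v => F7 3 phi0 (v *m invmx P7).
  by apply: funext => v; rewrite -phi7_P7 mulmxKV // P7_unit.
exact/alt_mulmx/interp_alt.
Qed.

Lemma psi7_alt : alternating psi7.
Proof.
have -> : psi7 = fun v => F7 4 psi0 (v *m invmx P7).
  by apply: funext => v; rewrite -psi7_P7 mulmxKV // P7_unit.
exact/alt_mulmx/interp_alt.
Qed.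

Lemma g7_P7 : P7 *m g7 *m P7^T = 1%:M.
Proof.
rewrite /g7 mulmxA mulmxV ?P7_unit // mul1mx -trmx_mul mulmxV ?P7_unit //.
by rewrite trmx1.
Qed.

Lemma det_g7 : (-1) ^+ e7 * Num.sqrt (\det g7) * \det P7 = 1.
Proof.
have dP : \det P7 != 0 by rewrite -unitfE -unitmxE P7_unit.
have -> : \det g7 = (\det P7)^-1 ^+ 2.
  by rewrite /g7 det_mulmx det_tr det_inv expr2.
rewrite sqrtr_sqr normfV mulrAC /e7 -normrEsign ?num_real // divff //.
by rewrite normr_eq0.
Qed.

Lemma star37_P7 (a : covector R R 3 (6 + 1)) w : alternating a ->
  @star R 3 4 g7 e7 a (w *m P7) = @star R 3 4 1%:M false (fun u => a (u *m P7)) w.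
Proof. move=> ha; exact: (@star_mulmx R 3 4 g7 P7 e7 false a ha g7_P7 det_g7). Qed.

Lemma star47_P7 (a : covector R R 4 (6 + 1)) w : alternating a ->
  @star R 4 3 g7 e7 a (w *m P7) = @star R 4 3 1%:M false (fun u => a (u *m P7)) w.
Proof. move=> ha; exact: (@star_mulmx R 4 3 g7 P7 e7 false a ha g7_P7 det_g7). Qed.

Lemma P7_ind k (Q : 'M[R]_(k, 6 + 1) -> Prop) :
  (forall w, Q (w *m P7)) -> forall v, Q v.
Proof. by move=> h v; rewrite -[v](mulmxKV P7_unit). Qed.

Lemma star_phi7 v : @star R 3 4 g7 e7 phi7 v = psi7 v.
Proof.
move: v; apply: P7_ind => w; rewrite star37_P7; last exact: phi7_alt.
rewrite phi7_P7 -[RHS]/((fun w => psi7 (w *m P7)) w) psi7_P7.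
have /andP[h1 h2] := flat_star_phi.
by rewrite /F7 (@interp_star R 3 4 i7 i7K) // expr0 mul1r; exact: interp_eq.
Qed.

Lemma star_psi7 v : @star R 4 3 g7 e7 psi7 v = phi7 v.
Proof.
move: v; apply: P7_ind => w; rewrite star47_P7; last exact: psi7_alt.
rewrite psi7_P7 -[RHS]/((fun w => phi7 (w *m P7)) w) phi7_P7.
have /andP[h1 h2] := flat_star_psi.
by rewrite /F7 (@interp_star R 4 3 i7 i7K) // expr0 mul1r; exact: interp_eq.
Qed.

Lemma mulmx_gram m (A : 'M[R]_m) (x y : 'rV[R]_m) : A \in unitmx ->
  ((x *m A) *m (invmx A *m (invmx A)^T) *m (y *m A)^T) 0 0 = \sum_i x 0 i * y 0 i.
Proof.
move=> Au.
have -> : (x *m A) *m (invmx A *m (invmx A)^T) *m (y *m A)^T = x *m y^T.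
  rewrite trmx_mul !mulmxA -[x *m A *m _]mulmxA mulmxV // mulmx1.
  by rewrite -[x *m _ *m _]mulmxA -trmx_mul mulmxV // trmx1 mulmx1.
by rewrite mxE; apply: eq_bigr => i _; rewrite mxE.
Qed.

Lemma lin_row7 (X : 'rV[R]_(6 + 1)) k (a : covector R R k.+1 (6 + 1)) : alternating a ->
  contract X a = fun v => \sum_i X 0 i * contract (delta_mx 0 i) a v.
Proof.
move=> ha; apply: funext => v; rewrite /contract.
rewrite (lin_expand (f := fun u => a (col_mx u v))) // => *.
exact: alt_row0_lin.
Qed.

(** In the frame [P7] the form is [phi0] and the metric is standard. The defining identity is
    bilinear in [X] and [Y], so it is enough to know it on pairs of basis vectors, which is
    [flat_G2]. *)
Lemma G2_metrics_phi7 : G2_metrics phi7 (g7, e7).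
Proof.
split=> [|X Y v] /=.
  split; first by rewrite /g7 trmx_mul trmxK.
  move=> u u0; rewrite -[u](mulmxKV P7_unit) mulmx_gram ?P7_unit //.
  set x := u *m invmx P7.
  have x0 : x != 0.
    by apply: contra_neq u0 => x0; rewrite -[u](mulmxKV P7_unit) -/x x0 mul0mx.
  rewrite lt_neqAle sumr_ge0 ?andbT => [|i _]; last by rewrite -expr2 sqr_ge0.
  apply: contra_neq x0 => /esym/eqP; rewrite psumr_eq0 => [|i _]; last by rewrite -expr2 sqr_ge0.
  move/allP => h; apply/rowP => i; rewrite [RHS]mxE.
  by have /= := h i (mem_index_enum _); rewrite mulf_eq0 orbb => /eqP.
move: v; apply: P7_ind => w.
rewrite -[X](mulmxKV P7_unit) -[Y](mulmxKV P7_unit).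
set x := X *m _; set y := Y *m _.
rewrite mulmx_gram ?P7_unit // /vol_form (det_mulmx w).
rewrite cwedge_mulmx phi7_P7 cwedge_mulmxF.
have E z : (fun u => contract (z *m P7) phi7 (u *m P7)) = contract z (F7 3 phi0).
  by apply: funext => u; rewrite contract_mulmx phi7_P7.
rewrite !E !(lin_row7 _ (interp_alt i7 3 phi0)).
rewrite cwedge_sumlF cwedge_suml.
transitivity (\sum_i \sum_j x 0 i * y 0 j * ((i == j)%:R * (6 * \det w))).
  apply: eq_bigr => i _; rewrite cwedge_sumrF cwedge_suml mulr_sumr.
  apply: eq_bigr => j _; rewrite mulrA; congr (_ * _).
  have C k : contract (delta_mx 0 k) (F7 3 phi0) = F7 2 (pcontr k phi0).
    by apply: funext => u; exact: (interp_contr i7K).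
  have M (k : 'I_(6 + 1)) : (k : nat) \in iota 0%N 7 by rewrite mem_iota ltn_ord.
  have cS k : (k \in iota 0%N 7) -> all (fun t => size t.2 == 2) (pcontr k phi0).
    by rewrite !inE; do ![move=> /orP[/eqP ->|] //]; move/eqP ->.
  rewrite !C.
  have -> : cwedge (F7 2 (pcontr i phi0)) (F7 2 (pcontr j phi0)) =
     F7 4 (pwedge (pcontr i phi0) (pcontr j phi0)).
    by apply: funext => u; rewrite /F7 interp_wedge // cS.
  rewrite /F7 interp_wedge; last first.
    have := cS _ (M i); have := cS _ (M j).
    elim: (pcontr i phi0) => //= t T IH h /andP[/eqP st /IH {}IH].
    rewrite all_cat {}IH // andbT all_map.
    by apply: sub_all h => t' /eqP /= st'; rewrite size_cat st st'.
  have /allP/(_ _ (M i))/allP/(_ _ (M j)) h := flat_G2.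
  rewrite (interp_eq i7 w h) /interp big_seq1 /= mono_iota; last exact: i7K.
  rewrite -[_ == _ :> nat]/(i == j); case: eqP => _; rewrite ?mul1r ?mul0r //.
have -> : (-1) ^+ e7 * Num.sqrt (\det g7) * (\det w * \det P7) = \det w.
  by rewrite mulrCA det_g7 mulr1.
rewrite mulr_sumr mulr_suml; apply: eq_bigr => i _.
rewrite (bigD1 i) //= eqxx big1 => [|j /negbTE]; first by rewrite mul1r; ring.
by rewrite eq_sym => ->; rewrite mul0r mulr0.
Qed.

(** On the standard basis the identity says that [phi] determines the product of the metric with the
    signed square root of its determinant. Positivity fixes the sign, so g = c g' with c > 0 and c^2
    det g = det g'. In dimension 7 also det g = c^7 det g', hence c^9 = 1 and c = 1. *)
Lemma G2_metrics_uniq phi ge ge' : G2_metrics phi ge -> G2_metrics phi ge' ->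
  \det ge.1 > 0 -> ge = ge' :> ('M[R]_7 * bool).
Proof.
case: ge => g e; case: ge' => g' e' [/= [gT gp] gE] [/= [gT' gp'] gE'] dg.
set d := \det g in dg; set d' := \det g'.
have E (X Y : 'rV[R]_7) : (X *m g *m Y^T) 0 0 * ((-1) ^+ e * Num.sqrt d) =
             (X *m g' *m Y^T) 0 0 * ((-1) ^+ e' * Num.sqrt d').
  have := gE X Y 1%:M; rewrite gE' /vol_form det1 !mulr1 -!mulrA => /mulfI.
  by rewrite pnatr_eq0 => /(_ isT) ->.
have u0 : (delta_mx 0 0 : 'rV[R]_7) != 0.
  by apply/eqP => /rowP/(_ 0); rewrite !mxE /= => /eqP; rewrite oner_eq0.
have := E (delta_mx 0 0) (delta_mx 0 0).
have sd : 0 < Num.sqrt d by rewrite sqrtr_gt0.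
have := gp _ u0; have := gp' _ u0.
set a := (_ *m g *m _) 0 0; set a' := (_ *m g' *m _) 0 0 => a'0 a0 aE.
have sd' : Num.sqrt d' > 0.
  rewrite lt_neqAle sqrtr_ge0 andbT; apply/eqP => h.
  by move/eqP: aE; rewrite -h !mulr0 !mulf_eq0 signr_eq0 (gt_eqF a0) (gt_eqF sd).
have ee : e = e'.
  have p1 : 0 < a * Num.sqrt d by rewrite mulr_gt0.
  have p2 : 0 < a' * Num.sqrt d' by rewrite mulr_gt0.
  by apply: (sign_pos_inj p1 p2); rewrite mulrCA aE mulrCA.
subst e'; congr pair.
set c := Num.sqrt d' / Num.sqrt d.
have c0 : 0 < c by rewrite divr_gt0.
have gc : g = c *: g'.
  apply/matrixP => i j; rewrite mxE.
  have h (B : 'M[R]_7) : ((delta_mx 0 i : 'rV[R]_7) *m B *m (delta_mx 0 j : 'rV[R]_7)^T) 0 0 = B i j.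
    by rewrite -rowE trmx_delta -colE !mxE.
  have := E (delta_mx 0 i) (delta_mx 0 j); rewrite !h => Eij.
  have h' : g i j * Num.sqrt d = g' i j * Num.sqrt d'.
    apply: (mulfI (x := (-1) ^+ e)); first by rewrite signr_eq0.
    by rewrite mulrCA Eij mulrCA.
  by rewrite /c mulrAC [_ * g' i j]mulrC -h' mulfK ?gt_eqF.
have dd : d = c ^+ 7 * d' by rewrite /d gc detZ.
have d'0 : 0 < d' by rewrite -sqrtr_gt0.
have c2 : c ^+ 2 * d = d'.
  by rewrite /c expr_div_n !sqr_sqrtr ?ltW // divfK ?gt_eqF.
have c9 : c ^+ 9 = 1.
  apply: (mulIf (x := d')); first by rewrite gt_eqF.
  by rewrite mul1r -[RHS]c2 dd mulrA -exprD.
have c1 : c = 1 by apply/eqP; rewrite -(@pexpr_eq1 _ c 9) ?ltW // c9.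
by rewrite gc c1 scale1r.
Qed.

Lemma G2_metric_phi7 : G2_metric phi7 = (g7, e7).
Proof.
rewrite /G2_metric; apply: esym; apply: (G2_metrics_uniq G2_metrics_phi7).
  by apply: xgetPex; exists (g7, e7); exact: G2_metrics_phi7.
rewrite /= /g7 det_mulmx det_tr -expr2 lt_neqAle sqr_ge0 andbT eq_sym sqrf_eq0.
by rewrite -unitfE -unitmxE unitmx_inv P7_unit.
Qed.

Section Torsion.
Variable th : 'rV[R]_6.

Definition cov : covector R R 1 6 := fun v => (v *m th^T) 0 0.
(** The vector dual to [th]: P^T P is the inverse of the metric for which the rows of [P] are
    orthonormal. *)
Let X := th *m (P^T *m P).
Definition dphi7 : covector R R 4 (6 + 1) := fun v =>
  - (f^-1 * cwedge (p1 cov) (p1 re) v + f * cwedge drc (cwedge (p1 cov) (p1 om)) v).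

Let thP := th *m P^T.

Lemma cov_P7 : (fun w => p1 cov (w *m P7)) = fun w => \sum_(i < 6) thP 0 i * F7 1 (cov0 i) w.
Proof.
have tP : P *m th^T = thP^T by rewrite /thP trmx_mul trmxK.
rewrite p1_P7; apply: funext => w; rewrite /p1 /cov -mulmxA tP mxE.
apply: eq_bigr => i _; rewrite mulrC mxE; congr (_ * _).
rewrite /F7 /interp big_seq1 mul1r /mono /eps det_mx11 !mxE.
by congr (w _ _); apply/val_inj; rewrite /= i7K // ltnS ltnW.
Qed.

Lemma dphi7_P7 : (fun w => dphi7 (w *m P7)) = fun w => \sum_(i < 6) thP 0 i * F7 4 (dphi0 i) w.
Proof.
apply: funext => w; rewrite /dphi7 !cwedge_mulmx cwedge_mulmxF drc_P7 cov_P7 !p1_P7 omP reP.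
have -> : p1 (fun u => f * F6 3 re0 u) = fun u => f * F7 3 re0 u by rewrite -F7_p1.
rewrite F7_p1 // cwedge_Zl cwedge_Zr cwedge_sumlF cwedge_sumlF cwedge_sumr.
rewrite mulKf ?gt_eqF // mulVKf ?gt_eqF // -big_split -sumrN; apply: eq_bigr => i _ /=.
rewrite -mulrDr -mulrN; congr (_ * _).
have -> : cwedge (F7 1 (cov0 i)) (F7 2 om0) = F7 3 (pwedge (cov0 i) om0).
  by apply: funext => u; rewrite /F7 interp_wedge.
by rewrite /F7 /dphi0 !interp_wedge // interp_opp interp_cat.
Qed.

Lemma dphi7_alt : alternating dphi7.
Proof.
have -> : dphi7 = fun v => \sum_(i < 6) thP 0 i * F7 4 (dphi0 i) (v *m invmx P7).
  apply: funext => v; rewrite -[LHS]/(dphi7 v) -{1}[v](mulmxKV P7_unit).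
  by rewrite -[LHS]/((fun w => dphi7 (w *m P7)) _) dphi7_P7.
by apply: alt_sum => i; exact/alt_mulmx/interp_alt.
Qed.

Lemma phi_dphi7 v : cwedge phi7 dphi7 v = 0.
Proof.
move: v; apply: P7_ind => w; rewrite cwedge_mulmx phi7_P7 dphi7_P7 cwedge_sumr.
rewrite big1 // => i _; rewrite /F7 interp_wedge //.
have M : (i : nat) \in iota 0%N 6 by rewrite mem_iota ltn_ord.
by have /allP/(_ _ M) h := flat_phi_dphi; rewrite is_nullP ?mulr0.
Qed.

Hypotheses (oma : alternating om) (ima : alternating im).

Lemma contract_P7 k (a : covector R R k.+1 6) (A : formal) c : alternating a ->
  (fun u => a (u *m P)) = (fun u => c * F6 k.+1 A u) ->
  all (fun t => (size t.2 == k.+1) && all (fun j => (j < 6)%N) t.2) A ->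
  (forall i : 'I_6, small k (pcontr i A)) ->
  (fun w => p1 (contract X a) (w *m P7)) =
  fun w => \sum_(i < 6) thP 0 i * (c * F7 k (pcontr i A) w).
Proof.
move=> ha aP sA sB; rewrite p1_P7; apply: funext => w; rewrite /p1 /X mulmxA contract_mulmx aP -/thP.
rewrite lin_row; last first.
  apply: alt_ext (alt_lin c 0 (interp_alt i6 _ A) (interp_alt i6 _ A)).
  by move=> v; rewrite mul0r addr0.
apply: eq_bigr => i _; congr (_ * _); rewrite -F7_p1 // /p1 /F6 -interp_contr //.
exact: i6K.
Qed.

(** Both sides are linear in [th], with frame components [thP]; the factors f and f^-1 cancel in the
    frame, and [flat_star_dphi] settles each basis covector. *)
Lemma star_dphi7 v : @star R 4 3 g7 e7 dphi7 v =
  cwedge drc (p1 (contract X im)) v - cwedge (p1 (contract X om)) (p1 om) v.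
Proof.
move: v; apply: P7_ind => w; rewrite star47_P7; last exact: dphi7_alt.
rewrite dphi7_P7 star_linear !cwedge_mulmx drc_P7 (p1_P7 om) omP F7_p1 //.
rewrite (contract_P7 (A := im0) (c := f)) //; last first.
  by move=> -[[|[|[|[|[|[|//]]]]]] i].
rewrite (contract_P7 (A := om0) (c := 1)) //; last 2 first.
- by rewrite omP; apply: funext => u; rewrite mul1r.
- by move=> -[[|[|[|[|[|[|//]]]]]] i].
rewrite cwedge_Zl cwedge_sumr cwedge_suml mulr_sumr -sumrB; apply: eq_bigr => i _.
rewrite !cwedge_Zr !cwedge_Zl mul1r [f^-1 * _]mulrCA mulKf ?gt_eqF // -mulrBr; congr (_ * _).
have M : (i : nat) \in iota 0%N 6 by rewrite mem_iota ltn_ord.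
have /allP/(_ _ M)/and3P[h1 h2 h3] := flat_star_dphi.
have -> : F7 4 (dphi0 i) = F7 4 (dphi1 i) by apply: funext => u; exact: interp_eq.
rewrite /F7 (@interp_star R 4 3 i7 i7K) // expr0 mul1r (interp_eq i7 w h3).
rewrite /stardphi0 interp_cat interp_opp !interp_wedge //.
by move: i {M h1 h2 h3} => -[[|[|[|[|[|[|//]]]]]] j].
Qed.

End Torsion.
End AtPoint.
End Product7.
Arguments F6 {R} k P v.
Arguments F7 {R} k P v.

(** * The SU(3) normal form *)

Section Complex.
Context {R : realType}.
Local Open Scope complex_scope.
Notation Re := complex.Re.
Notation Im := complex.Im.
Implicit Types x y : R[i].

Lemma cReD x y : Re (x + y) = Re x + Re y. Proof. by case: x; case: y. Qed.
Lemma cImD x y : Im (x + y) = Im x + Im y. Proof. by case: x; case: y. Qed.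
Lemma cReN x : Re (- x) = - Re x. Proof. by case: x. Qed.
Lemma cImN x : Im (- x) = - Im x. Proof. by case: x. Qed.
Lemma cReM x y : Re (x * y) = Re x * Re y - Im x * Im y.
Proof. by case: x; case: y. Qed.
Lemma cImM x y : Im (x * y) = Re x * Im y + Im x * Re y.
Proof. by case: x => a b; case: y => c d /=; rewrite addrC. Qed.
Lemma cReJ x : Re (conjc x) = Re x. Proof. by case: x. Qed.
Lemma cImJ x : Im (conjc x) = - Im x. Proof. by case: x. Qed.
Lemma cRe_sum (I : finType) (F : I -> R[i]) : Re (\sum_j F j) = \sum_j Re (F j).
Proof. by elim/big_rec2: _ => // j y1 y2 _ <-; rewrite cReD. Qed.
Lemma cIm_sum (I : finType) (F : I -> R[i]) : Im (\sum_j F j) = \sum_j Im (F j).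
Proof. by elim/big_rec2: _ => // j y1 y2 _ <-; rewrite cImD. Qed.

Lemma complexP x y : Re x = Re y -> Im x = Im y -> x = y.
Proof. by case: x => a b; case: y => c d /= -> ->. Qed.

Lemma sign_complex (b : bool) : (-1) ^+ b = ((-1) ^+ b : R)%:C.
Proof. by rewrite rmorph_sign. Qed.

Lemma cwedge_complex k l n (a : covector R R[i] k n) (b : covector R R[i] l n) v :
  cwedge a b v =
  (cwedge (fun u => Re (a u)) (fun u => Re (b u)) v -
   cwedge (fun u => Im (a u)) (fun u => Im (b u)) v) +i*
  (cwedge (fun u => Re (a u)) (fun u => Im (b u)) v +
   cwedge (fun u => Im (a u)) (fun u => Re (b u)) v).
Proof.
have rnat m : (m%:R : R[i])^-1 = ((m%:R)^-1)%:C by rewrite fmorphV rmorph_nat.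
rewrite /cwedge rnat.
under eq_bigr do rewrite sign_complex.
apply: complexP; rewrite !(cReM, cImM) /= mul0r ?subr0 ?addr0.
  rewrite -mulrBr -sumrB cRe_sum; congr (_ * _); apply: eq_bigr => s _.
  by rewrite !cReM /= mul0r subr0 -mulrBr.
rewrite -mulrDr -big_split cIm_sum; congr (_ * _); apply: eq_bigr => s _ /=.
by rewrite !cImM /= mul0r addr0 -mulrDr.
Qed.

End Complex.

Section SmallDet.
Context {K : comNzRingType}.

Lemma det2E (A : 'M[K]_2) : \det A = A 0 0 * A 1 1 - A 0 1 * A 1 0.
Proof.
rewrite (expand_det_row _ 0) !big_ord_recl big_ord0 /cofactor !det_mx11 !mxE /=.
rewrite !addr0 addn0 addn1 expr0 expr1 mul1r mulN1r mulrN.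
by congr (_ * A _ _ - A _ _ * A _ _); apply/val_inj.
Qed.

Lemma det3E (A : 'M[K]_3) : \det A =
  A 0 0 * (A 1 1 * A 2 2 - A 1 2 * A 2 1)
  - A 0 1 * (A 1 0 * A 2 2 - A 1 2 * A 2 0)
  + A 0 2 * (A 1 0 * A 2 1 - A 1 1 * A 2 0).
Proof.
rewrite (expand_det_row _ 0) !big_ord_recl big_ord0 /cofactor !det2E !mxE /=.
have e0 : (ord0 : 'I_3) = 0 by [].
have e1 : lift ord0 (ord0 : 'I_2) = 1 by exact/val_inj.
have e2 : lift ord0 (lift ord0 (ord0 : 'I_1)) = 2 by exact/val_inj.
have f0 : lift (0 : 'I_3) (0 : 'I_2) = 1 by exact/val_inj.
have f1 : lift (0 : 'I_3) (1 : 'I_2) = 2 by exact/val_inj.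
have g0 : lift (1 : 'I_3) (0 : 'I_2) = 0 by exact/val_inj.
have g1 : lift (1 : 'I_3) (1 : 'I_2) = 2 by exact/val_inj.
have h0 : lift (2 : 'I_3) (0 : 'I_2) = 0 by exact/val_inj.
have h1 : lift (2 : 'I_3) (1 : 'I_2) = 1 by exact/val_inj.
rewrite !(e0, e1, e2) !(f0, f1, g0, g1, h0, h1) /=; ring.
Qed.

End SmallDet.

Section Wedge3.
Context {R : realType} {K : numFieldType}.

Lemma cwedge_111 n (a : 'I_3 -> covector R K 1 n) v :
  cwedge (cwedge (a 0) (a 1)) (a 2) v = \det (\matrix_(r, j) a j (row r v)).
Proof.
have aE j : a j = fun u => \det (\matrix_(r < 1, s < 1) a j (row r u)).
  apply: funext => u; rewrite det_mx11 mxE; congr (a j).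
  by apply/matrixP => x y; rewrite mxE !ord1.
rewrite (aE 0) (aE 1) (aE 2).
have -> : cwedge (fun u => \det (\matrix_(r < 1, s < 1) a 0 (row r u)))
   (fun u => \det (\matrix_(r < 1, s < 1) a 1 (row r u))) =
   fun u : 'M[R]_(2, n) => \det (\matrix_(r, j) (match @fintype.split 1 1 j with inl _ => a 0 | inr _ => a 1 end) (row r u)).
  by apply: funext => u; exact: (cwedge_det (fun=> a 0) (fun=> a 1)).
rewrite (cwedge_det (fun j : 'I_2 => match @fintype.split 1 1 j with inl _ => a 0 | inr _ => a 1 end) (fun=> a 2)).
congr (\det _); apply/matrixP => x y; rewrite [LHS]mxE [RHS]mxE.
case: splitP => [z|z] e.
  by case: splitP => t e'; rewrite !ord1 /= in e'; congr (a _ _); apply/val_inj; rewrite /= e e'.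
by congr (a _ _); apply/val_inj; rewrite /= e ord1.
Qed.

End Wedge3.

(** * Unitary frames adapted to the Kaehler form and the (3,0)-form *)

Section NormalForm.
Context {R : realType}.
Local Open Scope complex_scope.
Notation Re := complex.Re.
Notation Im := complex.Im.

Definition zmx (v : 'M[R]_(3, 6)) : 'M[R[i]]_3 :=
  \matrix_(r, a) (v r (i6 a.*2) +i* v r (i6 a.*2.+1)).

Lemma F6_sum3 v : F6 3 re0 v +i* F6 3 im0 v = \det (zmx v).
Proof.
rewrite /F6 /interp !big_cons !big_nil /mono /eps !det3E !mxE /=.
by apply: complexP; rewrite !(cReD, cImD, cReM, cImM, cReN, cImN) /=; ring.
Qed.

Lemma F6_om (v : 'M[R]_(2, 6)) : F6 2 om0 v = \sum_(a < 3)
  (v 0 (i6 a.*2) * v 1 (i6 a.*2.+1) - v 0 (i6 a.*2.+1) * v 1 (i6 a.*2)).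
Proof.
rewrite /F6 /interp !big_cons !big_nil /mono /eps !det2E !mxE /=.
by rewrite !big_ord_recl big_ord0 /= /bump /=; ring.
Qed.

Context (J : 'M[R]_6) (om : covector R R 2 6).
Hypotheses (JJ : J *m J = - 1%:M) (oma : alternating om)
  (omJ : forall v, om (v *m J) = om v).
Let g : 'M[R]_6 := \matrix_(r, s)
  om (col_mx (delta_mx 0 r : 'rV[R]_6) (delta_mx 0 s *m J)).
Hypothesis gpos : pos_def g.
Let B (u v : 'rV[R]_6) : R := (u *m g *m v^T) 0 0.

Lemma om_linr (u : 'rV[R]_6) b c (v w : 'rV[R]_6) :
  om (col_mx u (b *: v + c *: w)) = b * om (col_mx u v) + c * om (col_mx u w).
Proof.
apply: (alt_rows (alt_contract u oma) (r := 0)).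
- by rewrite !row_id.
- by move=> s; rewrite ord1.
- by move=> s; rewrite ord1.
Qed.

Lemma om_gram (u v : 'rV[R]_6) : om (col_mx u (v *m J)) = B u v.
Proof.
rewrite (lin_expand (f := fun u => om (col_mx u (v *m J)))); last first.
  by move=> *; exact: alt_row0_lin.
rewrite /B -mulmxA mxE; apply: eq_bigr => r _; congr (_ * _).
rewrite (lin_expand (f := fun v => om (col_mx (delta_mx 0 r : 'rV[R]_6) (v *m J)))); last first.
  by move=> b c x y; rewrite mulmxDl -!scalemxAl om_linr.
by rewrite mxE; apply: eq_bigr => s _; rewrite !mxE mulrC.
Qed.

Lemma gram_sym u v : B u v = B v u.
Proof.
have -> : B u v = (u *m g *m v^T)^T 0 0 by rewrite mxE.
by rewrite !trmx_mul trmxK gpos.1 mulmxA.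
Qed.

Lemma gram_linl b c u v w : B (b *: u + c *: v) w = b * B u w + c * B v w.
Proof. by rewrite /B !mulmxDl -!scalemxAl !mxE. Qed.

Lemma gram_linr b c u v w : B w (b *: u + c *: v) = b * B w u + c * B w v.
Proof. by rewrite !(gram_sym w) gram_linl. Qed.

Lemma gramN u v : B u (- v) = - B u v.
Proof. by rewrite /B linearN /= mulmxN mxE. Qed.

Lemma gramNl u v : B (- u) v = - B u v.
Proof. by rewrite !(gram_sym _ v) gramN. Qed.

Lemma JJv (u : 'rV[R]_6) : u *m J *m J = - u.
Proof. by rewrite -mulmxA JJ mulmxN mulmx1. Qed.

Lemma gramJ u v : B (u *m J) (v *m J) = B u v.
Proof. by rewrite -!om_gram -mul_col_mx omJ. Qed.

Lemma gramJr u v : B u (v *m J) = - B (u *m J) v.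
Proof. by rewrite -[in RHS]gramJ JJv gramNl opprK. Qed.

Lemma gram_uuJ u : B u (u *m J) = 0.
Proof. by have := gramJr u u; rewrite [in RHS]gram_sym; lra. Qed.

(** Fewer than six linear conditions on a vector of R^6 have a nonzero solution, which is then
    normalised. *)
Lemma ex_orthonormal (s : seq 'rV[R]_6) : (size s < 6)%N ->
  exists u, B u u = 1 /\ forall p, p \in s -> B u p = 0.
Proof.
move=> s6.
pose q : 'M[R]_(size s, 6) := \matrix_i nth 0 s i.
have : kermx (g *m q^T) != 0.
  rewrite -mxrank_eq0 mxrank_ker subn_eq0 -ltnNge.
  exact: leq_ltn_trans (rank_leq_col _) s6.
move/rowV0Pn => [u /sub_kermxP uq u0].
have Bu : 0 < B u u by exact: gpos.2.
have sB : Num.sqrt (B u u) != 0 by rewrite gt_eqF // sqrtr_gt0.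
exists ((Num.sqrt (B u u))^-1 *: u + 0 *: u); split.
  rewrite gram_linl !gram_linr !mul0r !addr0 mulrA -invfM -expr2 sqr_sqrtr ?ltW //.
  by rewrite mulVf // gt_eqF.
move=> p /(nthP 0) [k ks <-]; rewrite gram_linl mul0r addr0.
suff -> : B u (nth 0 s k) = 0 by rewrite mulr0.
rewrite /B -mulmxA.
have -> : g *m (nth 0 s k)^T = col (Ordinal ks) (g *m q^T).
  by apply/colP => t; rewrite !mxE; apply: eq_bigr => l _; rewrite !mxE.
by rewrite colE !mulmxA -[u *m g *m _]mulmxA uq mul0mx mxE.
Qed.

(** Orthonormality for the Hermitian form with real part [B]: together with their images under [J]
    the three vectors form an orthonormal basis of R^6. *)
Definition unitary (u : 'I_3 -> 'rV[R]_6) := forall a b,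
  B (u a) (u b) = (a == b)%:R /\ B (u a) (u b *m J) = 0.

Lemma ex_unitary : exists u, unitary u.
Proof.
have [u0 [u00 _]] := @ex_orthonormal [::] isT.
have [u1 [u11 h1]] := @ex_orthonormal [:: u0; u0 *m J] isT.
have [u2 [u22 h2]] := @ex_orthonormal [:: u0; u0 *m J; u1; u1 *m J] isT.
have u10 : B u1 u0 = 0 by apply: h1; rewrite !inE eqxx.
have u10J : B u1 (u0 *m J) = 0 by apply: h1; rewrite !inE eqxx orbT.
have u20 : B u2 u0 = 0 by apply: h2; rewrite !inE eqxx.
have u20J : B u2 (u0 *m J) = 0 by apply: h2; rewrite !inE eqxx !orbT.
have u21 : B u2 u1 = 0 by apply: h2; rewrite !inE eqxx !orbT.
have u21J : B u2 (u1 *m J) = 0 by apply: h2; rewrite !inE eqxx !orbT.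
pose H u v (d : bool) := B u v = d%:R /\ B u (v *m J) = 0.
have Hsym u v d : H u v d -> H v u d.
  move=> [h h']; split; first by rewrite gram_sym.
  by move: h'; rewrite gramJr gram_sym => /eqP; rewrite oppr_eq0 => /eqP.
have H00 : H u0 u0 true by split; [exact: u00|exact: gram_uuJ].
have H11 : H u1 u1 true by split; [exact: u11|exact: gram_uuJ].
have H22 : H u2 u2 true by split; [exact: u22|exact: gram_uuJ].
have H10 : H u1 u0 false by split.
have H20 : H u2 u0 false by split.
have H21 : H u2 u1 false by split.
have [H01 H02 H12] := And3 (Hsym _ _ _ H10) (Hsym _ _ _ H20) (Hsym _ _ _ H21).
exists (fun a => nth 0 [:: u0; u1; u2] a).
move=> -[[|[|[|//]]] a3] -[[|[|[|//]]] b3].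
- exact: H00.
- exact: H01.
- exact: H02.
- exact: H10.
- exact: H11.
- exact: H12.
- exact: H20.
- exact: H21.
- exact: H22.
Qed.

Lemma sum6_pairs (V : nmodType) (F : 'I_6 -> V) :
  \sum_r F r = \sum_(a < 3) (F (i6 a.*2) + F (i6 a.*2.+1)).
Proof.
rewrite !big_ord_recl !big_ord0 !addr0 -!addrA.
by do !congr (_ + _); congr F; apply/val_inj; rewrite /= /i6 inordK.
Qed.

Section Frame.
Variable u : 'I_3 -> 'rV[R]_6.
Hypothesis uu : unitary u.

Definition frame : 'M[R]_6 :=
  \matrix_r if odd r then u (inord r./2) *m J else u (inord r./2).

Lemma frame_gram : frame *m g *m frame^T = 1%:M.
Proof.
have E r s : (frame *m g *m frame^T) r s = B (row r frame) (row s frame).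
  by rewrite /B -row_mul [LHS]mxE [RHS]mxE; apply: eq_bigr => k _; rewrite !mxE.
have half (r : 'I_6) : (r./2 < 3)%N by have := ltn_ord r; lia.
apply/matrixP => r s; rewrite E [RHS]mxE !rowK.
have /= h := uu (inord r./2) (inord s./2).
have e : (inord r./2 == inord s./2 :> 'I_3) = (r./2 == s./2).
  by rewrite -val_eqE /= !inordK.
case: (boolP (odd r)) (odd_double_half r) => or; case: (boolP (odd s)) (odd_double_half s) => os /= es er.
- rewrite gramJ h.1 e; congr (_%:R); congr (nat_of_bool _).
  by rewrite -[RHS]val_eqE /=; apply/eqP/eqP; lia.
- rewrite -[B _ _]opprK -gramJr h.2 oppr0.
  by rewrite -val_eqE; case: eqP => // /= rs; rewrite -rs or in os.
- by rewrite h.2 -val_eqE; case: eqP => // /= rs; rewrite rs os in or.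
- rewrite h.1 e; congr (_%:R); congr (nat_of_bool _).
  by rewrite -[RHS]val_eqE /=; apply/eqP/eqP; lia.
Qed.

Lemma frame_unit : frame \in unitmx.
Proof. by have := frame_gram; rewrite -mulmxA => /mulmx1_unit[]. Qed.

Lemma mul_frame (x : 'rV[R]_6) : x *m frame =
  \sum_(a < 3) (x 0 (i6 a.*2) *: u a + x 0 (i6 a.*2.+1) *: (u a *m J)).
Proof.
rewrite mulmx_sum_row sum6_pairs; apply: eq_bigr => a _.
have a1 : (a.*2.+1 < 6)%N by have := ltn_ord a; lia.
have a0 : (a.*2 < 6)%N by exact: ltnW.
have ia : inord a = a :> 'I_3 by apply/val_inj; rewrite /= inordK.
rewrite !rowK !i6K // oddS odd_double /= doubleK.
by rewrite uphalf_double ia.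
Qed.

Lemma om_frame v : om (v *m frame) = F6 2 om0 v.
Proof.
pose x : 'rV[R]_6 := usubmx (v : 'M[R]_(1 + 1, 6)).
pose y : 'rV[R]_6 := dsubmx (v : 'M[R]_(1 + 1, 6)).
transitivity (om (col_mx (x *m frame) (y *m frame))).
  by congr om; rewrite -mul_col_mx /x /y vsubmxK.
have vx j : v 0 j = x 0 j by rewrite /x mxE; congr (v _ _); apply/val_inj.
have vy j : v 1 j = y 0 j by rewrite /y mxE; congr (v _ _); apply/val_inj.
(* The second argument is written as an image under [J], so that omega becomes the metric. *)
have -> : y *m frame = (- (y *m frame *m J)) *m J by rewrite mulNmx JJv opprK.
rewrite om_gram.
rewrite (mul_frame y) mulmx_suml -sumrN.
(* The frame coordinates of - J y. *)
pose z : 'rV[R]_6 := \row_s (if odd s then - y 0 (i6 s.-1) else y 0 (i6 s.+1)).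
have -> : \sum_(a < 3) - ((y 0 (i6 a.*2) *: u a + y 0 (i6 a.*2.+1) *: (u a *m J)) *m J)
  = z *m frame.
  rewrite mul_frame; apply: eq_bigr => a _.
  have a1 : (a.*2.+1 < 6)%N by have := ltn_ord a; lia.
  rewrite !mxE !i6K //; last exact: ltnW.
  rewrite oddS odd_double /= mulmxDl -!scalemxAl JJv scalerN opprD opprK addrC.
  by rewrite scaleNr.
rewrite /B.
have -> : x *m frame *m g *m (z *m frame)^T = x *m z^T.
  by rewrite -[x in RHS]mulmx1 -frame_gram trmx_mul !mulmxA.
rewrite F6_om mxE sum6_pairs; apply: eq_bigr => a _.
have a1 : (a.*2.+1 < 6)%N by have := ltn_ord a; lia.
rewrite !vx !vy !mxE !i6K //; last exact: ltnW.
by rewrite oddS odd_double /= mulrN.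
Qed.

Lemma al_frame1 (al : covector R R[i] 1 6) :
  (forall b c u v, al (b *: u + c *: v) = b%:C * al u + c%:C * al v) ->
  (forall v, al (v *m J) = 'i * al v) ->
  forall x, al (x *m frame) =
    \sum_(a < 3) (x 0 (i6 a.*2) +i* x 0 (i6 a.*2.+1)) * al (u a).
Proof.
move=> al_lin alJ x.
have al0 : al 0 = 0.
  by have := al_lin 0 0 0 0; rewrite !scale0r addr0 !mul0r addr0.
rewrite mul_frame.
transitivity (\sum_(a < 3) al (x 0 (i6 a.*2) *: u a + x 0 (i6 a.*2.+1) *: (u a *m J))).
  elim/big_rec2: _ => // a y z _ <-.
  by rewrite -[X in X + _]scale1r -[z in LHS]scale1r al_lin !mul1r.
apply: eq_bigr => a _; rewrite al_lin alJ mulrA -mulrDl; congr (_ * _).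
by apply: complexP; rewrite !(cReD, cImD, cReM, cImM) /=; ring.
Qed.

Lemma al_frame (al : 'I_3 -> covector R R[i] 1 6) v :
  (forall j b c u v, al j (b *: u + c *: v) = b%:C * al j u + c%:C * al j v) ->
  (forall j v, al j (v *m J) = 'i * al j v) ->
  \matrix_(r, j) al j (row r (v *m frame)) = zmx v *m (\matrix_(a, j) al j (u a)).
Proof.
move=> al_lin alJ; apply/matrixP => r j; rewrite !mxE row_mul (al_frame1 (al_lin j) (alJ j)).
by apply: eq_bigr => a _; rewrite !mxE.
Qed.

End Frame.

(** In a unitary frame [u] a (3,0)-form is k dz_0 /\ dz_1 /\ dz_2 with k = h det(al_j(u_a)).
    Multiplying the first vector by a complex number of modulus 1 keeps the frame unitary and
    multiplies k by that number, so k can be made equal to c = |k|. *)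
Lemma normal_form (al : 'I_3 -> covector R R[i] 1 6) (h : R[i]) (U : covector R R[i] 3 6) :
  (forall j b c u v, al j (b *: u + c *: v) = b%:C * al j u + c%:C * al j v) ->
  (forall j v, al j (v *m J) = 'i * al j v) ->
  (forall v, U v = h * cwedge (cwedge (al 0) (al 1)) (al 2) v) ->
  (exists v, U v != 0) ->
  exists (P : 'M[R]_6) (c : R), [/\ P \in unitmx, 0 < c, P *m g *m P^T = 1%:M,
    (fun v => om (v *m P)) = F6 2 om0
    & (fun v => U (v *m P)) = fun v => c%:C * (F6 3 re0 v +i* F6 3 im0 v)].
Proof.
move=> al_lin alJ UE [v0 Uv0].
have [u uu] := ex_unitary.
pose C w := \matrix_(a, j) al j (w a) : 'M[R[i]]_3.
have UP w : unitary w -> forall v, U (v *m frame w) = h * \det (C w) * \det (zmx v).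
  move=> uw v; rewrite UE.
  rewrite (cwedge_111 al (v *m frame w)).
  rewrite (al_frame w v al_lin alJ).
  rewrite det_mulmx.
  rewrite -mulrA.
  by rewrite (mulrC (\det (zmx v))).
set k := h * \det (C u).
have k0 : k != 0.
  apply: contra_neq Uv0 => k0; rewrite -[v0](mulmxKV (frame_unit uu)) UP //.
  by rewrite -/k k0 mul0r.
pose c := Num.sqrt (Re k ^+ 2 + Im k ^+ 2).
have c0 : 0 < c.
  rewrite sqrtr_gt0 lt_neqAle addr_ge0 ?sqr_ge0 // andbT eq_sym.
  apply: contra k0; rewrite paddr_eq0 ?sqr_ge0 // !sqrf_eq0 => /andP[/eqP a /eqP b].
  by apply/eqP/complexP.
have c2 : c ^+ 2 = Re k ^+ 2 + Im k ^+ 2 by rewrite sqr_sqrtr ?addr_ge0 ?sqr_ge0.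
(* x + i y is the conjugate of k divided by |k|. *)
pose x := Re k / c; pose y := - Im k / c.
have xy : x ^+ 2 + y ^+ 2 = 1.
  by rewrite !expr_div_n sqrrN -mulrDl -c2 divff // sqrf_eq0 gt_eqF.
pose w a := if a == 0 then x *: u 0 + y *: (u 0 *m J) else u a.
have uw : unitary w.
  move=> a b; rewrite /w.
  have JE : (x *: u 0 + y *: (u 0 *m J)) *m J = (- y) *: u 0 + x *: (u 0 *m J).
    by rewrite mulmxDl -!scalemxAl JJv scalerN scaleNr addrC.
  have BJ a' b' : B (u a' *m J) (u b') = 0.
    by rewrite -[B _ _]opprK -gramJr (uu _ _).2 oppr0.
  case: (eqVneq a 0) => a0; case: (eqVneq b 0) => b0.
  - rewrite JE !gram_linl !gram_linr !BJ gramJ !(uu _ _).1 !(uu _ _).2 a0 b0 eqxx.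
    by rewrite -[true%:R]/(1 : R); split; [rewrite -[RHS]xy|]; ring.
  - rewrite !gram_linl !BJ gramJ !(uu _ _).1 !(uu _ _).2 a0 eq_sym (negbTE b0).
    by rewrite -[false%:R]/(0 : R); split; ring.
  - rewrite JE !gram_linr !(uu _ _).1 !(uu _ _).2 b0 (negbTE a0).
    by rewrite -[false%:R]/(0 : R); split; ring.
  - exact: uu.
have Cw : \det (C w) = (x +i* y) * \det (C u).
  rewrite (determinant_multilinear (A := C w) (B := C u) (C := C u) (i0 := 0) (b := x +i* y) (c := 0)) ?mul0r ?addr0 //.
  - apply/rowP => j; rewrite !mxE /w eqxx al_lin alJ mul0r addr0 mulrA -mulrDl; congr (_ * _).
    by apply: complexP; rewrite !(cReD, cImD, cReM, cImM) /=; ring.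
  - by apply/matrixP => a j; rewrite !mxE /w eq_sym (negbTE (neq_lift _ _)).
  - by apply/matrixP => a j; rewrite !mxE /w eq_sym (negbTE (neq_lift _ _)).
exists (frame w), c; split => //; first exact: frame_unit.
- exact: frame_gram.
- by apply: funext => v; exact: om_frame.
apply: funext => v; rewrite UP // F6_sum3; congr (_ * _).
have key a b : c ^+ 2 = a ^+ 2 + b ^+ 2 ->
    a / c * a - (- b / c) * b = c /\ a / c * b + (- b / c) * a = 0.
  move=> ab; have cn : c != 0 by rewrite gt_eqF.
  split; last by ring.
  have -> : a / c * a - (- b / c) * b = (a ^+ 2 + b ^+ 2) / c by ring.
  by rewrite -ab expr2 mulfK.
have [e1 e2] := key _ _ c2.
rewrite Cw mulrCA -/k; apply: complexP.
  by rewrite (cReM (x +i* y) k); exact: e1.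
by rewrite (cImM (x +i* y) k); exact: e2.
Qed.

(** U /\ conj U = -2i Re U /\ Im U, and [re0 /\ im0] is 4 times the volume form; this gives the -8,
    which the factor i/8 in the definition of |U| cancels. *)
Lemma norm_complex_volume (P : 'M[R]_6) (c : R) (U : covector R R[i] 3 6) v :
  P \in unitmx -> 0 < c ->
  (fun v => om (v *m P)) = F6 2 om0 ->
  (fun v => U (v *m P)) = (fun v => c%:C * (F6 3 re0 v +i* F6 3 im0 v)) ->
  (3`!)%:R^-1 * cwedge (cwedge om om) om (v *m P) = \det v /\
  cwedge U (fun w => conjc (U w)) (v *m P) = 0 +i* (- 8 * c ^+ 2 * \det v).
Proof.
move=> Pu c0 omP UP; split.
  rewrite cwedge_mulmx cwedge_mulmxF omP.
  have -> : cwedge (F6 2 om0) (F6 2 om0) = F6 (R := R) 4 (pwedge om0 om0).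
    by apply: funext => u; rewrite /F6 interp_wedge.
  rewrite /F6 interp_wedge // (interp_eq i6 v flat_omega3) /interp big_seq1 /=.
  by rewrite mono_iota ?mulKf ?pnatr_eq0 //; exact: i6K.
rewrite cwedge_mulmx UP.
have -> : (fun u => conjc (U (u *m P))) = (fun u => c%:C * (F6 3 re0 u -i* F6 3 im0 u)).
  apply: funext => u; rewrite -[U _]/((fun v => U (v *m P)) u) UP.
  by apply: complexP; rewrite !(cReJ, cImJ, cReM, cImM) /=; ring.
rewrite cwedge_complex.
have e1 : (fun u => Re (c%:C * (F6 3 re0 u +i* F6 3 im0 u))) = fun u => c * F6 3 re0 u.
  by apply: funext => u; rewrite cReM /=; ring.
have e2 : (fun u => Im (c%:C * (F6 3 re0 u +i* F6 3 im0 u))) = fun u => c * F6 3 im0 u.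
  by apply: funext => u; rewrite cImM /=; ring.
have e3 : (fun u => Re (c%:C * (F6 3 re0 u -i* F6 3 im0 u))) = fun u => c * F6 3 re0 u.
  by apply: funext => u; rewrite cReM /=; ring.
have e4 : (fun u => Im (c%:C * (F6 3 re0 u -i* F6 3 im0 u))) = fun u => - c * F6 3 im0 u.
  by apply: funext => u; rewrite cImM /=; ring.
rewrite e1 e2 e3 e4 !(cwedge_Zl, cwedge_Zr) /F6 !interp_wedge //.
have /and4P[h1 h2 h3 h4] := flat_reim.
rewrite (is_nullP i6 v h1) (is_nullP i6 v h2) (interp_eq i6 v h3) (interp_eq i6 v h4).
rewrite /interp !big_seq1 /= mono_iota; last exact: i6K.
by congr (_ +i* _); ring.
Qed.

End NormalForm.

(** * Differential calculus *)

Local Open Scope classical_set_scope.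
Section Analysis.
Context {R : realType}.

Lemma is_derive_cvg (V W : normedModType R) (f : V -> W) a v l :
  h^-1 *: (f (h *: v + a) - f a) @[h --> 0^'] --> l -> is_derive a v f l.
Proof.
move=> h; apply: DeriveDef; first by apply/cvg_ex; exists l.
by apply: cvg_lim.
Qed.

Lemma is_derive_line (V W : normedModType R) (f : V -> W) (y v : V) (s : R) l :
  is_derive (y + s *: v) v f l -> is_derive s 1 (fun s => f (y + s *: v)) l.
Proof.
case=> df dl; apply: is_derive_cvg.
have E (h : R) : f (y + (h *: (1 : R) + s) *: v) = f (h *: v + (y + s *: v)).
  have -> : h *: (1 : R) + s = h + s by exact: (congr1 (+%R^~ s) (mulr1 h)).
  by rewrite scalerDl addrCA.
under eq_fun do rewrite E.
by rewrite -dl; exact: df.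
Qed.

Lemma within_nbhs_open n (D : set 'rV[R]_n) (x v : 'rV[R]_n) : open D -> D x ->
  within [set h : R | D (x + h *: v)] 0^' = 0^'.
Proof.
move=> oD Dx; apply/seteqP; split=> A; last exact: cvg_within.
rewrite /within /= => h.
have : \forall h \near (0 : R)^', D (x + h *: v).
  apply: nbhs_dnbhs.
  have c : (fun h : R => x + h *: v) @ (0 : R) --> x + (0 : R) *: v.
    by apply: cvgD; [exact: cvg_cst|apply: cvgZr_tmp; exact: cvg_id].
  rewrite scale0r addr0 in c; apply: (c D); exact: open_nbhs_nbhs.
by apply: filterS2 h => h' + ?; exact.
Qed.

Lemma has_partial_derive n (D : set 'rV[R]_n) f j x l : open D -> D x ->
  has_partial D f j x l -> is_derive x (delta_mx 0 j) f l.
Proof.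
rewrite /has_partial => oD Dx; rewrite within_nbhs_open // => h.
apply: is_derive_cvg.
suff -> : (fun t : R => t^-1 *: (f (t *: delta_mx 0 j + x) - f x)) =
  (fun t => t^-1 * (f (x + t *: delta_mx 0 j) - f x)) by exact: h.
by apply: funext => t; rewrite (addrC x).
Qed.

(** The mean value theorem as a comparison with an affine function of slope [c]. The point [b] may
    lie on either side of [a], because increments of coordinates have any sign. *)
Lemma mvt_bound (phi dphi : R -> R) (c e a b : R) :
  (forall s, `|s - a| <= `|b - a| -> is_derive s 1 phi (dphi s) /\ `|dphi s - c| <= e) ->
  `|phi b - phi a - c * (b - a)| <= e * `|b - a|.
Proof.
move=> H.
have [xi [xi_ab E]] : exists xi, `|xi - a| <= `|b - a| /\ phi b - phi a = dphi xi * (b - a).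
  have [ab|ba] := leP a b.
    have Hd s : a <= s <= b -> is_derive s 1 phi (dphi s).
      move=> /andP[as_ sb]; apply: (H s _).1.
      by rewrite !ger0_norm ?subr_ge0 // lerB.
    have [|//|xi] := @MVT_segment R phi dphi a b ab.
    - by move=> s; rewrite in_itv /= => /andP[sa sb]; apply: Hd; rewrite !ltW.
    - apply: derivable_within_continuous => s; rewrite in_itv /= => /Hd[]//.
    rewrite in_itv /= => /andP[h1 h2] E; exists xi; split => //.
    by rewrite !ger0_norm ?subr_ge0 // lerB.
  have Hd s : b <= s <= a -> is_derive s 1 phi (dphi s).
    move=> /andP[bs sa]; apply: (H s _).1.
    by rewrite !ler0_norm ?subr_le0 ?(ltW ba) // lerN2 lerB.
  have [|//|xi] := @MVT_segment R phi dphi b a (ltW ba).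
  - by move=> s; rewrite in_itv /= => /andP[sa sb]; apply: Hd; rewrite !ltW.
  - apply: derivable_within_continuous => s; rewrite in_itv /= => /Hd[]//.
  rewrite in_itv /= => /andP[h1 h2] E; exists xi; split.
    by rewrite !ler0_norm ?subr_le0 ?(ltW ba) // lerN2 lerB.
  by rewrite -[LHS]opprB E -mulrN opprB.
have := (H xi xi_ab).2 => d; rewrite E -mulrBl normrM.
by rewrite ler_wpM2r.
Qed.

Lemma rV_norm_coord n (u : 'rV[R]_n) j : `|u 0 j| <= `|u|.
Proof.
rewrite [leRHS]/Num.Def.normr /= mx_normrE.
exact: (le_bigmax _ (fun i : 'I_1 * 'I_n => `|u i.1 i.2|) (0, j)).
Qed.

Lemma rV_norm_le n (u : 'rV[R]_n) d : 0 <= d -> (forall j, `|u 0 j| <= d) -> `|u| <= d.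
Proof.
move=> d0 H; rewrite [leLHS]/Num.Def.normr /= mx_normrE bigmax_le // => -[i j] _ /=.
by rewrite ord1.
Qed.

Lemma differentiable_eps (V W : normedModType R) (f : V -> W) x : differentiable f x ->
  forall e, 0 < e -> exists2 d, 0 < d &
    forall v, `|v| < d -> `|f (x + v) - f x - 'd f x v| <= e * `|v|.
Proof.
move=> df e e0; have /eqaddoP/(_ _ e0)/nbhs_ballP[d /= d0 H] := diff_locally df.
exists d => // v vd; have := H v; rewrite -ball_normE /= sub0r normrN => /(_ vd).
by rewrite !fctE /= opprD addrA [v + x]addrC.
Qed.

Lemma eps_differentiable (V W : normedModType R) (f : V -> W) (df : {linear V -> W}) x :
  continuous df ->
  (forall e, 0 < e -> exists2 d, 0 < d &
    forall v, `|v| < d -> `|f (x + v) - f x - df v| <= e * `|v|) ->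
  differentiable f x /\ 'd f x = df :> (V -> W).
Proof.
move=> dfc H.
have E : f \o shift x = cst (f x) + df +o_ 0 id.
  apply/eqaddoP => e e0; have [d d0 Hd] := H e e0.
  apply/nbhs_ballP; exists d => //= v; rewrite -ball_normE /= sub0r normrN => vd.
  have := Hd v vd; rewrite !fctE /= opprD addrA [v + x]addrC //.
have D := diff_unique dfc E.
by split => //; apply/diff_locallyP; rewrite D.
Qed.

Lemma open_ball_coord n (D : set 'rV[R]_n) x : open D -> D x ->
  exists2 d, 0 < d & forall v, `|v| < d -> D (x + v).
Proof.
move=> oD Dx; have /nbhs_ballP[d /= d0 H] : nbhs x D by exact: open_nbhs_nbhs.
exists d => // v vd; apply: H; rewrite -ball_normE /= opprD addrA subrr sub0r normrN //.
Qed.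

Lemma continuous_eps n (g : 'rV[R]_n -> R) x : {for x, continuous g} ->
  forall e, 0 < e -> exists2 d, 0 < d & forall v, `|v| < d -> `|g (x + v) - g x| <= e.
Proof.
move=> gc e e0; have /cvgrPdist_le/(_ _ e0)/nbhs_ballP[d /= d0 H] := gc.
exists d => // v vd; rewrite distrC; apply: H; rewrite -ball_normE /= opprD addrA subrr sub0r normrN //.
Qed.

Lemma ex_uniform (I : finType) (P : I -> R -> Prop) :
  (forall j, exists2 d, 0 < d & forall d', d' <= d -> P j d') ->
  exists2 d, 0 < d & forall j, P j d.
Proof.
move=> H; have /choice[d dP] : forall j, exists d, 0 < d /\ forall d', d' <= d -> P j d'.
  by move=> j; have [d ? ?] := H j; exists d.
pose m := \big[Num.min/1]_j d j; exists m.
  by rewrite /m lt_bigmin // => j _; exact: (dP j).1.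
by move=> j; apply: (dP j).2; rewrite /m; exact: bigmin_le.
Qed.

Lemma differentiable_bigsum (V : normedModType R) (I : Type) (r : seq I) (P : pred I)
    (F : I -> V -> R) x :
  (forall j, P j -> differentiable (F j) x) ->
  differentiable (fun y => \sum_(j <- r | P j) F j y) x.
Proof.
move=> H; have -> : (fun y => \sum_(j <- r | P j) F j y) = \sum_(j <- r | P j) F j.
  by apply: funext => y; rewrite fct_sumE.
elim/big_ind: _ => [|a b ha hb|j Pj]; [exact: differentiable_cst|exact: differentiableD|exact: H].
Qed.

Lemma differentiable_bigprod (V : normedModType R) (I : Type) (r : seq I) (P : pred I)
    (F : I -> V -> R) x :
  (forall j, P j -> differentiable (F j) x) ->
  differentiable (fun y => \prod_(j <- r | P j) F j y) x.
Proof.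
move=> H; elim: r => [|j r IH].
  under eq_fun do rewrite big_nil; exact: differentiable_cst.
under eq_fun do rewrite big_cons; case: (boolP (P j)) => // Pj.
exact: (differentiableM (H j Pj) IH).
Qed.

(** * Differentiability from continuous partial derivatives *)

Section Partial.
Context {n : nat} (D : set 'rV[R]_n) (f : 'rV[R]_n -> R) (g : 'I_n -> 'rV[R]_n -> R).
Hypotheses (oD : open D)
  (fg : forall j x, D x -> has_partial D f j x (g j x)).

Let grad_lin x (v : 'rV[R]_n) : R := \sum_j v 0 j * g j x.

Lemma grad_lin_linear x : linear (grad_lin x).
Proof.
move=> a u v; rewrite /grad_lin scaler_sumr -big_split; apply: eq_bigr => j _.
by rewrite !mxE mulrDl /= -mulrA.
Qed.

HB.instance Definition _ x := GRing.isLinear.Build R 'rV[R]_n R _ (grad_lin x) (grad_lin_linear x).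

Lemma continuous_grad_lin x : continuous (grad_lin x).
Proof.
move=> v; apply: differentiable_continuous; apply: differentiable_bigsum => j _.
exact: (differentiableM (differentiable_coord v 0 j) (differentiable_cst (g j x) v)).
Qed.

(** The increment from [x] to x + v is split into steps that change one coordinate each: [p k] keeps
    the first k coordinates of [v]. On each step [mvt_bound] compares [f] with the slope [g j x]. *)
Lemma partial_differentiable x : D x -> (forall j, {for x, continuous (g j)}) ->
  differentiable f x /\ forall v, 'D_v f x = \sum_j v 0 j * g j x.
Proof.
move=> Dx gc.
have [df dE] : differentiable f x /\ 'd f x = grad_lin x :> (_ -> _); last first.
  by split => // v; rewrite deriveE // dE.
apply: eps_differentiable; first exact: continuous_grad_lin.
move=> e e0.
(* The n steps have error at most e1 |v| each; dividing by n + 1 instead of n covers n = 0. *)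
have n0 : (0 : R) < n.+1%:R by rewrite ltr0n.
pose e1 := e / n.+1%:R; have e10 : 0 < e1 by rewrite divr_gt0.
have [d0 d00 HD] := open_ball_coord oD Dx.
have [d1 d10 Hg] : exists2 d, 0 < d & forall j, forall v, `|v| < d -> `|g j (x + v) - g j x| <= e1.
  apply: (ex_uniform (P := fun j d => forall v, `|v| < d -> `|g j (x + v) - g j x| <= e1)) => j.
  have [d dp H] := continuous_eps (gc j) e10; exists d => // d' dd' v vd'.
  by apply: H; exact: lt_le_trans dd'.
exists (Num.min d0 d1); first by rewrite lt_min d00 d10.
move=> v; rewrite lt_min => /andP[v0 v1].
pose p (k : nat) : 'rV[R]_n := \row_j (if (j < k)%N then v 0 j else 0).
have p0 : p 0%N = 0 by apply/rowP => j; rewrite !mxE.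
have pn : p n = v by apply/rowP => j; rewrite !mxE ltn_ord.
have pS (j : 'I_n) : p j.+1 = p j + v 0 j *: delta_mx 0 j.
  apply/rowP => k; rewrite !mxE /= ltnS leq_eqVlt -val_eqE /=.
  case: eqP => [/val_inj->|_] /=; first by rewrite ltnn add0r mulr1.
  by rewrite mulr0 addr0.
have pv (j : 'I_n) s : `|s| <= `|v 0 j| -> `|p j + s *: delta_mx 0 j| <= `|v|.
  move=> sv; apply: rV_norm_le => // k; rewrite !mxE /= -val_eqE /=.
  case: ltngtP => [kj|kj|/val_inj kj]; rewrite ?mulr0 ?addr0 ?normr0 ?mulr1 ?add0r //.
    exact: rV_norm_coord.
  exact: le_trans (rV_norm_coord v j).
have -> : f (x + v) - f x - grad_lin x v =
    \sum_(j < n) (f (x + p j.+1) - f (x + p j) - g j x * v 0 j).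
  rewrite sumrB; congr (_ - _); last by apply: eq_bigr => j _; rewrite mulrC.
  rewrite -(big_mkord xpredT (fun k => f (x + p k.+1) - f (x + p k))).
  by rewrite telescope_sumr // pn p0 addr0.
apply: le_trans (ler_norm_sum _ _ _) _.
apply: (@le_trans _ _ (\sum_(j < n) e1 * `|v|)); last first.
  rewrite sumr_const card_ord -mulr_natr mulrAC ler_wpM2r // /e1.
  by rewrite mulrAC ler_pdivrMr // ler_wpM2l ?(ltW e0) // ler_nat.
apply: ler_sum => j _; rewrite pS.
have := @mvt_bound (fun s => f (x + p j + s *: delta_mx 0 j))
  (fun s => g j (x + p j + s *: delta_mx 0 j)) (g j x) e1 0 (v 0 j).
rewrite !subr0 scale0r addr0 !addrA => H; apply: le_trans (H _) _; last first.
  by rewrite ler_wpM2l ?(ltW e10) // rV_norm_coord.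
move=> s; rewrite subr0 => sv; have pj := pv j s sv; rewrite -!addrA; split.
  apply: is_derive_line; rewrite -addrA; apply: has_partial_derive oD _ _; last first.
    apply: fg.
    by apply: HD; exact: le_lt_trans v0.
  by apply: HD; exact: le_lt_trans v0.
by apply: Hg; exact: le_lt_trans v1.
Qed.

End Partial.

(** Weaker than the names suggest: [C1_on] asks for differentiability only, and [C2_on] for
    differentiability of the function and of its directional derivatives. This is enough for second
    derivatives to commute. *)
Definition C1_on (V : normedModType R) (D : set V) (f : V -> R) :=
  forall x, D x -> differentiable f x.
Definition C2_on (V : normedModType R) (D : set V) (f : V -> R) :=
  C1_on D f /\ forall v, C1_on D ('D_v f).

Lemma Ck_continuous n k (D : set 'rV[R]_n) f x : open D -> D x -> Ck k D f ->
  {for x, continuous f}.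
Proof.
move=> oD Dx; case: k => [|k] [+ _]; rewrite continuous_open_subspace // => h;
by apply: h; rewrite inE.
Qed.

Lemma Ck_C1 n k (D : set 'rV[R]_n) f : open D -> Ck k.+1 D f -> C1_on D f.
Proof.
move=> oD [_ [g fg]] x Dx.
have [] := @partial_differentiable n D f g oD (fun j => (fg j).1) x Dx => //.
by move=> j; exact: Ck_continuous (fg j).2.
Qed.

Lemma open_near (V : normedModType R) (D : set V) x (P : V -> Prop) : open D -> D x ->
  (forall y, D y -> P y) -> \forall y \near x, P y.
Proof. by move=> oD Dx H; apply: filterS H _; exact: open_nbhs_nbhs. Qed.

Lemma near_differentiable (V : normedModType R) (f g : V -> R) x :
  (\forall y \near x, g y = f y) -> differentiable f x -> differentiable g x.
Proof.
move=> fg df; have gx : g x = f x by exact: nbhs_singleton fg.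
apply: (eps_differentiable (diff_continuous df) _).1 => e e0.
have [d d0 H] := differentiable_eps df e0.
have /nbhs_ballP[d1 /= d10 H1] := fg.
exists (Num.min d d1); first by rewrite lt_min d0 d10.
move=> v; rewrite lt_min => /andP[vd vd1]; rewrite gx H1; first exact: H.
by rewrite -ball_normE /= opprD addrA subrr sub0r normrN.
Qed.

Lemma Ck_C2 n k (D : set 'rV[R]_n) f : open D -> Ck k.+2 D f -> C2_on D f.
Proof.
move=> oD Cf; split; first exact: Ck_C1 Cf.
have [_ [g fg]] := Cf => v x Dx.
have gC j : Ck k.+1 D (g j) := (fg j).2.
apply: (near_differentiable (f := fun y => \sum_j v 0 j * g j y)).
  apply: (open_near oD Dx) => y Dy.
  have [] := @partial_differentiable n D f g oD (fun j => (fg j).1) y Dy => //.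
  by move=> j; exact: Ck_continuous (gC j).
apply: differentiable_bigsum => j _.
apply: (differentiableM (differentiable_cst (v 0 j) x)).
exact: Ck_C1 (gC j) _ Dx.
Qed.

Lemma smooth_C2 n (D : set 'rV[R]_n) f : open D -> smooth_on D f -> C2_on D f.
Proof. by move=> oD /(_ 2%N); exact: Ck_C2. Qed.

Lemma deriveDl (V : normedModType R) (f : V -> R) x u v : differentiable f x ->
  'D_(u + v) f x = 'D_u f x + 'D_v f x.
Proof. by move=> df; rewrite !deriveE // linearD. Qed.

Lemma deriveZl (V : normedModType R) (f : V -> R) x (a : R) u : differentiable f x ->
  'D_(a *: u) f x = a * 'D_u f x.
Proof. by move=> df; rewrite !deriveE // linearZ. Qed.

Lemma derive_row n (f : 'rV[R]_n -> R) x v : differentiable f x ->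
  'D_v f x = \sum_j v 0 j * 'D_(delta_mx 0 j) f x.
Proof.
move=> df; rewrite (lin_expand (f := fun v => 'D_v f x)) // => b c u w.
by rewrite deriveDl // !deriveZl.
Qed.

(** * Symmetry of second derivatives *)

Section Young.
Context {V : normedModType R} (D : set V) (f : V -> R) (x : V).
Hypotheses (oD : open D) (Dx : D x) (fC : C2_on D f).

Let second_diff (u w : V) (h : R) :=
  f (x + h *: u + h *: w) - f (x + h *: u) - f (x + h *: w) + f x.

(** [mvt_bound] is applied to s |-> f(x + h w + s u) - f(x + s u) on [0, h]. As ['D_u f] is
    differentiable at [x], the derivative of this function differs from h D_w D_u f(x) by at most e
    h. *)
Lemma second_diff_bound u w e : 0 < e -> exists2 d, 0 < d & forall h, 0 < h -> h < d ->
  `|second_diff u w h - h ^+ 2 * 'D_w ('D_u f) x| <= e * h ^+ 2.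
Proof.
move=> e0.
(* h M bounds the displacements s u + h w with |s| <= h; the added 1 keeps M positive when both
   vectors vanish. *)
pose M := `|u| + `|w| + 1.
have M0 : 0 < M by rewrite ltr_wpDl // addr_ge0.
have e10 : 0 < e / (2 * M) by rewrite divr_gt0 // mulr_gt0.
have dF : differentiable ('D_u f) x by exact: fC.2.
have [d1 d10 H1] := differentiable_eps dF e10.
have /nbhs_ballP[d2 /= d20 HD] : nbhs x D by exact: open_nbhs_nbhs.
have d0 : 0 < Num.min d1 d2 / M by rewrite divr_gt0 // lt_min d10 d20.
exists (Num.min d1 d2 / M) => // h h0; rewrite ltr_pdivlMr // lt_min => /andP[hd1 hd2].
have small s (b : bool) : `|s| <= h -> `|s *: u + h *: (if b then w else 0)| <= h * M.
  move=> sh; apply: le_trans (ler_normD _ _) _; rewrite !normrZ (gtr0_norm h0) /M.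
  have : `|s| * `|u| <= h * `|u| by rewrite ler_wpM2r.
  have : h * `|if b then w else 0| <= h * `|w|.
    by rewrite ler_wpM2l ?(ltW h0) //; case: b; rewrite // normr0.
  by nra.
have inD s (b : bool) : `|s| <= h -> D (x + (s *: u + h *: (if b then w else 0))).
  move=> sh; apply: HD; rewrite -ball_normE /= opprD addrA subrr sub0r normrN.
  exact: le_lt_trans (small s b sh) hd2.
(* The boolean tells whether h w is present; the two cases are subtracted at the end, each with half
   of the error. *)
have step s (b : bool) : `|s| <= h ->
   `|'D_u f (x + (s *: u + h *: (if b then w else 0))) - 'D_u f x
     - (s * 'D_u ('D_u f) x + h * (if b then 'D_w ('D_u f) x else 0))| <= e / 2 * h.
  move=> sh; have := H1 _ (le_lt_trans (small s b sh) hd1).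
  rewrite -deriveE // deriveDl // !deriveZl // => H.
  have -> : (if b then 'D_w ('D_u f) x else 0) = 'D_(if b then w else 0) ('D_u f) x.
    by case: b {H} => //; rewrite derive0.
  apply: le_trans H _; apply: le_trans (ler_wpM2l (ltW e10) (small s b sh)) _.
  by rewrite le_eqVlt; apply/orP; left; apply/eqP; field; rewrite gt_eqF.
pose phi s := f (x + h *: w + s *: u) - f (x + s *: u).
pose dphi s := 'D_u f (x + h *: w + s *: u) - 'D_u f (x + s *: u).
have := @mvt_bound phi dphi (h * 'D_w ('D_u f) x) (e * h) 0 h.
rewrite !subr0 (gtr0_norm h0) => H.
have -> : second_diff u w h - h ^+ 2 * 'D_w ('D_u f) x =
  phi h - phi 0 - h * 'D_w ('D_u f) x * h.
  rewrite /second_diff /phi scale0r !addr0 [x + h *: u + _]addrAC; ring.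
rewrite expr2 mulrA; apply: H => s; rewrite subr0 => sh.
have eT : x + h *: w + s *: u = x + (s *: u + h *: w) by rewrite -addrA [h *: w + _]addrC.
have eF : x + s *: u = x + (s *: u + h *: 0) by rewrite scaler0 addr0.
split.
  apply: is_deriveB; apply: is_derive_line.
    by rewrite eT; apply: derivableP; apply: diff_derivable; apply: fC.1; exact: (inD s true).
  by rewrite eF; apply: derivableP; apply: diff_derivable; apply: fC.1; exact: (inD s false).
have := step s true sh; have := step s false sh; rewrite /= -eT -eF /dphi mulr0 addr0.
set a := 'D_u f (x + h *: w + s *: u); set b := 'D_u f (x + s *: u).
set c := 'D_u f x; set k := s * _; set m := h * _ => A B.
have -> : a - b - m = (a - c - (k + m)) - (b - c - k) by ring.
apply: le_trans (ler_normB _ _) _; apply: le_trans (lerD B A) _.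
by rewrite -mulrDl -mulrDr -[X in X + X]mul1r; lra.
Qed.

(** The second difference is symmetric in [u] and [w], and divided by h^2 it approximates both
    iterated derivatives. *)
Lemma derive_sym u w : 'D_u ('D_w f) x = 'D_w ('D_u f) x.
Proof.
apply/eqP; rewrite -subr_eq0 -normr_le0; apply/ler_addgt0Pr => e e0; rewrite add0r.
have e20 : 0 < e / 2 by rewrite divr_gt0.
have [d1 d10 H1] := second_diff_bound u w e20.
have [d2 d20 H2] := second_diff_bound w u e20.
pose h := Num.min d1 d2 / 2.
have h0 : 0 < h by rewrite divr_gt0 // lt_min d10 d20.
have hm : h < Num.min d1 d2 by rewrite ltr_pdivrMr // ltr_pMr ?ltr1n // lt_min d10 d20.
move: hm; rewrite lt_min => /andP[h1 h2].
have := H1 h h0 h1; have := H2 h h0 h2.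
have -> : second_diff w u h = second_diff u w h.
  by rewrite /second_diff [x + h *: w + _]addrAC; ring.
set S := second_diff u w h; set a := 'D_u _ x; set b := 'D_w _ x => A B.
rewrite -(ler_pM2r (exprn_gt0 2 h0)).
have -> : `|a - b| * h ^+ 2 = `|(S - h ^+ 2 * b) - (S - h ^+ 2 * a)|.
  rewrite -[h ^+ 2 in LHS]ger0_norm ?exprn_ge0 ?(ltW h0) // -normrM; congr `|_|; ring.
apply: le_trans (ler_normB _ _) _; apply: le_trans (lerD B A) _.
by rewrite -mulrDl -splitr.
Qed.

End Young.
End Analysis.

(** * Exterior and Lie derivatives *)

Section ExtD.
Context {R : realType} {n : nat}.
Local Notation V := 'rV[R]_n.
Implicit Types (x w : V).

Definition dir k (a : V -> covector R R k n) w x : covector R R k n :=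
  fun v => 'D_w (fun y => a y v) x.

(* [extd] and [lied] are [ext_d] and [lie] in a single chart. *)
Definition extd k (a : V -> covector R R k n) x : covector R R k.+1 n := fun v =>
  \sum_(r < k.+1) (-1) ^+ r * 'D_(row r v) (fun y => a y (row' r v)) x.

Definition C1f k (a : V -> covector R R k n) x :=
  forall v, differentiable (fun y => a y v) x.

Definition ecov (j : 'I_n) : covector R R 1 n := fun u => u 0 j.

Lemma ecov_alt j : alternating (ecov j).
Proof.
split=> [r b c u v w h _ _|r s v rs]; last by case/eqP: rs; rewrite !ord1.
by have /rowP/(_ j) := h; rewrite !mxE ord1.
Qed.

Lemma extd_near k (a b : V -> covector R R k n) x v :
  (\forall y \near x, a y = b y) -> extd a x v = extd b x v.
Proof.
move=> ab; apply: eq_bigr => r _; congr (_ * _); apply: near_eq_derive.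
by apply: filterS ab => y ->.
Qed.

Lemma dir_alt k (a : V -> covector R R k n) w x :
  (\forall y \near x, alternating (a y)) -> C1f a x -> alternating (dir a w x).
Proof.
move=> ha da; split=> [r b c u v z h1 h2 h3|r s v rs h].
  rewrite /dir -[X in _ = X + _]deriveMl; last exact/diff_derivable/da.
  rewrite -[X in _ = _ + X]deriveMl; last exact/diff_derivable/da.
  rewrite -deriveD; try exact/diff_derivable/differentiableM.
  apply: near_eq_derive; apply: filterS ha => y ay.
  exact: ay.1 h1 h2 h3.
rewrite /dir -[RHS](derive_cst (0 : R) x w); apply: near_eq_derive.
by apply: filterS ha => y ay; exact: ay.2 rs h.
Qed.

(** This is d a = sum_j e^j /\ D_j a, from which the Leibniz rules follow by the algebra of wedge
    products. The weight 1 gives the shape that [cwedge_suml] expects. *)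
Lemma extd_basis k (a : V -> covector R R k n) x :
  (\forall y \near x, alternating (a y)) -> C1f a x ->
  extd a x = fun v => \sum_j 1 * cwedge (ecov j) (dir a (delta_mx 0 j) x) v.
Proof.
move=> ha da; apply: funext => v.
transitivity (\sum_j \sum_(r < k.+1) (-1) ^+ r * (v r j * dir a (delta_mx 0 j) x (row' r v))).
  rewrite exchange_big; apply: eq_bigr => r _ /=; rewrite -mulr_sumr; congr (_ * _).
  by rewrite derive_row //; apply: eq_bigr => j _; rewrite mxE.
apply: eq_bigr => j _; rewrite mul1r cwedge1; [|exact: ecov_alt|exact: dir_alt].
by apply: eq_bigr => r _; rewrite /ecov mxE.
Qed.

Lemma derive_bigsum (I : Type) (r : seq I) (P : pred I) (F : I -> V -> R) x w :
  (forall j, P j -> differentiable (F j) x) ->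
  'D_w (fun y => \sum_(j <- r | P j) F j y) x = \sum_(j <- r | P j) 'D_w (F j) x.
Proof.
move=> dF; elim: r => [|j r IH].
  under eq_fun do rewrite big_nil; rewrite big_nil; exact: derive_cst.
under eq_fun do rewrite big_cons; rewrite big_cons; case: (boolP (P j)) => // Pj.
rewrite -IH; apply: deriveD; apply: diff_derivable; first exact: dF.
exact: differentiable_bigsum.
Qed.

Lemma C1f_cwedge k l (a : V -> covector R R k n) (b : V -> covector R R l n) x :
  C1f a x -> C1f b x -> C1f (fun y => cwedge (a y) (b y)) x.
Proof.
move=> da db v; rewrite /cwedge; apply: differentiableM => //.
apply: differentiable_bigsum => s _; apply: differentiableM => //.
by apply: differentiableM.
Qed.

Lemma dir_cwedge k l (a : V -> covector R R k n) (b : V -> covector R R l n) w x :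
  C1f a x -> C1f b x ->
  dir (fun y => cwedge (a y) (b y)) w x =
  fun v => 1 * cwedge (dir a w x) (b x) v + 1 * cwedge (a x) (dir b w x) v.
Proof.
move=> da db; apply: funext => v; rewrite !mul1r /dir /cwedge.
have dm s : differentiable (fun y => a y (usubmx (row_perm s v)) * b y (dsubmx (row_perm s v))) x.
  exact: differentiableM.
rewrite deriveMl; last first.
  apply: diff_derivable; apply: differentiable_bigsum => s _.
  by apply: differentiableM.
rewrite -mulrDr; congr (_ * _); rewrite derive_bigsum; last first.
  by move=> s _; apply: differentiableM.
rewrite -big_split; apply: eq_bigr => s _ /=.
rewrite deriveMl; last exact: diff_derivable.
rewrite deriveM; try exact: diff_derivable.
by rewrite -mulrDr; congr (_ * _); rewrite /GRing.scale /= addrC [X in X + _]mulrC.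
Qed.

Section Leibniz.
Context {l : nat} (a : V -> covector R R 1 n) (b : V -> covector R R l n) (x : V).
Hypotheses (aa : \forall y \near x, alternating (a y))
  (ab : \forall y \near x, alternating (b y)) (da : C1f a x) (db : C1f b x).

Lemma near_cwedge_alt : \forall y \near x, alternating (cwedge (a y) (b y)).
Proof. by apply: filterS2 aa ab => y ? ?; exact: cwedge_alt. Qed.

(** The minus sign comes from moving e^j past the 1-form [a] in e^j /\ a /\ D_j b. *)
Lemma extd_cwedge1 v : extd (fun y => cwedge (a y) (b y)) x v =
  cwedge (extd a x) (b x) v - cwedge (a x) (extd b x) v.
Proof.
have ax := nbhs_singleton aa; have bx := nbhs_singleton ab.
rewrite extd_basis; [|exact: near_cwedge_alt|exact: C1f_cwedge].
rewrite (extd_basis aa da) (extd_basis ab db) cwedge_suml cwedge_sumr -sumrB.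
apply: eq_bigr => j _; rewrite !mul1r dir_cwedge // cwedge_linr !mul1r.
congr (_ + _).
  by apply: cwedge1A => //; [exact: ecov_alt|exact: dir_alt].
by apply: cwedge11C => //; [exact: ecov_alt|exact: dir_alt].
Qed.

End Leibniz.

Lemma extd_scale k (f : V -> R) (a : V -> covector R R k n) x v :
  (\forall y \near x, alternating (a y)) -> C1f a x -> differentiable f x ->
  extd (fun y v => f y * a y v) x v =
  cwedge (fun u : 'rV[R]_n => 'D_u f x) (a x) v + f x * extd a x v.
Proof.
move=> aa da df; rewrite cwedge1; last 2 first.
- split=> [r b c u w z h _ _|r s u rs]; last by case/eqP: rs; rewrite !ord1.
  by move: h; rewrite !row_id => ->; rewrite deriveDl // !deriveZl.
- exact: nbhs_singleton aa.
rewrite /extd mulr_sumr -big_split; apply: eq_bigr => r _ /=.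
rewrite deriveM; try exact: diff_derivable.
rewrite /GRing.scale /= mulrDr addrC [a x _ * _]mulrC; congr (_ + _).
exact: mulrCA.
Qed.

Lemma extd_lin k c d (a b : V -> covector R R k n) x v : C1f a x -> C1f b x ->
  extd (fun y v => c * a y v + d * b y v) x v = c * extd a x v + d * extd b x v.
Proof.
move=> da db; rewrite /extd !mulr_sumr -big_split; apply: eq_bigr => r _ /=.
rewrite deriveD; try exact/diff_derivable/differentiableM.
rewrite !deriveMl; try exact/diff_derivable.
by rewrite mulrDr !(mulrCA c) !(mulrCA d).
Qed.

(** Since 2-forms commute, the two Leibniz terms coincide. *)
Lemma extd_square (a : V -> covector R R 2 n) x v :
  (\forall y \near x, alternating (a y)) -> C1f a x ->
  extd (fun y => cwedge (a y) (a y)) x v = 2 * cwedge (extd a x) (a x) v.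
Proof.
move=> aa da; have ax := nbhs_singleton aa.
rewrite extd_basis; last 2 first.
- by apply: filterS aa => y ?; exact: cwedge_alt.
- exact: C1f_cwedge.
rewrite (extd_basis aa da) cwedge_suml mulr_sumr; apply: eq_bigr => j _.
rewrite !mul1r dir_cwedge // cwedge_linr !mul1r.
have -> : cwedge (a x) (dir a (delta_mx 0 j) x) = cwedge (dir a (delta_mx 0 j) x) (a x).
  by apply: funext => u; exact: cwedge22C.
rewrite (cwedge1A (ecov_alt j) (dir_alt _ aa da) ax); ring.
Qed.

(** Moving [w] from the top to row [s] passes [s] rows. On monomials the proof compares the
    expansions of the two determinants along the row [w]. *)
Lemma alt_move k (a : covector R R k.+1 n) (w : V) (v : 'M[R]_(k.+1, n)) s :
  alternating a ->
  a (col_mx w (row' s v)) =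
  (-1) ^+ s * a (\matrix_t (if t == s then w else row t v)).
Proof.
move=> ha; apply: (eps_ind (F := fun a => a (col_mx w (row' s v)))
  (G := fun a => (-1) ^+ s * a (\matrix_t (if t == s then w else row t v)))) ha => //.
  by move=> I c b; rewrite mulr_sumr; apply: eq_bigr => i _; rewrite mulrCA.
move=> K; rewrite /eps (expand_det_row _ ord0) (expand_det_row _ s) mulr_sumr.
apply: eq_bigr => j _; rewrite /cofactor.
rewrite [X in X * _ = _]mxE.
have -> : (col_mx w (row' s v) : 'M[R]_(1 + k, n)) ord0 (K j) = w 0 (K j).
  by have /rowP/(_ (K j)) := row_col_mx0 w (row' s v); rewrite mxE.
have -> : (colsub K (\matrix_t (if t == s then w else row t v))) s j = w 0 (K j).
  by rewrite !mxE eqxx.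
rewrite add0n exprD !mulrA [(-1) ^+ s * _]mulrC -!mulrA; congr (_ * _).
rewrite !mulrA -exprD addnn -mul2n exprM sqrrN expr1n expr1n mul1r; congr (_ * _).
congr (\det _); apply/matrixP => p q; rewrite [LHS]mxE [LHS]mxE [LHS]mxE.
rewrite [RHS]mxE [RHS]mxE [RHS]mxE [RHS]mxE.
have -> : (col_mx w (row' s v) : 'M[R]_(1 + k, n)) (lift ord0 p) (K (lift j q)) = v (lift s p) (K (lift j q)).
  by have /rowP/(_ (K (lift j q))) := row_col_mxS w (row' s v) p; rewrite !mxE.
by rewrite eq_sym (negbTE (neq_lift _ _)) !mxE.
Qed.

Lemma row'0_col_mx k (w : V) (v : 'M[R]_(k, n)) :
  row' ord0 (col_mx w v : 'M[R]_(1 + k, n)) = v.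
Proof.
apply/row_matrixP => t; rewrite -[RHS](row_col_mxS w).
by apply/rowP => j; rewrite !mxE.
Qed.

Lemma row'S_col_mx k (w : V) (v : 'M[R]_(k.+1, n)) s :
  row' (lift ord0 s) (col_mx w v : 'M[R]_(1 + k.+1, n)) = col_mx w (row' s v).
Proof.
apply/row_matrixP => t; case: (unliftP ord0 t) => [t' ->|->].
  rewrite (row_col_mxS w).
  have -> : row (lift ord0 t') (row' (lift ord0 s) (col_mx w v : 'M[R]_(1 + k.+1, n))) =
     row (lift ord0 (lift s t')) (col_mx w v : 'M[R]_(1 + k.+1, n)).
    apply/rowP => j; rewrite [LHS]mxE [LHS]mxE [RHS]mxE; congr (col_mx w v _ j).
    by apply/val_inj; rewrite /= /bump /=; lia.
  by rewrite (row_col_mxS w); apply/rowP => j; rewrite !mxE.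
rewrite (row_col_mx0 w) -[RHS](row_col_mx0 w v).
apply/rowP => j; rewrite [LHS]mxE [LHS]mxE [RHS]mxE; congr (col_mx w v _ j).
exact/val_inj.
Qed.

Definition lied k (Y : V -> V) (a : V -> covector R R k n) x : covector R R k n := fun v =>
  'D_(Y x) (fun y => a y v) x +
  \sum_(r < k) a x (\matrix_(s < k) if s == r then 'D_(row r v) Y x else row s v).

(** * Cartan's formula *)

Section Cartan.
Context {k : nat} (Y : V -> V) (a : V -> covector R R k.+1 n) (x : V).
Hypotheses (aa : \forall y \near x, alternating (a y)) (da : C1f a x)
  (dY : forall j, differentiable (fun y => Y y 0 j) x).

Lemma derivable_field w : derivable Y x w.
Proof. by apply/derivable_mxP => i j; rewrite ord1; apply: diff_derivable. Qed.

Lemma contract_near v : \forall y \near x,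
  contract (Y y) (a y) v = \sum_j Y y 0 j * a y (col_mx (delta_mx 0 j : V) v).
Proof.
apply: filterS aa => y ay; rewrite /contract.
rewrite (lin_expand (f := fun u => a y (col_mx u v))) // => *.
exact: alt_row0_lin.
Qed.

Lemma C1f_contract : C1f (fun y => contract (Y y) (a y)) x.
Proof.
move=> v; apply: near_differentiable (contract_near v) _.
by apply: differentiable_bigsum => j _; apply: differentiableM.
Qed.

Lemma derive_contract w v : 'D_w (fun y => contract (Y y) (a y) v) x =
  'D_w (fun y => a y (col_mx (Y x) v)) x + a x (col_mx ('D_w Y x) v).
Proof.
rewrite (near_eq_derive _ (contract_near v)) derive_bigsum; last first.
  by move=> j _; apply: differentiableM.
have ax := nbhs_singleton aa.
rewrite (lin_expand (f := fun u => a x (col_mx u v))); last first.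
  by move=> *; exact: alt_row0_lin.
have -> : 'D_w (fun y => a y (col_mx (Y x) v)) x =
    \sum_j Y x 0 j * 'D_w (fun y => a y (col_mx (delta_mx 0 j : V) v)) x.
  rewrite (lin_expand (f := fun u => 'D_w (fun y => a y (col_mx u v)) x)) // => b c u z.
  exact: (alt_row0_lin (dir_alt w aa da)).
rewrite -big_split; apply: eq_bigr => j _ /=.
rewrite deriveM; try exact: diff_derivable.
rewrite derive_mx ?mxE; last exact: derivable_field.
by rewrite /GRing.scale /= [X in _ + X]mulrC.
Qed.

(** Differentiating the contraction gives terms in which [a] is differentiated and terms in which
    [Y] is. By [alt_move] the latter are the sum in the Lie derivative. The former cancel against
    the contraction of [d a], except for its first term, the derivative of [a] along [Y]. *)
Lemma cartan v : extd (fun y => contract (Y y) (a y)) x v =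
  lied Y a x v - contract (Y x) (extd a x) v.
Proof.
have ax := nbhs_singleton aa.
rewrite /lied /contract /extd [X in _ = _ - X]big_ord_recl /= expr0 mul1r (row_col_mx0 (Y x) v).
rewrite (row'0_col_mx (Y x) v).
under eq_bigr do rewrite derive_contract mulrDr (alt_move _ _ _ ax) mulrA -exprD addnn -mul2n exprM sqrrN expr1n expr1n mul1r.
rewrite big_split /=; set S := (X in X + _ = _); set T := (X in _ = _ - (_ + X)).
have -> : T = - S.
  rewrite /T /S -sumrN; apply: eq_bigr => r _.
  rewrite (row_col_mxS (Y x) v) (row'S_col_mx (Y x) v).
  by rewrite /bump /= exprS mulN1r mulNr.
ring.
Qed.

End Cartan.
End ExtD.

(** * Closedness of a holomorphic volume form *)

Section Pullback.
Context {R : realType}.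

Lemma derive_lsub (b : 'rV[R]_6 -> R) (w x : 'rV[R]_(6 + 1)) :
  'D_w (fun y : 'rV[R]_(6 + 1) => b (lsubmx y)) x = 'D_(lsubmx w) b (lsubmx x).
Proof.
rewrite /derive.
have -> // : (fun h : R => h^-1 *: (((fun y : 'rV[R]_(6 + 1) => b (lsubmx y)) \o shift x) (h *: w) - b (lsubmx x)))
  = (fun h : R => h^-1 *: ((b \o shift (lsubmx x)) (h *: lsubmx w) - b (lsubmx x))).
apply: funext => h /=.
have -> // : lsubmx (h *: w + x) = h *: lsubmx w + lsubmx x.
by apply/rowP => j; rewrite !mxE.
Qed.

Lemma differentiable_lsub (b : 'rV[R]_6 -> R) (x : 'rV[R]_(6 + 1)) :
  differentiable b (lsubmx x) -> differentiable (fun y : 'rV[R]_(6 + 1) => b (lsubmx y)) x.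
Proof. by move=> db; apply: (differentiable_comp (differentiable_lsubmx x) db). Qed.

Lemma extd_p1 k (b : 'rV[R]_6 -> covector R R k 6) (x : 'rV[R]_(6 + 1)) :
  extd (fun y => p1 (b (lsubmx y))) x = p1 (extd b (lsubmx x)).
Proof.
apply: funext => v; apply: eq_bigr => r _; congr (_ * _).
rewrite /p1 (derive_lsub (fun y => b y (lsubmx (row' r v)))) row_lsubmx.
have -> // : lsubmx (row' r v) = row' r (lsubmx v).
by apply/matrixP => i j; rewrite !mxE.
Qed.

Lemma C1f_p1 k (b : 'rV[R]_6 -> covector R R k 6) (x : 'rV[R]_(6 + 1)) :
  C1f b (lsubmx x) -> C1f (fun y => p1 (b (lsubmx y))) x.
Proof. by move=> db v; exact: (differentiable_lsub (b := fun y => b y (lsubmx v))). Qed.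

End Pullback.

Section Holomorphic.
Context {R : realType}.
Local Open Scope complex_scope.
Notation Re := complex.Re.
Notation Im := complex.Im.
Notation V6 := 'rV[R]_6.

Definition is_cderive (F : V6 -> R[i]) (w x : V6) (l : R[i]) :=
  is_derive x w (fun y => Re (F y)) (Re l) /\ is_derive x w (fun y => Im (F y)) (Im l).

Lemma is_cderive_eq F w x l l' : is_cderive F w x l -> l = l' -> is_cderive F w x l'.
Proof. by move=> h <-. Qed.

Lemma is_cderiveD F G w x l m : is_cderive F w x l -> is_cderive G w x m ->
  is_cderive (fun y => F y + G y) w x (l + m).
Proof.
move=> [h1 h2] [h3 h4]; split.
  rewrite cReD; under eq_fun do rewrite cReD; exact: is_deriveD.
rewrite cImD; under eq_fun do rewrite cImD; exact: is_deriveD.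
Qed.

Lemma is_cderiveN F w x l : is_cderive F w x l -> is_cderive (fun y => - F y) w x (- l).
Proof.
move=> [h1 h2]; split.
  rewrite cReN; under eq_fun do rewrite cReN; exact: is_deriveN.
rewrite cImN; under eq_fun do rewrite cImN; exact: is_deriveN.
Qed.

Lemma is_cderiveM F G w x l m : is_cderive F w x l -> is_cderive G w x m ->
  is_cderive (fun y => F y * G y) w x (l * G x + F x * m).
Proof.
move=> [h1 h2] [h3 h4]; split.
  under eq_fun do rewrite cReM.
  apply: (is_derive_eq (is_deriveB (is_deriveM h1 h3) (is_deriveM h2 h4))).
  by rewrite cReD !cReM /GRing.scale /=; ring.
under eq_fun do rewrite cImM.
apply: (is_derive_eq (is_deriveD (is_deriveM h1 h4) (is_deriveM h2 h3))).
by rewrite cImD !cImM /GRing.scale /=; ring.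
Qed.

(* The derivative of the determinant at [P] in the direction [Q]. *)
Definition ddet3 (P Q : 'M[R[i]]_3) : R[i] :=
  Q 0 0 * (P 1 1 * P 2 2 - P 1 2 * P 2 1)
  + P 0 0 * (Q 1 1 * P 2 2 + P 1 1 * Q 2 2 - (Q 1 2 * P 2 1 + P 1 2 * Q 2 1))
  - (Q 0 1 * (P 1 0 * P 2 2 - P 1 2 * P 2 0)
  + P 0 1 * (Q 1 0 * P 2 2 + P 1 0 * Q 2 2 - (Q 1 2 * P 2 0 + P 1 2 * Q 2 0)))
  + (Q 0 2 * (P 1 0 * P 2 1 - P 1 1 * P 2 0)
  + P 0 2 * (Q 1 0 * P 2 1 + P 1 0 * Q 2 1 - (Q 1 1 * P 2 0 + P 1 1 * Q 2 0))).

(** This is d(dz_j) = 0 inside the product: each second derivative occurs once for each order of its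
    two directions, with opposite signs. *)
Lemma ddet3_alt (P : 'I_4 -> 'I_3 -> R[i]) (S : 'I_4 -> 'I_4 -> 'I_3 -> R[i]) :
  (forall r t j, S r t j = S t r j) ->
  \sum_(r < 4) (-1) ^+ r *
    ddet3 (\matrix_(s, j) P (lift r s) j) (\matrix_(s, j) S r (lift r s) j) = 0.
Proof.
move=> Ssym; rewrite !big_ord_recl big_ord0 /ddet3 !mxE.
have e1 : lift ord0 (ord0 : 'I_3) = 1 :> 'I_4 by exact/val_inj.
have e2 : lift ord0 (lift ord0 (ord0 : 'I_2)) = 2 :> 'I_4 by exact/val_inj.
have e3 : lift ord0 (lift ord0 (lift ord0 (ord0 : 'I_1))) = 3 :> 'I_4 by exact/val_inj.
have l00 : lift ord0 (0 : 'I_3) = 1 :> 'I_4 by exact/val_inj.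
have l01 : lift ord0 (1 : 'I_3) = 2 :> 'I_4 by exact/val_inj.
have l02 : lift ord0 (2 : 'I_3) = 3 :> 'I_4 by exact/val_inj.
have l10 : lift 1 (0 : 'I_3) = 0 :> 'I_4 by exact/val_inj.
have l11 : lift 1 (1 : 'I_3) = 2 :> 'I_4 by exact/val_inj.
have l12 : lift 1 (2 : 'I_3) = 3 :> 'I_4 by exact/val_inj.
have l20 : lift 2 (0 : 'I_3) = 0 :> 'I_4 by exact/val_inj.
have l21 : lift 2 (1 : 'I_3) = 1 :> 'I_4 by exact/val_inj.
have l22 : lift 2 (2 : 'I_3) = 3 :> 'I_4 by exact/val_inj.
have l30 : lift 3 (0 : 'I_3) = 0 :> 'I_4 by exact/val_inj.
have l31 : lift 3 (1 : 'I_3) = 1 :> 'I_4 by exact/val_inj.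
have l32 : lift 3 (2 : 'I_3) = 2 :> 'I_4 by exact/val_inj.
rewrite !(e1, e2, e3) !(l00, l01, l02, l10, l11, l12, l20, l21, l22, l30, l31, l32).
rewrite -[ord0]/(0 : 'I_4).
rewrite !(Ssym 1 0) !(Ssym 2 0) !(Ssym 3 0) !(Ssym 2 1) !(Ssym 3 1) !(Ssym 3 2).
have s2 : (-1) ^+ nat_of_ord (2%R : 'I_4) = 1 :> R[i] by rewrite sqrrN expr1n.
have s3 : (-1) ^+ nat_of_ord (3%R : 'I_4) = -1 :> R[i] by rewrite exprS sqrrN expr1n mulr1.
rewrite s2 s3 expr0 expr1; ring.
Qed.

Lemma is_cderive_det3 (h : V6 -> R[i]) (p : V6 -> 'M[R[i]]_3) w x hw (q : 'M[R[i]]_3) :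
  is_cderive h w x hw -> (forall s j, is_cderive (fun y => p y s j) w x (q s j)) ->
  is_cderive (fun y => h y * \det (p y)) w x (hw * \det (p x) + h x * ddet3 (p x) q).
Proof.
move=> hh hp; under eq_fun do rewrite det3E.
apply: is_cderive_eq.
  apply: is_cderiveM hh _.
  apply: is_cderiveD; first apply: is_cderiveD; last first.
  - by apply: is_cderiveM => //; apply: is_cderiveD; [apply: is_cderiveM|apply: is_cderiveN; apply: is_cderiveM].
  - by apply: is_cderiveN; apply: is_cderiveM => //; apply: is_cderiveD; [apply: is_cderiveM|apply: is_cderiveN; apply: is_cderiveM].
  - by apply: is_cderiveM => //; apply: is_cderiveD; [apply: is_cderiveM|apply: is_cderiveN; apply: is_cderiveM].
by rewrite /ddet3 det3E.
Qed.

Context (D : set V6) (z : 'I_3 -> V6 -> R[i]) (h : V6 -> R[i])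
  (U : V6 -> covector R R[i] 3 6) (x : V6).
Hypotheses (oD : open D) (Dx : D x)
  (zre : forall j, C2_on D (fun y => Re (z j y)))
  (zim : forall j, C2_on D (fun y => Im (z j y)))
  (hre : C1_on D (fun y => Re (h y))) (him : C1_on D (fun y => Im (h y)))
  (UE : forall y, D y -> forall v, U y v =
     h y * cwedge (cwedge (cdiff (z 0) y) (cdiff (z 1) y)) (cdiff (z 2) y) v).

Definition second j (u w : V6) : R[i] :=
  'D_u ('D_w (fun y => Re (z j y))) x +i* 'D_u ('D_w (fun y => Im (z j y))) x.

Lemma second_sym j u w : second j u w = second j w u.
Proof.
exact: (f_equal2 (@Complex R) (derive_sym oD Dx (zre j) u w) (derive_sym oD Dx (zim j) u w)).
Qed.

Lemma is_cderive_volume u v : is_cderive (fun y => U y v) u x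
  (cdiff h x u * \det (\matrix_(s, j) cdiff (z j) x (row s v)) +
   h x * ddet3 (\matrix_(s, j) cdiff (z j) x (row s v))
     (\matrix_(s, j) second j u (row s v))).
Proof.
pose p y := \matrix_(s, j) cdiff (z j) y (row s v).
have := @is_cderive_det3 h p u x (cdiff h x u) (\matrix_(s, j) second j u (row s v)).
move=> [|s j|].
- by split; apply: derivableP; apply: diff_derivable; [exact: hre|exact: him].
- have -> : (fun y => p y s j) = (fun y => cdiff (z j) y (row s v)).
    by apply: funext => y; rewrite mxE.
  rewrite mxE; split; apply: derivableP; apply: diff_derivable.
    exact: (zre j).2.
  exact: (zim j).2.
move=> h1 h2; split.
  apply: near_eq_is_derive h1; apply: (open_near oD Dx) => y Dy.
  by rewrite UE // (cwedge_111 (fun j => cdiff (z j) y)).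
apply: near_eq_is_derive h2; apply: (open_near oD Dx) => y Dy.
by rewrite UE // (cwedge_111 (fun j => cdiff (z j) y)).
Qed.

(** The complex value of dU, with the product rule already applied to U = h det(dz_j). *)
Definition cextd (v : 'M[R]_(4, 6)) : R[i] := \sum_(r < 4) (-1) ^+ r *
  (cdiff h x (row r v) * \det (\matrix_(s, j) cdiff (z j) x (row s (row' r v))) +
   h x * ddet3 (\matrix_(s, j) cdiff (z j) x (row s (row' r v)))
     (\matrix_(s, j) second j (row r v) (row s (row' r v)))).

Lemma extd_volume v :
  extd (fun y u => Re (U y u)) x v = Re (cextd v) /\
  extd (fun y u => Im (U y u)) x v = Im (cextd v).
Proof.
have sg (r : nat) : (-1) ^+ r = ((-1) ^+ r : R)%:C by rewrite rmorphXn rmorphN1.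
rewrite /cextd cRe_sum cIm_sum; split; apply: eq_bigr => r _; rewrite sg ?cReM ?cImM /= mul0r ?subr0 ?addr0.
  by congr (_ * _); have [[]] := is_cderive_volume (row r v) (row' r v).
by congr (_ * _); have [_ []] := is_cderive_volume (row r v) (row' r v).
Qed.

Lemma ddet3_cancel (v : 'M[R]_(4, 6)) : \sum_(r < 4) (-1) ^+ r *
   (h x * ddet3 (\matrix_(s, j) cdiff (z j) x (row s (row' r v)))
     (\matrix_(s, j) second j (row r v) (row s (row' r v)))) = 0.
Proof.
have rr (r : 'I_4) (s : 'I_3) : row s (row' r v) = row (lift r s) v.
  by apply/rowP => j; rewrite !mxE.
pose P t j := cdiff (z j) x (row t v).
pose S r t j := second j (row r v) (row t v).
transitivity (h x * \sum_(r < 4) (-1) ^+ r *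
    ddet3 (\matrix_(s, j) P (lift r s) j) (\matrix_(s, j) S r (lift r s) j)); last first.
  by rewrite (@ddet3_alt P S (fun r t j => second_sym j (row r v) (row t v))) mulr0.
have EP (r : 'I_4) : \matrix_(s, j) cdiff (z j) x (row s (row' r v)) =
    \matrix_(s, j) P (lift r s) j.
  apply/matrixP => s j; rewrite [LHS]mxE [RHS]mxE.
  exact: (congr1 (fun w => cdiff (z j) x w) (rr r s)).
have ES (r : 'I_4) : \matrix_(s, j) second j (row r v) (row s (row' r v)) =
    \matrix_(s, j) S r (lift r s) j.
  apply/matrixP => s j; rewrite [LHS]mxE [RHS]mxE.
  exact: (congr1 (fun w => second j (row r v) w) (rr r s)).
clearbody P S; rewrite mulr_sumr; apply: eq_bigr => r _.
by rewrite (EP r) (ES r) mulrCA.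
Qed.

(** The matrix factors through the three complex coordinates [zeta], so its rank is at most 3. *)
Lemma ctype_dependent m (al : 'I_m -> covector R R[i] 1 6) (v : 'M[R]_(m, 6)) (P : 'M[R]_6)
    (u : 'I_3 -> V6) (zeta : V6 -> 'I_3 -> R[i]) : (3 < m)%N -> P \in unitmx ->
  (forall j w, al j (w *m P) = \sum_a zeta w a * al j (u a)) ->
  \det (\matrix_(r, j) al j (row r v)) = 0.
Proof.
move=> m3 Pu H.
have -> : \matrix_(r, j) al j (row r v) =
    (\matrix_(r, a) zeta (row r v *m invmx P) a) *m (\matrix_(a, j) al j (u a)).
  apply/matrixP => r j; rewrite !mxE -{1}[row r v](mulmxKV Pu) H.
  by apply: eq_bigr => a _; rewrite !mxE.
apply/eqP; rewrite -[_ == 0]negbK -unitfE -unitmxE -row_free_unit /row_free.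
rewrite neq_ltn (leq_ltn_trans (mulmx_max_rank _ _)) //.
Qed.

(** The terms with second derivatives cancel. What remains is the expansion along the first column
    of the 4 x 4 determinant of dh, dz_0, dz_1, dz_2, four complex-linear covectors on a complex
    3-dimensional space. *)
Lemma cextd_closed v (P : 'M[R]_6) (u : 'I_3 -> V6) (zeta : V6 -> 'I_3 -> R[i]) :
  P \in unitmx ->
  (forall w, cdiff h x (w *m P) = \sum_a zeta w a * cdiff h x (u a)) ->
  (forall j w, cdiff (z j) x (w *m P) = \sum_a zeta w a * cdiff (z j) x (u a)) ->
  cextd v = 0.
Proof.
move=> Pu hP zP; rewrite /cextd.
under eq_bigr do rewrite mulrDr.
rewrite big_split /= ddet3_cancel addr0.
pose al (j : 'I_4) := if unlift ord0 j is Some j' then cdiff (z j') x else cdiff h x.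
have := @ctype_dependent 4 al v P u zeta isT Pu.
have H j w : al j (w *m P) = \sum_a zeta w a * al j (u a).
  by rewrite /al; case: unliftP.
move=> /(_ H) E; rewrite -[RHS]E (expand_det_col _ ord0); apply: eq_bigr => r _.
rewrite mxE /cofactor /al unlift_none addn0 mulrCA; congr (_ * (_ * _)).
by congr (\det _); apply/matrixP => s j; rewrite !mxE liftK; congr cdiff; apply/rowP => t; rewrite !mxE.
Qed.

End Holomorphic.

(** * Derivatives in space and time *)

Section Calculus.
Context {R : realType} {V : normedModType R}.
Implicit Types (f g : V -> R) (D : set V).

Lemma chain_rule f (u : R -> R) x l : differentiable f x -> is_derive (f x) 1 u l ->
  differentiable (fun y => u (f y)) x /\
  forall v, 'D_v (fun y => u (f y)) x = l * 'D_v f x.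
Proof.
move=> df [du ul]; have du' : differentiable u (f x) by exact/derivable1_diffP.
have dc : differentiable (fun y => u (f y)) x := differentiable_comp df du'.
split=> // v; rewrite !deriveE //.
rewrite (diff_comp df du') /=.
have ul' : 'd u (f x) (1 : R) = l by rewrite -deriveE.
rewrite -[X in 'd u (f x) X]mulr1 -[_ * 1]/(_ *: (1 : R)) linearZ /= ul'.
by rewrite /GRing.scale /= mulrC.
Qed.

Lemma C2_near D f g : open D -> (forall x, D x -> f x = g x) -> C2_on D g -> C2_on D f.
Proof.
move=> oD fg [g1 g2]; split=> [x Dx|v x Dx].
  by apply: near_differentiable (g1 x Dx); exact: (open_near oD Dx).
apply: near_differentiable (g2 v x Dx); apply: (open_near oD Dx) => y Dy.
by apply: near_eq_derive; exact: (open_near oD Dy).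
Qed.

Lemma C2_cst D (c : R) : C2_on D (fun _ => c).
Proof.
split=> [x _|v x _]; first exact: differentiable_cst.
have -> : 'D_v (fun _ : V => c) = fun _ => 0.
  by apply: funext => y; exact: derive_cst.
exact: differentiable_cst.
Qed.

Lemma C2_mul D f g : open D -> C2_on D f -> C2_on D g -> C2_on D (fun x => f x * g x).
Proof.
move=> oD [f1 f2] [g1 g2]; split=> [x Dx|v x Dx].
  by apply: differentiableM; [exact: f1|exact: g1].
apply: (near_differentiable (f := fun y => f y * 'D_v g y + g y * 'D_v f y)).
  apply: (open_near oD Dx) => y Dy.
  by rewrite deriveM //; apply: diff_derivable; [exact: f1|exact: g1].
apply: differentiableD; apply: differentiableM.
- exact: f1.
- exact: g2.
- exact: g1.
- exact: f2.
Qed.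

Lemma C2_add D f g : open D -> C2_on D f -> C2_on D g -> C2_on D (fun x => f x + g x).
Proof.
move=> oD [f1 f2] [g1 g2]; split=> [x Dx|v x Dx].
  by apply: differentiableD; [exact: f1|exact: g1].
apply: (near_differentiable (f := fun y => 'D_v f y + 'D_v g y)).
  apply: (open_near oD Dx) => y Dy.
  by rewrite deriveD //; apply: diff_derivable; [exact: f1|exact: g1].
by apply: differentiableD; [exact: f2|exact: g2].
Qed.

Lemma C2_sum D (I : Type) (r : seq I) (F : I -> V -> R) : open D ->
  (forall j, C2_on D (F j)) -> C2_on D (fun x => \sum_(j <- r) F j x).
Proof.
move=> oD H; elim: r => [|j r IH].
  under eq_fun do rewrite big_nil; exact: C2_cst.
under eq_fun do rewrite big_cons; exact: C2_add.
Qed.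

Lemma C2_inv D f : open D -> C2_on D f -> (forall x, D x -> f x != 0) ->
  C2_on D (fun x => (f x)^-1).
Proof.
move=> oD [f1 f2] f0; split=> [x Dx|v x Dx].
  by apply: differentiableV; [exact: f1|exact: f0].
apply: (near_differentiable (f := fun y => (- 1) * ((f y)^-1 * ((f y)^-1 * 'D_v f y)))).
  apply: (open_near oD Dx) => y Dy.
  rewrite deriveV ?f0 //; last by apply: diff_derivable; exact: f1.
  by rewrite /GRing.scale /= expr2 invfM; ring.
have dV : differentiable (fun y => (f y)^-1) x.
  by apply: differentiableV; [exact: f1|exact: f0].
apply: differentiableM; first exact: differentiable_cst.
by do 2!apply: differentiableM => //; exact: f2.
Qed.

Lemma C2_ln D f : open D -> C2_on D f -> (forall x, D x -> 0 < f x) ->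
  C2_on D (fun x => ln (f x)).
Proof.
move=> oD [f1 f2] f0; have H x : D x -> _ := fun Dx => chain_rule (f1 x Dx) (is_derive1_ln (f0 x Dx)).
split=> [x Dx|v x Dx]; first exact: (H x Dx).1.
apply: (near_differentiable (f := fun y => (f y)^-1 * 'D_v f y)).
  by apply: (open_near oD Dx) => y Dy; exact: (H y Dy).2.
apply: differentiableM; last exact: f2.
by apply: differentiableV; [exact: f1|rewrite gt_eqF // f0].
Qed.

Definition C2f D k n (a : V -> covector R R k n) := forall v, C2_on D (fun x => a x v).

Lemma C2_cwedge D k l n (a : V -> covector R R k n) (b : V -> covector R R l n) :
  open D -> C2f D a -> C2f D b -> C2f D (fun x => cwedge (a x) (b x)).
Proof.
move=> oD ha hb v; rewrite /cwedge; apply: C2_mul => //; first exact: C2_cst.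
apply: C2_sum => // s; apply: C2_mul => //; first exact: C2_cst.
exact: C2_mul.
Qed.

Lemma differentiable_det n (A : V -> 'M[R]_n) x :
  (forall i j, differentiable (fun y => A y i j) x) ->
  differentiable (fun y => \det (A y)) x.
Proof.
move=> dA; apply: differentiable_bigsum => s _; apply: differentiableM => //.
exact: differentiable_bigprod.
Qed.

Lemma differentiable_invmx n (A : V -> 'M[R]_n) x :
  (forall i j, differentiable (fun y => A y i j) x) ->
  (\forall y \near x, A y \in unitmx) ->
  forall i j, differentiable (fun y => invmx (A y) i j) x.
Proof.
move=> dA Au i j.
have A0 : \det (A x) != 0.
  by have := nbhs_singleton Au; rewrite unitmxE unitfE.
apply: (near_differentiable (f := fun y => (\det (A y))^-1 * cofactor (A y) j i)).
  by apply: filterS Au => y yu; rewrite /invmx yu !mxE.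
apply: differentiableM.
  by apply: differentiableV => //; exact: differentiable_det.
apply: differentiableM => //; apply: differentiable_det => p q.
by under eq_fun do rewrite !mxE.
Qed.

End Calculus.

(** * Time derivatives on an interval that may contain its end points *)

Section TimeDerivative.
Context {R : realType} (T : set R) (t : R).
Implicit Types f g : R -> R.
Let F := within [set h : R | T (t + h)] (0 : R)^'.

Lemma tfilter_id : (fun h : R => h) @ F --> (0 : R).
Proof. by apply: cvg_within_filter; exact: nbhs_dnbhs. Qed.

Lemma tfilter_neq0 : \forall h \near F, h != 0.
Proof. by apply: filterS (nbhs_dnbhs_neq 0) => h h0 _. Qed.

Lemma has_tderiv_cvg f l : has_tderiv T f t l -> f (t + h) @[h --> F] --> f t.
Proof.
move=> df.
have H : h * (h^-1 * (f (t + h) - f t)) + f t @[h --> F] --> 0 * l + f t.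
  by apply: cvgD; [apply: cvgM; [exact: tfilter_id|exact: df]|exact: cvg_cst].
rewrite mul0r add0r in H; apply: cvg_trans H; apply: near_eq_cvg.
by apply: filterS tfilter_neq0 => h h0; rewrite mulVKf // subrK.
Qed.

Lemma has_tderivM f g l m : has_tderiv T f t l -> has_tderiv T g t m ->
  has_tderiv T (fun s => f s * g s) t (l * g t + f t * m).
Proof.
move=> df dg; rewrite /has_tderiv -/F.
have H : (h^-1 * (f (t + h) - f t)) * g (t + h) + f t * (h^-1 * (g (t + h) - g t))
    @[h --> F] --> l * g t + f t * m.
  apply: cvgD; last by apply: cvgM; [exact: cvg_cst|exact: dg].
  by apply: cvgM; [exact: df|exact: has_tderiv_cvg dg].
apply: cvg_trans H; apply: near_eq_cvg; apply: filterE => h; ring.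
Qed.

Lemma has_tderivD f g l m : has_tderiv T f t l -> has_tderiv T g t m ->
  has_tderiv T (fun s => f s + g s) t (l + m).
Proof.
move=> df dg; rewrite /has_tderiv -/F.
have H : (h^-1 * (f (t + h) - f t)) + (h^-1 * (g (t + h) - g t)) @[h --> F] --> l + m.
  by apply: cvgD; [exact: df|exact: dg].
apply: cvg_trans H; apply: near_eq_cvg; apply: filterE => h; ring.
Qed.

Lemma has_tderiv_cst c : has_tderiv T (fun=> c) t 0.
Proof.
rewrite /has_tderiv; under eq_fun do rewrite subrr mulr0; exact: cvg_cst.
Qed.

Lemma has_tderivZ c f l : has_tderiv T f t l -> has_tderiv T (fun s => c * f s) t (c * l).
Proof.
move=> df; have := has_tderivM (has_tderiv_cst c) df.
by rewrite mul0r add0r.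
Qed.

Lemma has_tderiv_sum (I : Type) (r : seq I) (f : I -> R -> R) (l : I -> R) :
  (forall j, has_tderiv T (f j) t (l j)) ->
  has_tderiv T (fun s => \sum_(j <- r) f j s) t (\sum_(j <- r) l j).
Proof.
move=> H; elim: r => [|j r IH].
  by rewrite big_nil; under eq_fun do rewrite big_nil; exact: has_tderiv_cst.
rewrite big_cons.
have -> : (fun s => \sum_(k <- j :: r) f k s) = fun s => f j s + \sum_(k <- r) f k s.
  by apply: funext => s; rewrite big_cons.
exact: has_tderivD.
Qed.

Lemma has_tderiv_ext f g l : T t -> (forall s, T s -> f s = g s) ->
  has_tderiv T f t l -> has_tderiv T g t l.
Proof.
move=> Tt fg df; apply: cvg_trans df; apply: near_eq_cvg; rewrite near_withinE.
by apply: filterE => h /= Th; rewrite !fg.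
Qed.

(** Limits along admissible increments are unique only if there are arbitrarily small nonzero ones;
    small steps from [t] towards another time [u] provide them. *)
Lemma tfilter_proper : is_interval T -> T t -> (exists2 u, T u & u != t) -> ProperFilter F.
Proof.
move=> iT Tt [u Tu ut]; apply: Build_ProperFilter_ex => P.
rewrite /F /within /= => /nbhs_ballP[d /= d0 H].
(* The first bound makes the step e (u - t) at most d/2, the second keeps t + e (u - t) between [t]
   and [u]. *)
pose e := Num.min (d / (2 * `|u - t|)) 1.
have ut0 : 0 < `|u - t| by rewrite normr_gt0 subr_eq0.
have e0 : 0 < e by rewrite lt_min ltr01 divr_gt0 // mulr_gt0.
have e1 : e <= 1 by rewrite ge_min lexx orbT.
exists (e * (u - t)); apply: H => /=.
- rewrite -ball_normE /= sub0r normrN normrM gtr0_norm //.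
  apply: (@le_lt_trans _ _ (d / 2)); last by rewrite ltr_pdivrMr // ltr_pMr ?ltr1n.
  rewrite -ler_pdivlMr //; apply: le_trans (_ : d / (2 * `|u - t|) <= _).
    by rewrite ge_min lexx.
  by rewrite invfM mulrA.
- by apply: mulf_neq0; [rewrite gt_eqF|rewrite subr_eq0].
have [tu|tu] := leP t u.
  apply: (iT t u) => //; apply/andP; split; first by rewrite lerDl mulr_ge0 ?subr_ge0 // ltW.
  by rewrite -lerBrDl ler_piMl // subr_ge0.
apply: (iT u t) => //; apply/andP; split; last first.
  by rewrite gerDl mulr_ge0_le0 ?(ltW e0) // subr_le0 ltW.
rewrite -lerBlDl -lerN2 -mulrN opprB; apply: ler_piMl => //.
by rewrite subr_ge0 ltW.
Qed.

Lemma has_tderiv_unique f l m : is_interval T -> T t -> (exists2 u, T u & u != t) ->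
  has_tderiv T f t l -> has_tderiv T f t m -> l = m.
Proof.
move=> iT Tt uT; have PF := tfilter_proper iT Tt uT.
exact: cvg_unique.
Qed.

Lemma has_tderiv_cwedge k l n (a : R -> covector R R k n) (b : R -> covector R R l n)
    (a' : covector R R k n) (b' : covector R R l n) v :
  (forall u, has_tderiv T (fun s => a s u) t (a' u)) ->
  (forall u, has_tderiv T (fun s => b s u) t (b' u)) ->
  has_tderiv T (fun s => cwedge (a s) (b s) v) t
    (cwedge a' (b t) v + cwedge (a t) b' v).
Proof.
move=> da db; rewrite /cwedge -mulrDr -big_split /=.
apply: has_tderivZ; apply: has_tderiv_sum => s; rewrite -mulrDr; apply: has_tderivZ.
exact: has_tderivM.
Qed.

End TimeDerivative.

(** * Images of the angle charts *)

Section Circle.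
Context {R : realType}.

Lemma cosD2pik (r : R) (k : int) : cos (r + k%:~R * (2 * pi)) = cos r.
Proof.
have H n x : cos (x + n%:R * (2 * pi)) = cos x :> R.
  by rewrite mulr_natl mulr_natl (periodicn (@cosD2pi R)).
case: k => n; first exact: H.
have E := H n.+1 (r - n.+1%:R * (2 * pi)); rewrite subrK in E.
by rewrite NegzE rmorphN /= -pmulrn mulNr E.
Qed.

Lemma sinD2pik (r : R) (k : int) : sin (r + k%:~R * (2 * pi)) = sin r.
Proof.
have H n x : sin (x + n%:R * (2 * pi)) = sin x :> R.
  by rewrite mulr_natl mulr_natl (periodicn (@sinD2pi R)).
case: k => n; first exact: H.
have E := H n.+1 (r - n.+1%:R * (2 * pi)); rewrite subrK in E.
by rewrite NegzE rmorphN /= -pmulrn mulNr E.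
Qed.

Lemma circle_angle (x y : R) : x ^+ 2 + y ^+ 2 = 1 -> exists r, cos r = x /\ sin r = y.
Proof.
move=> xy.
have x1 : -1 <= x <= 1.
  have : x ^+ 2 <= 1 by rewrite -xy lerDl sqr_ge0.
  by move=> h; rewrite -ler_norml -sqrtr_sqr -[leRHS]sqrtr1; exact: ler_wsqrtr.
have c : cos (acos x) = x by rewrite acosK // in_itv.
have s : sin (acos x) = `|y| by rewrite sin_acos // -sqrtr_sqr -xy addrAC subrr add0r.
have [y0|y0] := leP 0 y.
  by exists (acos x); rewrite c s ger0_norm.
by exists (- acos x); rewrite cosN sinN c s ltr0_norm // opprK.
Qed.

(** If s < r, then (r - s)/2 lies in ]0, pi[ and has positive sine, while cos(r - s) = 1 forces this
    sine to vanish. *)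
Lemma angle_pt_inj (r s : R) : angle_pt r = angle_pt s -> `|r - s| < 2 * pi -> r = s.
Proof.
wlog rs : r s / s <= r => [hw|].
  have [sr|rs] := leP s r; first exact: hw.
  by rewrite distrC => /esym E h; apply/esym; apply: hw => //; exact: ltW.
move=> [cE sE]; rewrite ger0_norm ?subr_ge0 // => h.
apply/eqP; rewrite eq_le rs andbT leNgt; apply/negP => lt_sr.
have c1 : cos (r - s) = 1 by rewrite cosB cE sE -!expr2 cos2Dsin2.
have d2 : (r - s) / 2 *+ 2 = r - s by rewrite -mulr_natr divfK ?pnatr_eq0.
have := cos_mulr2n ((r - s) / 2); rewrite d2 c1 mulr2n.
have s0 : 0 < sin ((r - s) / 2).
  apply: sin_gt0_pi; rewrite divr_gt0 ?subr_gt0 //=.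
  by rewrite ltr_pdivrMr // mulrC.
by have := cos2Dsin2 ((r - s) / 2); nra.
Qed.

Lemma cimg_circle (a : R) :
  cimg (X := circle_charts R) a = [set x : 'rV[R]_1 | a < x 0 0 < a + 2 * pi].
Proof.
have pi0 : 0 < 2 * pi :> R by rewrite mulr_gt0 // pi_gt0.
apply/seteqP; split=> [x [z /= za <-]|x /= /andP[ax xa]].
  rewrite mxE; case: xgetP => [r _ [] //|none].
  exfalso; case: z za none => -[p q] pq za none.
  have pq' : p ^+ 2 + q ^+ 2 = 1 by move: (pq); rewrite inE.
  have [r [cr sr]] := circle_angle pq'.
  (* The number of full turns to remove so that a <= r' < a + 2 pi; equality on the left is excluded
     because the chart omits the point of angle [a]. *)
  pose k := Num.floor ((r - a) / (2 * pi)).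
  pose r' := r + (- k)%:~R * (2 * pi).
  have r'E : angle_pt r' = exist _ (p, q) pq.
    by apply: eq_exist; rewrite /r' cosD2pik sinD2pik cr sr.
  have k1 : k%:~R * (2 * pi) <= r - a by rewrite -ler_pdivlMr // floor_le_tmp.
  have k2 : r - a < (k + 1)%:~R * (2 * pi) by rewrite -ltr_pdivrMr // floorD1_gt.
  apply: (none r'); split=> //; rewrite /r' rmorphN mulNr.
  rewrite intrD mulrDl mul1r in k2.
  have h2 : r - k%:~R * (2 * pi) < a + 2 * pi by lra.
  rewrite h2 andbT lt_neqAle; apply/andP; split; last by lra.
  apply/eqP => ra; apply: za; rewrite -r'E ra /r' rmorphN mulNr //.
exists (angle_pt (x 0 0)) => /=.
  move=> E; have := angle_pt_inj E; rewrite ger0_norm ?subr_ge0 ?(ltW ax) //.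
  rewrite ltrBlDl => /(_ xa) xE; by rewrite xE ltxx in ax.
apply/matrixP => i j; rewrite mxE !ord1; case: xgetP => [r _ [/andP[ar ra] E]|none].
  apply: (angle_pt_inj E); rewrite ltr_norml; apply/andP; split; lra.
by exfalso; apply: (none (x 0 0)); rewrite /= ax xa.
Qed.

Lemma open_cimg_circle (a : R) : open (cimg (X := circle_charts R) a).
Proof.
rewrite cimg_circle.
have -> : [set x : 'rV[R]_1 | a < x 0 0 < a + 2 * pi] =
  (fun x : 'rV[R]_1 => x 0 0) @^-1` `]a, (a + 2 * pi)[%classic.
  by apply/seteqP; split => x /=; rewrite in_itv.
apply: open_comp; last exact: interval_open.
by move=> x _; exact: coord_continuous.
Qed.

End Circle.

(** * Calabi-Yau structures in a chart *)

Section CalabiYauLocal.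
Context {R : realType} {N : Type} {X : charts R 6 N}.
Context (J : endo X) (om : kform R X 2) (U : kform R[i] X 3).
Hypotheses (oX : forall i : cidx X, open (cimg i)) (CY : calabi_yau J om U).
Local Open Scope complex_scope.

Let re := re_form U.
Let im := im_form U.

Lemma form_C2 k (a : kform R X k) i : is_form a -> C2f (cimg i) (a i).
Proof. by case=> _ h _ v; apply: smooth_C2. Qed.

Lemma C2f_C1f k (a : kform R X k) i x : cimg i x -> C2f (cimg i) (a i) -> C1f (a i) x.
Proof. by move=> ix h v; exact: (h v).1. Qed.

Lemma form_alt_near k (a : kform R X k) i x : is_form a -> cimg i x ->
  \forall y \near x, alternating (a i y).
Proof.
case=> h _ _ ix.
exact: (open_near (P := fun y => alternating (a i y)) (@oX i) ix (h i)).
Qed.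

Let om_form : is_form om. Proof. by case: CY => _ []. Qed.
Let re_isform : is_form re. Proof. by case: CY => _ _ [[]]. Qed.
Let im_isform : is_form im. Proof. by case: CY => _ _ [[]]. Qed.

Lemma real_lin_complex (b c p q p' q' : R) :
  (b * p + c * q) +i* (b * p' + c * q') = b%:C * (p +i* p') + c%:C * (q +i* q').
Proof. by apply: complexP; rewrite !(cReD, cImD, cReM, cImM) /=; ring. Qed.

Lemma holomorphic_linear i D (f : 'rV[R]_6 -> R[i]) x : open D -> D x ->
  holomorphic_on J i D f ->
  (forall b c u v, cdiff f x (b *: u + c *: v) = b%:C * cdiff f x u + c%:C * cdiff f x v) /\
  (forall v, cdiff f x (v *m J i x) = 'i * cdiff f x v).
Proof.
move=> oD Dx [fr fi fJ]; split=> [b c u v|v]; last exact: fJ.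
have [dr _] := smooth_C2 oD fr; have [di _] := smooth_C2 oD fi.
rewrite /cdiff; rewrite (deriveDl _ _ (dr x Dx)) (deriveDl _ _ (di x Dx)).
rewrite !(deriveZl _ _ (dr x Dx)) !(deriveZl _ _ (di x Dx)).
exact: real_lin_complex.
Qed.

Let metric := kaehler_metric J om.

Definition frame_at i x (P : 'M[R]_6) (c : R) :=
  [/\ P \in unitmx, 0 < c, P *m metric i x *m P^T = 1%:M,
    (fun v => om i x (v *m P)) = F6 2 om0
    & (fun v => U i x (v *m P)) = fun v => c%:C * (F6 3 re0 v +i* F6 3 im0 v)].

(** Both parts use one holomorphic chart around [x]: its differentials dz_j at [x] are the
    complex-linear covectors of [normal_form], and they enter the determinant of [cextd_closed]. *)
Lemma ex_frame_closed i x : cimg i x -> (exists P c, frame_at i x P c) /\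
  (extd (re i) x = fun _ => 0) /\ (extd (im i) x = fun _ => 0).
Proof.
move=> ix; have [[J1 J2 J3] [w1 w2 w3 w4] [U1 U2] U3] := CY.
have [V [z [Vx zV]]] := J3 i x ix.
have [h hh Uh] := U2 i V z zV.
have [oV Vi zh _ _] := zV.
have zl j := holomorphic_linear oV Vx (zh j).
have hl := holomorphic_linear oV Vx hh.
have oma : alternating (om i x) by case: w1 => a _ _; exact: a.
split.
  have := @normal_form R (J i x) (om i x) (J2 i x ix) oma (fun v => w2 i x v ix)
    (w3 i x ix) (fun j => cdiff (z j) x) (h x) (U i x).
  move=> [b c u v||v|//|P [c [H1 H2 H3 H4 H5]]].
  - exact: (zl b).1.
  - by move=> j; exact: (zl j).2.
  - exact: Uh.
  - by have := U3 i x ix.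
  by exists P, c.
have [u uu] := ex_unitary (J2 i x ix) oma (fun v => w2 i x v ix) (w3 i x ix).
have Pu := frame_unit (J2 i x ix) oma (fun v => w2 i x v ix) (w3 i x ix) uu.
have zr j : C2_on V (fun y => complex.Re (z j y)) by case: (zh j) => a _ _; exact: smooth_C2.
have zi j : C2_on V (fun y => complex.Im (z j y)) by case: (zh j) => _ a _; exact: smooth_C2.
have hr : C1_on V (fun y => complex.Re (h y)) by case: hh => a _ _; case: (smooth_C2 oV a).
have hi : C1_on V (fun y => complex.Im (h y)) by case: hh => _ a _; case: (smooth_C2 oV a).
have E v := extd_volume oV Vx zr zi hr hi (fun y Vy v => Uh y v Vy) v.
have K v : cextd z h x v = 0.
  apply: (cextd_closed oV Vx zr zi v Pu (u := u)
    (zeta := fun w a => w 0 (i6 a.*2) +i* w 0 (i6 a.*2.+1))).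
    move=> w; exact: (al_frame1 u hl.1 hl.2).
  move=> j w; exact: (al_frame1 u (zl j).1 (zl j).2).
by split; apply: funext => v; [rewrite (E v).1|rewrite (E v).2]; rewrite K.
Qed.

Section Frame.
Context (i : cidx X) (x : 'rV[R]_6) (P : 'M[R]_6) (c : R) (ix : cimg i x)
  (fr : frame_at i x P c).

Lemma frame_re : (fun v => re i x (v *m P)) = fun v => c * F6 3 re0 v.
Proof.
have [_ _ _ _ UP] := fr; apply: funext => v; rewrite /re /re_form.
by rewrite -[U i x _]/((fun v => U i x (v *m P)) v) UP cReM /=; ring.
Qed.

Lemma frame_im : (fun v => im i x (v *m P)) = fun v => c * F6 3 im0 v.
Proof.
have [_ _ _ _ UP] := fr; apply: funext => v; rewrite /im /im_form.
by rewrite -[U i x _]/((fun v => U i x (v *m P)) v) UP cImM /=; ring.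
Qed.

(** [c] satisfies the defining condition. Conversely, evaluating that condition on the frame forces
    f^2 = c^2, and both numbers are positive. *)
Lemma norm_frame : norm_U om U i x = c.
Proof.
have [Pu c0 _ omP UP] := fr.
have H v := norm_complex_volume v Pu c0 omP UP.
have c0' : c != 0 by rewrite gt_eqF.
rewrite /norm_U; set S := [set f | _]; have Sc : S c.
  split=> // v; rewrite -[v](mulmxKV Pu) (H _).1 (H _).2.
  set d := \det _; have -> : 'i / 8%:R = (0 +i* 8^-1 : R[i]).
    have -> : (8%:R : R[i])^-1 = (8^-1)%:C by rewrite fmorphV rmorph_nat.
    by apply: complexP; rewrite ?cReM ?cImM /=; ring.
  by apply: complexP; rewrite !(cReM, cImM) /=; field.
have [f0 /(_ P)] := xgetPex 0 (ex_intro _ c Sc).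
set f := xget 0 S in f0 *.
rewrite -[P](mul1mx P) (H _).1 (H _).2 det1 mulr1.
have -> : 'i / 8%:R = (0 +i* 8^-1 : R[i]).
  have -> : (8%:R : R[i])^-1 = (8^-1)%:C by rewrite fmorphV rmorph_nat.
  by apply: complexP; rewrite ?cReM ?cImM /=; ring.
move/(congr1 (@complex.Re R)); rewrite !(cReM, cImM) /= => E.
have f0' : f != 0 by rewrite gt_eqF.
have E2 : 1 = (f ^+ 2)^-1 * c ^+ 2 by rewrite [LHS]E; field.
apply/eqP; rewrite -(@eqrXn2 _ 2) ?ltW //; apply/eqP.
by rewrite -[RHS](mulVKf (x := f ^+ 2)) ?expf_neq0 // -E2 mulr1.
Qed.

Lemma cov_metric (th : 'rV[R]_6) : th *m invmx (metric i x) = th *m (P^T *m P).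
Proof.
have [Pu _ Pg _ _] := fr; congr (_ *m _).
have gP : metric i x *m (P^T *m P) = 1%:M.
  by rewrite mulmxA; apply: mulmx1C; rewrite mulmxA.
have [gu _] := mulmx1_unit gP.
by rewrite -[RHS](mulKmx gu) gP mulmx1.
Qed.

Lemma metric_unit : metric i x \in unitmx.
Proof.
have [Pu _ Pg _ _] := fr.
have gP : metric i x *m (P^T *m P) = 1%:M.
  by rewrite mulmxA; apply: mulmx1C; rewrite mulmxA.
by have [] := mulmx1_unit gP.
Qed.

End Frame.

(** The frames vary without control from point to point, so the regularity of |U| is read off from
    values on the coordinate basis: |U|^2 is a quotient of two such values, and [vol1] is its
    denominator. *)
Definition vol1 (i : cidx X) x : R :=
  (3`!)%:R^-1 * cwedge (cwedge (om i x) (om i x)) (om i x) 1%:M.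
(* Since [U /\ conj U = -2i Re U /\ Im U], this is [|U|^2]. *)
Definition normsq (i : cidx X) x : R :=
  4^-1 * (cwedge (re i x) (im i x) 1%:M * (vol1 i x)^-1).

Lemma vol1_neq0 i x : cimg i x -> vol1 i x != 0.
Proof.
move=> ix; have [[P [c [Pu c0 _ omP UP]]] _] := ex_frame_closed ix.
rewrite /vol1 -(mulVmx Pu) (norm_complex_volume (invmx P) Pu c0 omP UP).1.
by rewrite -unitfE -unitmxE unitmx_inv.
Qed.

Lemma normsqE i x : cimg i x -> normsq i x = norm_U om U i x ^+ 2 /\ 0 < norm_U om U i x.
Proof.
move=> ix; have [[P [c fr]] _] := ex_frame_closed ix; have [Pu c0 _ omP UP] := fr.
rewrite (norm_frame fr); split=> //; have v0 := vol1_neq0 ix.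
move: v0; rewrite /normsq /vol1 -(mulVmx Pu) (norm_complex_volume (invmx P) Pu c0 omP UP).1.
rewrite cwedge_mulmx (frame_re fr) (frame_im fr) cwedge_Zl cwedge_Zr /F6 interp_wedge //.
have /and4P[_ _ h3 _] := flat_reim.
rewrite (interp_eq i6 _ h3) /interp big_seq1 /= mono_iota => [d0|]; last exact: i6K.
by field.
Qed.

Lemma C2_normsq i : C2_on (cimg i) (normsq i).
Proof.
have ho := form_C2 i om_form; have hr := form_C2 i re_isform; have hi := form_C2 i im_isform.
have oi := @oX i.
have h2 : C2f (cimg i) (fun y => cwedge (om i y) (om i y)) by exact: C2_cwedge.
have h3 : C2f (cimg i) (fun y => cwedge (cwedge (om i y) (om i y)) (om i y)).
  exact: (C2_cwedge oi h2 ho).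
have h4 : C2f (cimg i) (fun y => cwedge (re i y) (im i y)) by exact: C2_cwedge.
apply: C2_mul => //; first exact: C2_cst.
apply: C2_mul => //.
apply: C2_inv => // [|x]; last exact: vol1_neq0.
by apply: C2_mul => //; exact: C2_cst.
Qed.

Let L := log_norm_U om U.

Lemma log_normE i x : cimg i x -> L i x = 2^-1 * ln (normsq i x).
Proof.
move=> ix; have [-> f0] := normsqE ix.
have half (a : R) : a = 2^-1 * (a + a) by field.
by rewrite lnXn // mulr2n; exact: half.
Qed.

Lemma C2_log_norm i : C2_on (cimg i) (L i).
Proof.
apply: (C2_near (@oX i) (fun x => @log_normE i x)).
apply: C2_mul => //; first exact: C2_cst.
apply: C2_ln => // [|x ix]; first exact: C2_normsq.
by have [-> f0] := normsqE ix; rewrite exprn_gt0.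
Qed.

Let f := norm_U om U.

(** The regularity of L is already known from [normsq], and f = exp L inherits it. *)
Lemma derive_norm i x : cimg i x -> differentiable (f i) x /\
  forall v, 'D_v (f i) x = f i x * 'D_v (L i) x.
Proof.
move=> ix; have [dL _] := C2_log_norm i.
have E y : cimg i y -> f i y = expR (L i y).
  by move=> iy; rewrite /L /log_norm_U lnK // posrE; have [] := normsqE iy.
have near_E : \forall y \near x, f i y = expR (L i y).
  exact: (open_near (@oX i) ix E).
have [d1 d2] := chain_rule (dL x ix) (is_derive_expR (L i x)).
split; first exact: near_differentiable near_E d1.
by move=> v; rewrite (near_eq_derive v near_E) d2 E.
Qed.

Lemma derive_norm_inv i x : cimg i x -> differentiable (fun y => (f i y)^-1) x /\
  forall v, 'D_v (fun y => (f i y)^-1) x = - (f i x)^-1 * 'D_v (L i) x.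
Proof.
move=> ix; have [df Df] := derive_norm ix; have [_ f0] := normsqE ix.
have fn : f i x != 0 by rewrite gt_eqF.
split=> [|v]; first exact: differentiableV.
rewrite deriveV //; last exact: diff_derivable.
by rewrite Df /GRing.scale /=; field.
Qed.

Definition dlog i x : 'rV[R]_6 := \row_s 'D_(delta_mx 0 s) (L i) x.

Lemma cov_dlog i x : cimg i x -> cov (dlog i x) = dfun L i x.
Proof.
move=> ix; apply: funext => v; have [dL _] := C2_log_norm i.
rewrite /dfun (derive_row v (dL x ix)) /cov mxE; apply: eq_bigr => s _.
by rewrite !mxE.
Qed.

Let Y := grad_log_norm_U J om U.

Lemma gradE i x P c : frame_at i x P c -> Y i x = dlog i x *m (P^T *m P).
Proof. by move=> fr; rewrite -(cov_metric fr). Qed.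

Lemma grad_differentiable i x : cimg i x -> forall j, differentiable (fun y => Y i y 0 j) x.
Proof.
move=> ix j.
have -> : (fun y => Y i y 0 j) = fun y => \sum_s dlog i y 0 s * invmx (metric i y) s j.
  by apply: funext => y; rewrite mxE.
apply: differentiable_bigsum => s _; apply: differentiableM.
  under eq_fun do rewrite mxE; exact: (C2_log_norm i).2.
apply: differentiable_invmx; last first.
  apply: (open_near (P := fun y => metric i y \in unitmx) (@oX i) ix) => y iy.
  by have [[P [c fr]] _] := ex_frame_closed iy; exact: metric_unit fr.
move=> p q.
have [[[Js _] _ _] _ _ _] := CY.
(* The smoothness of omega is given on fixed vectors, whereas the second argument in the metric is
   moved by [J]; it is therefore expanded in the standard basis. *)
apply: (near_differentiable (f := fun y => \sum_t J i y q t *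
    om i y (col_mx (delta_mx 0 p : 'rV[R]_6) (delta_mx 0 t)))).
  apply: (filterS _ (form_alt_near om_form ix)) => y oma; rewrite mxE.
  rewrite (lin_expand (f := fun u => om i y (col_mx (delta_mx 0 p : 'rV[R]_6) u))).
    by apply: eq_bigr => t _; rewrite -rowE mxE.
  by move=> b c u v; exact: om_linr.
apply: differentiable_bigsum => t _; apply: differentiableM.
  exact: (smooth_C2 (@oX i) (Js i q t)).1.
exact: (form_C2 i om_form _).1.
Qed.

Lemma closed_om i x : cimg i x -> extd (om i) x = fun _ => 0.
Proof.
move=> ix; apply: funext => v; have [_ [_ _ _ h] _ _] := CY.
exact: h.
Qed.

End CalabiYauLocal.

(** * The G2-form of the product *)

Section CovectorZero.
Context {R : realType}.

Lemma cwedge0l k l n (b : covector R R l n) :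
  cwedge (fun=> 0 : R) b = fun _ : 'M[R]_(k + l, n) => 0.
Proof.
by apply: funext => v; rewrite /cwedge big1 ?mulr0 // => s _; rewrite mul0r mulr0.
Qed.

Lemma cwedge0r k l n (a : covector R R k n) :
  cwedge a (fun=> 0 : R) = fun _ : 'M[R]_(k + l, n) => 0.
Proof.
by apply: funext => v; rewrite /cwedge big1 ?mulr0 // => s _; rewrite mulr0 mulr0.
Qed.

Lemma extd_cst k n (a : covector R R k n) (x : 'rV[R]_n) :
  extd (fun=> a) x = fun=> 0.
Proof.
by apply: funext => v; rewrite /extd big1 // => r _; rewrite derive_cst mulr0.
Qed.

End CovectorZero.

(** * Charts of the product *)

Section ProductChart.
Context {R : realType} {N : Type} {X : charts R 6 N}.
Notation XS := (prod_charts X (circle_charts R)).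

Lemma cimg_prod (k : cidx XS) : cimg k = [set x : 'rV[R]_(6 + 1) |
  cimg k.1 (lsubmx x) /\ cimg (X := circle_charts R) k.2 (rsubmx x)].
Proof.
apply/seteqP; split=> [x [[p z] [/= pk zk] <-]|x [[p pk px] [z zk zx]]] /=.
  by rewrite row_mxKl row_mxKr; split; [exists p|exists z].
exists (p, z); first by split.
by rewrite -[RHS]hsubmxK -px -zx.
Qed.

Lemma open_prod (k : cidx XS) : open (cimg k.1) -> open (cimg k).
Proof.
move=> ok; rewrite cimg_prod.
have -> : [set x : 'rV[R]_(6 + 1) |
    cimg k.1 (lsubmx x) /\ cimg (X := circle_charts R) k.2 (rsubmx x)] =
  (@lsubmx R 1 6 1 @^-1` cimg k.1) `&`
  (@rsubmx R 1 6 1 @^-1` cimg (X := circle_charts R) k.2) by [].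
apply: openI; apply: open_comp => //; last exact: open_cimg_circle.
  by move=> x _; apply: differentiable_continuous; exact: differentiable_lsubmx.
by move=> x _; apply: differentiable_continuous; exact: differentiable_rsubmx.
Qed.

End ProductChart.

(** * The two sides of the coflow for the G2-form at a fixed time *)

Section Coflow.
Context {R : realType} {N : Type} {X : charts R 6 N}.
Context (J : endo X) (om : kform R X 2) (U : kform (complex R) X 3).
Hypotheses (oX : forall i : cidx X, open (cimg i)) (CY : calabi_yau J om U).
Notation XS := (prod_charts X (circle_charts R) : charts R 7 (N * circle R)).
Let re := re_form U.
Let im := im_form U.
Let f := norm_U om U.
Let L := log_norm_U om U.
Let Y := grad_log_norm_U J om U.
Let phi : kform R XS 3 := G2_form om U.
Notation l6 := (@lsubmx R 1 6 1).

Let om_form : is_form om. Proof. by case: CY => _ []. Qed.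
Let re_isform : is_form re. Proof. by case: CY => _ _ [[]]. Qed.
Let im_isform : is_form im. Proof. by case: CY => _ _ [[]]. Qed.

Lemma prod_cimg (k : cidx XS) (x : 'rV[R]_(6 + 1)) : cimg k x -> cimg k.1 (l6 x).
Proof. by rewrite (cimg_prod k) => -[]. Qed.

Lemma prod_near (k : cidx XS) (x : 'rV[R]_(6 + 1)) (P : 'rV[R]_(6 + 1) -> Prop) :
  cimg k x -> (forall y, cimg k y -> P y) -> \forall y \near x, P y.
Proof. by move=> kx; apply: open_near => //; exact: open_prod (@oX k.1). Qed.

Lemma G2_formE (k : cidx XS) (x : 'rV[R]_(6 + 1)) :
  phi k x = phi7 (om k.1 (l6 x)) (re k.1 (l6 x)) (f k.1 (l6 x)).
Proof. by []. Qed.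

Lemma G2_form_metric (k : cidx XS) (x : 'rV[R]_(6 + 1)) (y := l6 x) : cimg k x ->
  exists P, [/\ G2_metrics (phi k x) (g7 (f k.1 y) P, e7 (f k.1 y) P),
  G2_metric (phi k x) = (g7 (f k.1 y) P, e7 (f k.1 y) P)
  & frame_at J om U k.1 y P (f k.1 y)].
Proof.
move=> kx; have ky := prod_cimg kx; have [[P [c fr]] _] := ex_frame_closed CY ky; exists P.
have fc : f k.1 y = c := norm_frame fr.
have [Pu c0 Pg omP UP] := fr.
rewrite G2_formE -/y fc; split => //.
  exact: (G2_metrics_phi7 c0 Pu omP (frame_re fr)).
exact: (G2_metric_phi7 c0 Pu omP (frame_re fr)).
Qed.

Lemma G2_form_metrics k x : cimg k x -> G2_metrics (phi k x) !=set0.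
Proof.
move=> kx; have [P [h _ _]] := G2_form_metric kx.
by exists (g7 (f k.1 (l6 x)) P, e7 (f k.1 (l6 x)) P).
Qed.

Lemma psi_G2 k x : cimg k x -> psi phi k x = psi7 (om k.1 (l6 x)) (im k.1 (l6 x)).
Proof.
move=> kx; have [P [_ M fr]] := G2_form_metric kx; have [Pu c0 _ omP _] := fr.
apply: funext => v; rewrite /psi /star37 M /= G2_formE.
exact: (star_phi7 c0 Pu omP (frame_re fr) (frame_im fr)).
Qed.

Lemma star_psi_G2 k x : cimg k x -> star47 phi (psi phi) k x = phi k x.
Proof.
move=> kx; have [P [_ M fr]] := G2_form_metric kx; have [Pu c0 _ omP _] := fr.
apply: funext => v; rewrite /star47 M /= psi_G2 //.
exact: (star_psi7 c0 Pu omP (frame_re fr) (frame_im fr)).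
Qed.

Lemma pull_alt k (a : kform R X k) (j : cidx XS) x : is_form a -> cimg j x ->
  \forall y \near x, alternating (p1 (a j.1 (l6 y))).
Proof.
move=> [h _ _] jx; apply: (prod_near jx (P := fun y => alternating (p1 (a j.1 (l6 y))))) => y jy.
by apply: p1_alt; apply: h; exact: prod_cimg.
Qed.

Lemma pull_C1 k (a : kform R X k) (j : cidx XS) x : is_form a -> cimg j x ->
  C1f (fun y => p1 (a j.1 (l6 y))) x.
Proof.
move=> fa jx; apply: C1f_p1; apply: C2f_C1f; first exact: prod_cimg.
exact: form_C2.
Qed.

Lemma drc_near (x : 'rV[R]_(6 + 1)) :
  \forall y \near x, alternating ((fun=> drc : covector R R 1 (6 + 1)) y).
Proof. by apply: filterE => y; exact: drc_alt. Qed.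

Lemma drc_C1 (x : 'rV[R]_(6 + 1)) : C1f (fun=> drc : covector R R 1 (6 + 1)) x.
Proof. by move=> v; exact: differentiable_cst. Qed.

Lemma extd_drc_wedge l (b : 'rV[R]_(6 + 1) -> covector R R l (6 + 1)) x :
  (\forall y \near x, alternating (b y)) -> C1f b x ->
  extd (fun y => cwedge drc (b y)) x = fun v => - cwedge drc (extd b x) v.
Proof.
move=> ab db; apply: funext => v.
by rewrite (extd_cwedge1 (drc_near x) ab (drc_C1 x) db) extd_cst cwedge0l sub0r.
Qed.

Lemma cov_alt (th : 'rV[R]_6) : alternating (cov th).
Proof.
split=> [r b c u v w h _ _|r s v rs]; last by case/eqP: rs; rewrite !ord1.
by move: h; rewrite !row_id /cov => ->; rewrite mulmxDl -!scalemxAl !mxE.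
Qed.

Lemma extd_G2 k x : cimg k x ->
  ext_d phi k x = dphi7 (om k.1 (l6 x)) (re k.1 (l6 x)) (f k.1 (l6 x)) (dlog om U k.1 (l6 x)).
Proof.
move=> kx; have ky := prod_cimg kx; apply: funext => v.
have [di Di] := derive_norm_inv oX CY ky; have [df Df] := derive_norm oX CY ky.
have dR := differentiable_lsub df; have dI := differentiable_lsub di.
have ar := pull_alt re_isform kx; have ao := pull_alt om_form kx.
have cr := pull_C1 re_isform kx; have co := pull_C1 om_form kx.
have aw := near_cwedge_alt (drc_near x) ao.
have cw := C1f_cwedge (drc_C1 x) co.
set fi := fun y => (f k.1 (l6 y))^-1; set fr := fun y => f k.1 (l6 y).
have E : phi k = fun y v => 1 * ((fun y v => fi y * p1 (re k.1 (l6 y)) v) y v) +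
    1 * ((fun y v => fr y * cwedge drc (p1 (om k.1 (l6 y))) v) y v).
  by apply: funext => y; apply: funext => w; rewrite !mul1r.
have cs (g : 'rV[R]_(6 + 1) -> R) l (a : 'rV[R]_(6 + 1) -> covector R R l (6 + 1)) :
    differentiable g x -> C1f a x -> C1f (fun y v => g y * a y v) x.
  by move=> dg da w; apply: differentiableM.
rewrite -[LHS]/(extd (phi k) x v) E extd_lin; [|exact: cs|exact: cs].
rewrite !mul1r (extd_scale v ar cr dI) (extd_scale v aw cw dR) extd_drc_wedge // !extd_p1.
have [_ [-> _]] := ex_frame_closed CY ky; rewrite (closed_om CY ky).
have -> : p1 (fun=> 0 : R) = (fun=> 0) :> covector R R 3 (6 + 1) by [].
have -> : p1 (fun=> 0 : R) = (fun=> 0) :> covector R R 4 (6 + 1) by [].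
rewrite cwedge0r oppr0 mulr0 addr0 mulr0 addr0.
have -> : (fun u : 'rV[R]_(6 + 1) => 'D_u fi x) = fun u => - fi x * p1 (cov (dlog om U k.1 (l6 x))) u.
  apply: funext => u; rewrite (derive_lsub (fun y => (f k.1 y)^-1)) Di.
  by rewrite (cov_dlog oX CY ky).
have -> : (fun u : 'rV[R]_(6 + 1) => 'D_u fr x) = fun u => fr x * p1 (cov (dlog om U k.1 (l6 x))) u.
  apply: funext => u; rewrite (derive_lsub (f k.1)) Df.
  by rewrite (cov_dlog oX CY ky).
(* The derivative of f dr /\ omega appears as f dL /\ dr /\ omega; exchanging dL and dr gives the
   sign that it shares with the other term. *)
rewrite !cwedge_Zl (cwedge11C (p1_alt (@cov_alt _)) drc_alt (nbhs_singleton ao)).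
by rewrite mulNr mulrN -opprD.
Qed.

Lemma star_dG2 k x : cimg k x -> star47 phi (ext_d phi) k x = fun v =>
  1 * cwedge drc (p1 (contract (Y k.1 (l6 x)) (im k.1 (l6 x)))) v +
  (-1) * cwedge (p1 (contract (Y k.1 (l6 x)) (om k.1 (l6 x)))) (p1 (om k.1 (l6 x))) v.
Proof.
move=> kx; have ky := prod_cimg kx.
have [P [_ M fr]] := G2_form_metric kx; have [Pu c0 _ omP _] := fr.
apply: funext => v; rewrite /star47 M /= extd_G2 //.
have -> : Y k.1 (l6 x) = _ := gradE fr; rewrite mul1r mulN1r.
apply: (star_dphi7 c0 Pu omP (frame_re fr) (frame_im fr)).
  by case: om_form => h _ _; exact: h.
by case: im_isform => h _ _; exact: h.
Qed.

Lemma tau0_G2 k x : cimg k x -> tau0 phi k x = 0.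
Proof.
move=> kx; have [P [_ M fr]] := G2_form_metric kx; have [Pu c0 _ omP _] := fr.
rewrite /tau0 /star77 M /= /fwedge extd_G2 // G2_formE.
rewrite /star big1 ?mulr0 // => I _.
by rewrite (phi_dphi7 c0 Pu omP (frame_re fr)) mul0r.
Qed.

Lemma extd_psi_G2 k x : cimg k x -> ext_d (psi phi) k x = fun=> 0.
Proof.
move=> kx; have ky := prod_cimg kx; apply: funext => v.
have ai := pull_alt im_isform kx; have ao := pull_alt om_form kx.
have ci := pull_C1 im_isform kx; have co := pull_C1 om_form kx.
have E : \forall y \near x, psi phi k y = (fun y v =>
    2^-1 * cwedge (p1 (om k.1 (l6 y))) (p1 (om k.1 (l6 y))) v +
    (-1) * cwedge drc (p1 (im k.1 (l6 y))) v) y.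
  apply: (prod_near kx (P := fun y => psi phi k y = (fun y v =>
    2^-1 * cwedge (p1 (om k.1 (l6 y))) (p1 (om k.1 (l6 y))) v +
    (-1) * cwedge drc (p1 (im k.1 (l6 y))) v) y)) => y jy.
  by rewrite psi_G2 //; apply: funext => w; rewrite /psi7 mulN1r.
rewrite -[LHS]/(extd (psi phi k) x v) (extd_near v E).
rewrite (extd_lin _ _ _ (C1f_cwedge co co) (C1f_cwedge (drc_C1 x) ci)).
rewrite (extd_square v ao co) extd_drc_wedge // !extd_p1.
have [_ [_ ->]] := ex_frame_closed CY ky; rewrite (closed_om CY ky).
have -> : p1 (fun=> 0 : R) = (fun=> 0) :> covector R R 4 (6 + 1) by [].
have -> : p1 (fun=> 0 : R) = (fun=> 0) :> covector R R 3 (6 + 1) by [].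
by rewrite cwedge0r cwedge0l oppr0 !mulr0 addr0.
Qed.

Lemma codiff5_G2 k x v : cimg k x -> codiff5 phi (ext_d (psi phi)) k x v = 0.
Proof.
move=> kx; rewrite /codiff5 /star37.
have -> : ext_d (star57 phi (ext_d (psi phi))) k x = fun=> 0.
  apply: funext => w.
  have E : \forall y \near x, star57 phi (ext_d (psi phi)) k y = (fun=> (fun=> 0)) y.
    apply: (prod_near kx (P := fun y => star57 phi (ext_d (psi phi)) k y = (fun=> (fun=> 0)) y)) => y jy.
    apply: funext => u; rewrite /star57 extd_psi_G2 // /star big1 ?mulr0 // => I _.
    by rewrite mul0r.
  by rewrite -[LHS]/(extd (star57 phi (ext_d (psi phi)) k) x w) (extd_near w E) extd_cst.
by rewrite /star big1 ?mulr0 // => I _; rewrite mul0r.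
Qed.

Lemma d_codiff4_G2 k x v : cimg k x -> ext_d (codiff4 phi (psi phi)) k x v =
  - cwedge drc (p1 (lie Y im k.1 (l6 x))) v - p1 (cwedge (lie Y om k.1 (l6 x)) (om k.1 (l6 x))) v.
Proof.
move=> kx; have ky := prod_cimg kx.
have dY := grad_differentiable oX CY ky.
have ai := form_alt_near oX im_isform ky; have ao := form_alt_near oX om_form ky.
have ci := C2f_C1f ky (form_C2 oX k.1 im_isform); have co := C2f_C1f ky (form_C2 oX k.1 om_form).
have c1 := cartan ai ci dY; have c2 := cartan ao co dY.
pose Yi y := contract (Y k.1 y) (im k.1 y).
pose Yo y := contract (Y k.1 y) (om k.1 y).
have E : \forall y \near x, codiff4 phi (psi phi) k y = (fun y v =>
    1 * cwedge drc (p1 (Yi (l6 y))) v + (-1) * cwedge (p1 (Yo (l6 y))) (p1 (om k.1 (l6 y))) v) y.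
  apply: (prod_near kx (P := fun y => codiff4 phi (psi phi) k y = (fun y v =>
    1 * cwedge drc (p1 (Yi (l6 y))) v + (-1) * cwedge (p1 (Yo (l6 y))) (p1 (om k.1 (l6 y))) v) y)) => y jy.
  (* The exponent in [codiff4] is 36, so the codifferential of [psi] is star d star psi = star d
     phi. *)
  apply: funext => w; rewrite /codiff4 -signr_odd /= expr0 [LHS]mul1r.
  transitivity (star47 phi (ext_d phi) k y w); last by rewrite star_dG2.
  rewrite /star47 /=; congr (star _ _ _ _); apply: funext => u.
  apply: extd_near.
  (* Equality on the image of the chart, a neighbourhood of the point, is what the exterior
     derivative requires. *)
  exact: (prod_near jy (P := fun y => star47 phi (psi phi) k y = phi k y) (@star_psi_G2 k)).
have pa l (a : kform R X l.+1) : is_form a ->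
    \forall y \near x, alternating (p1 (contract (Y k.1 (l6 y)) (a k.1 (l6 y)))).
  move=> [h _ _]; apply: (prod_near kx (P := fun y => alternating (p1 (contract (Y k.1 (l6 y)) (a k.1 (l6 y)))))) => y jy.
  by apply/p1_alt/alt_contract/h; exact: prod_cimg.
have pi_ := pa _ _ im_isform; have po := pa _ _ om_form.
have ci' : C1f (fun y => p1 (Yi (l6 y))) x := C1f_p1 (C1f_contract ai ci dY).
have co' : C1f (fun y => p1 (Yo (l6 y))) x := C1f_p1 (C1f_contract ao co dY).
have aop := pull_alt om_form kx; have cop := pull_C1 om_form kx.
rewrite -[LHS]/(extd (codiff4 phi (psi phi) k) x v) (extd_near v E).
rewrite (extd_lin _ _ _ (C1f_cwedge (drc_C1 x) ci') (C1f_cwedge co' cop)).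
rewrite extd_drc_wedge // (extd_cwedge1 po aop co' cop) !extd_p1 (closed_om CY ky).
rewrite mul1r mulN1r.
have -> : p1 (fun=> 0 : R) = (fun=> 0) :> covector R R 3 (6 + 1) by [].
rewrite cwedge0r subr0 -cwedge_p1; congr (- _ - _); congr (cwedge _ _ _); apply: funext => u.
  rewrite /p1 c1; have [_ [_ ->]] := ex_frame_closed CY ky.
  by rewrite /contract subr0.
by rewrite (extd_p1 Yo) /p1 c2 (closed_om CY ky) /contract subr0.
Qed.

Lemma d_torsion_G2 (A : R) k x v : cimg k x ->
  ext_d (fscale (fun j y => A - 7%:R / 2%:R * tau0 phi j y) phi) k x v =
  A * dphi7 (om k.1 (l6 x)) (re k.1 (l6 x)) (f k.1 (l6 x)) (dlog om U k.1 (l6 x)) v.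
Proof.
move=> kx; have ky := prod_cimg kx; rewrite -extd_G2 //.
have E : \forall y \near x, fscale (fun j y => A - 7%:R / 2%:R * tau0 phi j y) phi k y =
    (fun y v => A * phi k y v) y.
  apply: (prod_near kx (P := fun y => fscale (fun j y => A - 7%:R / 2%:R * tau0 phi j y) phi k y =
    (fun y v => A * phi k y v) y)) => y jy.
  by apply: funext => w; rewrite /fscale tau0_G2 // mulr0 subr0.
rewrite -[LHS]/(extd (fscale _ phi k) x v) (extd_near v E) /ext_d /extd mulr_sumr.
apply: eq_bigr => r _; rewrite mulrCA; congr (_ * _).
rewrite deriveMl //; apply: diff_derivable.
have [di _] := derive_norm_inv oX CY ky; have [df _] := derive_norm oX CY ky.
have dR := differentiable_lsub df; have dI := differentiable_lsub di.
have cr := pull_C1 re_isform kx; have co := pull_C1 om_form kx.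
have cw := C1f_cwedge (drc_C1 x) co.
apply: (differentiableD (differentiableM dI (cr (row' r v)))).
exact: (differentiableM dR (cw (row' r v))).
Qed.

End Coflow.

(** * The evolution equations *)

Section Split.
Context {R : realType}.

Lemma drc_row_mx0 k (u : 'M[R]_(k, 6)) r : drc (row r (row_mx u 0 : 'M[R]_(k, 6 + 1))) = 0.
Proof. by rewrite /drc row_row_mx row_mxKr !mxE. Qed.

(** Vectors tangent to the first factor are killed by [drc], which isolates [a]. Putting the circle
    direction in front of such vectors isolates [b], because its projection to the first factor is
    zero. *)
Lemma product_split k (a : covector R R k.+1 6) (b : covector R R k 6) :
  alternating a -> alternating b ->
  (forall v, p1 a v + cwedge drc (p1 b) v = 0) <->
  (forall u, a u = 0) /\ (forall u, b u = 0).
Proof.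
move=> ha hb; split=> [h|[a0 b0] v]; last first.
  have -> : b = fun=> 0 by apply: funext.
  have -> : p1 (fun=> 0 : R) = (fun=> 0) :> covector R R k (6 + 1) by [].
  by rewrite cwedge0r /p1 a0 addr0.
split=> u.
  have := h (row_mx u 0); rewrite (cwedge1 drc_alt (p1_alt hb)) big1.
    by rewrite addr0 /p1 row_mxKl.
  by move=> r _; rewrite drc_row_mx0 mul0r mulr0.
have := h (col_mx (row_mx 0 1%:M : 'M[R]_(1, 6 + 1)) (row_mx u 0 : 'M[R]_(k, 6 + 1)) : 'M[R]_(1 + k, 6 + 1)).
rewrite (cwedge1 drc_alt (p1_alt hb)) big_ord_recl big1 => [|r _]; last first.
  by rewrite row_col_mxS drc_row_mx0 mul0r mulr0.
rewrite row_col_mx0 row'0_col_mx expr0 mul1r addr0 /drc row_mxKr mxE mul1r.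
rewrite /p1 row_mxKl.
have -> : lsubmx (col_mx (row_mx 0 1%:M : 'M[R]_(1, 6 + 1)) (row_mx u 0 : 'M[R]_(k, 6 + 1))) =
   col_mx 0 u.
  by rewrite -block_mxEv block_mxEh row_mxKl.
have -> : (0 : 'rV[R]_6) = 0 *: 0 + 0 *: 0 by rewrite !scale0r addr0.
by rewrite (alt_row0_lin ha) !mul0r !add0r.
Qed.

End Split.

Section Evolution.
Context {R : realType} {N : Type} {X : charts R 6 N}.
Notation XS := (prod_charts X (circle_charts R) : charts R 7 (N * circle R)).
Notation l6 := (@lsubmx R 1 6 1).
Context (T : set R) (J : R -> endo X) (om : R -> kform R X 2) (U : R -> kform (complex R) X 3)
  (beta : kform R X 2) (gamma : kform (complex R) X 3) (A t : R).
Hypotheses (oX : forall i : cidx X, open (cimg i))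
  (iT : is_interval T) (Tt : T t) (uT : exists2 u, T u & u != t)
  (CY : forall s, T s -> calabi_yau (J s) (om s) (U s))
  (fbeta : is_form beta) (fgamma : is_cform gamma).
Let Y := grad_log_norm_U (J t) (om t) (U t).
Hypotheses (dom : form_tderiv T om t (fun i x v => - lie Y (om t) i x v + beta i x v))
  (dU : cform_tderiv T U t (fun i x v => clie Y (U t) i x v + gamma i x v)).
Let phi s : kform R XS 3 := G2_form (om s) (U s).

Lemma psi_tderiv (k : cidx XS) (x : 'rV[R]_(6 + 1)) (y := l6 x) (kx : cimg k x) v :
  has_tderiv T (fun s => psi (phi s) k x v) t
    (p1 (cwedge (fun u => - lie Y (om t) k.1 y u + beta k.1 y u) (om t k.1 y)) v
     - cwedge drc (p1 (fun u => lie Y (im_form (U t)) k.1 y u + im_form gamma k.1 y u)) v).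
Proof.
have ky : cimg k.1 y := prod_cimg kx.
apply: (has_tderiv_ext (f := fun s => 2^-1 * cwedge (p1 (om s k.1 y)) (p1 (om s k.1 y)) v +
    (-1) * cwedge drc (p1 (im_form (U s) k.1 y)) v)) => //.
  by move=> s Ts; rewrite (psi_G2 (CY Ts) kx) /psi7 mulN1r.
set o' := fun u => - lie Y (om t) k.1 y u + beta k.1 y u.
set i' := fun u => lie Y (im_form (U t)) k.1 y u + im_form gamma k.1 y u.
have d1 u : has_tderiv T (fun s => p1 (om s k.1 y) u) t (p1 o' u) by exact: dom.
have d2 u : has_tderiv T (fun s => p1 (im_form (U s) k.1 y) u) t (p1 i' u).
  have := dU.2 k.1 y (lsubmx u) ky; by rewrite {2}/im_form cImD.
have H := has_tderivD (has_tderivZ (c := 2^-1) (has_tderiv_cwedge (v := v : 'M[R]_(2 + 2, 6 + 1)) d1 d1))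
  (has_tderivZ (c := -1) (has_tderiv_cwedge (v := v : 'M[R]_(1 + 3, 6 + 1)) (fun u => has_tderiv_cst T t (drc u)) d2)).
move: H; rewrite -[fun u => 0]/(fun=> 0) cwedge0l add0r mulN1r.
(* The two terms in the derivative of omega /\ omega coincide, which absorbs the factor 1/2. *)
rewrite (cwedge22C (p1 (om t k.1 y)) (p1 o')) cwedge_p1.
by have -> : 2^-1 * (p1 (cwedge o' (om t k.1 y)) v + p1 (cwedge o' (om t k.1 y)) v) =
  p1 (cwedge o' (om t k.1 y)) v by lra.
Qed.

Let f := norm_U (om t) (U t).
Let dlogf := dfun (log_norm_U (om t) (U t)).

Lemma coflow_at :
  (form_tderiv T (fun s => psi (phi s)) t
       (fun i x v =>
          laplacian4 (phi t) (psi (phi t)) i x v +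
          ext_d (fscale (fun j y => A - 7%:R / 2%:R * tau0 (phi t) j y)
                        (phi t)) i x v)) <->
  (form_eq (fwedge beta (om t))
       (fscale (fun i x => - A * (f i x)^-1)
          (fwedge dlogf (re_form (U t)))) /\
     form_eq (im_form gamma)
       (fscale (fun i x => A * f i x) (fwedge dlogf (om t)))).
Proof.
have CYt := CY Tt.
have fom : is_form (om t) by case: CYt => _ [].
have fre : is_form (re_form (U t)) by case: CYt => _ _ [[]].
(* [a] and [b] are the defects of the two conditions, the second with its sign reversed; the
   coefficients 1 and -1 match the shape of [alt_lin]. *)
pose a (i : cidx X) y : covector R R 4 6 := fun u => 1 * cwedge (beta i y) (om t i y) u +
  (A * (f i y)^-1) * cwedge (dlogf i y) (re_form (U t) i y) u.
pose b (i : cidx X) y : covector R R 3 6 := fun u => (-1) * im_form gamma i y u +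
  (A * f i y) * cwedge (dlogf i y) (om t i y) u.
have al (i : cidx X) y : cimg i y -> alternating (dlogf i y).
  by move=> iy; rewrite /dlogf -(cov_dlog oX CYt iy); exact: cov_alt.
have aa (i : cidx X) y : cimg i y -> alternating (a i y).
  move=> iy; have [[hb _ _] [ho _ _] [hr _ _]] := And3 fbeta fom fre.
  apply: (alt_lin 1 (A * (f i y)^-1) (cwedge_alt (hb i y iy) (ho i y iy))).
  exact: (cwedge_alt (al i y iy) (hr i y iy)).
have ab (i : cidx X) y : cimg i y -> alternating (b i y).
  move=> iy; have [[_ [hg _ _]] [ho _ _]] := conj fgamma fom.
  exact: (alt_lin (-1) (A * f i y) (hg i y iy) (cwedge_alt (al i y iy) (ho i y iy))).
have E : (form_tderiv T (fun s => psi (phi s)) t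
       (fun i x v =>
          laplacian4 (phi t) (psi (phi t)) i x v +
          ext_d (fscale (fun j y => A - 7%:R / 2%:R * tau0 (phi t) j y)
                        (phi t)) i x v)) <->
    (forall (k : cidx XS) (x : 'rV[R]_(6 + 1)), cimg k x ->
      forall v, p1 (a k.1 (l6 x)) v + cwedge drc (p1 (b k.1 (l6 x))) v = 0).
  (* The derivative of [psi] given by the evolution equations, minus the right-hand side of the
     coflow: the Lie derivative terms cancel and the defects remain. *)
  have D (k : cidx XS) (x : 'rV[R]_(6 + 1)) v : cimg k x ->
      (p1 (cwedge (fun u => - lie Y (om t) k.1 (l6 x) u + beta k.1 (l6 x) u) (om t k.1 (l6 x))) v
     - cwedge drc (p1 (fun u => lie Y (im_form (U t)) k.1 (l6 x) u + im_form gamma k.1 (l6 x) u)) v) -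
     (laplacian4 (phi t) (psi (phi t)) k x v +
          ext_d (fscale (fun j y => A - 7%:R / 2%:R * tau0 (phi t) j y)
                        (phi t)) k x v) =
     p1 (a k.1 (l6 x)) v + cwedge drc (p1 (b k.1 (l6 x))) v.
    move=> kx; have ky := prod_cimg kx.
    rewrite (d_torsion_G2 oX CYt A v kx) /laplacian4 (d_codiff4_G2 oX CYt v kx).
    rewrite (codiff5_G2 oX CYt v kx) addr0 /dphi7 !cwedge_p1 (cov_dlog oX CYt ky).
    have -> : (fun u => - lie Y (om t) k.1 (l6 x) u + beta k.1 (l6 x) u) =
       fun u => (-1) * lie Y (om t) k.1 (l6 x) u + 1 * beta k.1 (l6 x) u.
      by apply: funext => u; rewrite mulN1r mul1r.
    have -> : p1 (fun u => lie Y (im_form (U t)) k.1 (l6 x) u + im_form gamma k.1 (l6 x) u) =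
       fun u => 1 * p1 (lie Y (im_form (U t)) k.1 (l6 x)) u + 1 * p1 (im_form gamma k.1 (l6 x)) u.
      by apply: funext => u; rewrite !mul1r.
    have -> : p1 (b k.1 (l6 x)) = fun u => (-1) * p1 (im_form gamma k.1 (l6 x)) u +
      (A * f k.1 (l6 x)) * p1 (cwedge (dlogf k.1 (l6 x)) (om t k.1 (l6 x))) u by [].
    rewrite !cwedge_linr /p1 cwedge_linl -/Y -/f -/dlogf.
    rewrite /a; ring.
  split=> [h k x kx v|h k x v kx].
    (* Uniqueness of the time derivative turns the coflow equation into an equality of forms at time
       [t]. *)
    by rewrite -D // -(has_tderiv_unique iT Tt uT (h k x v kx) (@psi_tderiv _ _ kx v)) subrr.
  have := D k x v kx; rewrite h // => /eqP; rewrite subr_eq0 => /eqP <-.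
  exact: psi_tderiv.
rewrite E; split=> [h|[h1 h2] k x kx].
  have S (i : cidx X) y : cimg i y -> (forall u, a i y u = 0) /\ (forall u, b i y u = 0).
    move=> iy; apply/product_split; [exact: aa|exact: ab|].
    (* The angle pi lies in the circle chart of index 0, so every point of a chart of [N] is the
       projection of a point of a product chart. *)
    have := h (i, 0) (row_mx y (const_mx pi)); rewrite row_mxKl; apply.
    rewrite cimg_prod /= row_mxKl row_mxKr; split=> //.
    rewrite cimg_circle /= mxE add0r pi_gt0 /=.
    by have := pi_gt0 R; lra.
  split=> i y u iy; have [a0 b0] := S i y iy.
    have := a0 u; rewrite /a /fscale /fwedge mul1r => /eqP; rewrite addr_eq0 => /eqP ->.
    by rewrite mulNr mulNr.
  have := b0 u; rewrite /b /fscale /fwedge mulN1r => /eqP; rewrite addrC subr_eq0 => /eqP ->.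
  by [].
have ky : cimg k.1 (l6 x) := prod_cimg kx.
apply/product_split; [exact: aa|exact: ab|split=> u].
  have := h1 k.1 (l6 x) u ky; rewrite /fwedge /fscale /a => ->; rewrite /fwedge; ring.
have := h2 k.1 (l6 x) u ky; rewrite /fscale /b => ->; rewrite /fwedge; ring.
Qed.

End Evolution.

Theorem theorem2p3 (R : realType) (N : topologicalType) (X : charts R 6 N)
  (J0 : endo X) (omega0 : kform R X 2) (Upsilon0 : kform (complex R) X 3)
  (A : R) (T : set R)
  (J : R -> endo X) (omega : R -> kform R X 2) (Upsilon : R -> kform (complex R) X 3)
  (beta : R -> kform R X 2) (gamma : R -> kform (complex R) X 3) :
  (* N is a compact Calabi-Yau 3-manifold *)
  hausdorff_space N -> compact [set: N] -> smooth_atlas X ->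
  calabi_yau J0 omega0 Upsilon0 ->
  (* T is the time interval, which may contain end points *)
  is_interval T -> T 0 -> (exists2 t, T t & t != 0) ->
  (forall t, T t -> calabi_yau (J t) (omega t) (Upsilon t)) ->
  smooth_family T omega -> smooth_cfamily T Upsilon ->
  form_eq (omega 0) omega0 -> form_eq (Upsilon 0) Upsilon0 ->
  (forall t, T t -> is_form (beta t) /\ is_cform (gamma t)) ->
  (forall t, T t ->
     let Y := grad_log_norm_U (J t) (omega t) (Upsilon t) in
     form_tderiv T omega t
       (fun i x v => - lie Y (omega t) i x v + beta t i x v) /\
     cform_tderiv T Upsilon t
       (fun i x v => clie Y (Upsilon t) i x v + gamma t i x v)) ->
  modified_laplacian_coflow A T (fun t => G2_form (omega t) (Upsilon t)) <->
  (forall t, T t ->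
     let f := norm_U (omega t) (Upsilon t) in
     let dlogf := dfun (log_norm_U (omega t) (Upsilon t)) in
     form_eq (fwedge (beta t) (omega t))
       (fscale (fun i x => - A * (f i x)^-1)
          (fwedge dlogf (re_form (Upsilon t)))) /\
     form_eq (im_form (gamma t))
       (fscale (fun i x => A * f i x) (fwedge dlogf (omega t)))).
Proof.
move=> _ _ [_ aX _] _ iT T0 [t1 Tt1 t10] CY _ _ _ _ fbg ev.
have oX (i : cidx X) : open (cimg i) by have [] := aX i.
(* Every time needs a second time of [T] for uniqueness of derivatives: [t1] serves for t = 0, and 0
   for all others. *)
have uT t : exists2 u, T u & u != t.
  by have [->|t0] := eqVneq t 0; [exists t1|exists 0 => //; rewrite eq_sym].
split=> [[_ h] t Tt|h].
  have [fb fg] := fbg t Tt; have [dom dU] := ev t Tt.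
  exact/(coflow_at A oX iT Tt (uT t) CY fb fg dom dU)/h.
split=> t Tt; first by move=> k x kx; exact: (G2_form_metrics (CY t Tt) kx).
have [fb fg] := fbg t Tt; have [dom dU] := ev t Tt.
exact/(coflow_at A oX iT Tt (uT t) CY fb fg dom dU)/h.
Qed.
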